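(* Let $d\ge2$ and let $\Omega\subset\mathbb{R}^d$ be a bounded (polygonal) domain such that the closure of $\Omega$ is of uniformly positive reach $r_\Omega>0$. Suppose $f$ and $g$ are continuous over $\overline{\Omega}$. Let $u$ be the solution of $-\Delta u=f$ in $\Omega$, $u=g$ on $\partial\Omega$, let $\epsilon_1>0$ be the given tolerance, and let $u_s$ be the spline collocation solution defined in the context over a triangulation $\triangle$ of $\Omega$ whose size $|\triangle|$ is sufficiently small. Suppose that $u\in H^3(\Omega)$ and $(u-u_s)|_{\partial\Omega}=0$. Then $$\|u-u_s\|_{L^2(\Omega)}\le C\epsilon_1,\qquad\|\nabla(u-u_s)\|_{L^2(\Omega)}\le C\epsilon_1,$$ and $$\sum_{i,j=1}^d\Big\|\frac{\partial^2}{\partial x_i\partial x_j}(u-u_s)\Big\|_{L^2(\Omega)}\le C\epsilon_1$$ for a positive constant $C$ depending on $A$ and $\Omega$, where $A>0$ is a constant such that $A\|v\|_{H^2}\le\|\Delta v\|_{L^2(\Omega)}$ for all $v\in H^2(\Omega)\cap H_0^1(\Omega)$.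
   Context: Norm: $\|v\|_{H^2}=\|v\|_{L^2(\Omega)}+\|\nabla v\|_{L^2(\Omega)}+\sum_{i,j=1}^d\|\frac{\partial^2 v}{\partial x_i\partial x_j}\|_{L^2(\Omega)}$. Reach: for non-empty $K\subseteq\mathbb{R}^d$, $r_K$ is the supremum of the $r$ such that every point of $\{x:\mathrm{dist}(x,K)<r\}$ has a unique projection in $K$; $K$ has positive reach if $r_K>0$. With $B(0,\epsilon)$ the closed ball, $E_\epsilon(K)=(K^c+B(0,\epsilon))^c$ for $\epsilon>0$, $E_0(K)=K$; $K$ has uniformly positive reach $r_0$ if for some $\epsilon_0>0$ every $E_\epsilon(K)$, $\epsilon\in[0,\epsilon_0]$, has positive reach at least $r_0$. Splines: $\triangle$ is a quasi-uniform triangulation (tetrahedralization if $d=3$) of $\Omega$, i.e. the ratio of longest edge to inradius of all its simplices is bounded by a fixed constant; $|\triangle|$ is its longest edge length. $S_D^{-1}(\triangle)$ is the space of (discontinuous) piecewise polynomials of degree $D$ over $\triangle$; each $s$ in it is identified with its vector $\mathbf{c}$ of Bernstein–Bézier coefficients on all simplices. $S^r_D(\triangle)=C^r(\Omega)\cap S^{-1}_D(\triangle)$, with $r\ge 2$ and $D$ large enough ($D\ge3r+2$ if $d=2$, $D\ge6r+3$ if $d=3$). The domain points of degree $D'$ of a simplex $T=\langle v_1,\dots,v_{d+1}\rangle$ are the points $\frac{1}{D'}\sum_k i_kv_k$ with integers $i_k\ge0$, $\sum_k i_k=D'$; those of $\triangle$ are the union over all $T\in\triangle$. Fix $D'>D$.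 Collocation: $K$ is the matrix such that $K\mathbf{c}$ is the vector of values of $\Delta s$ at the domain points of degree $D'$ (evaluated on each simplex), and $\mathbf{f}$ is the vector of values of $f$ there. $B\mathbf{c}$ and $\mathbf{g}$ are the vectors of values of $s$ and $g$ at the domain points on $\partial\Omega$. $H_0,H_r$ are matrices of smoothness conditions across interior faces: $H_0\mathbf{c}=0$ iff $s\in C^0(\Omega)$, $H_r\mathbf{c}=0$ iff $s\in C^r(\Omega)$. Fix $\alpha,\beta,\gamma>0$. The spline solution $u_s\in S^r_D(\triangle)$ is the spline whose coefficient vector is the minimizer of $$\min_{\mathbf{c}}\tfrac12\left(\alpha\|B\mathbf{c}-\mathbf{g}\|^2+\beta\|H_r\mathbf{c}\|^2+\gamma\|H_0\mathbf{c}\|^2\right)\quad\text{subject to }\|K\mathbf{c}+\mathbf{f}\|\le\epsilon_1.$$ ''$|\triangle|$ sufficiently small'' means below a threshold that may depend on $u$ and $\epsilon_1$; the constant $C$ does not depend on $|\triangle|$ or $\epsilon_1$. *)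

(* Defs.v *)
From HB Require Import structures.
From mathcomp Require Import all_boot all_order all_algebra.
From mathcomp Require Import all_classical all_reals all_analysis.
Set Implicit Arguments.
Unset Strict Implicit.
Unset Printing Implicit Defensive.
Import Order.TTheory GRing.Theory Num.Theory.
Import numFieldNormedType.Exports.
Local Open Scope classical_set_scope.
Local Open Scope ring_scope.

(* 'rV[R]_n carries the product sigma-algebra of n copies of the Borel
   sigma-algebra of R, which is the Borel sigma-algebra of R^n. *)
Definition measure_rV_display : measure_display.
Proof. exact. Qed.

Section measurable_rV.
Variables (R : realType) (n : nat).

Let coor : 'I_n -> 'rV[R]_n -> measurableTypeR R := fun i x => x ord0 i.

Let rV_set0 : g_sigma_preimage coor set0.
Proof. exact: sigma_algebra0. Qed.

Let rV_setC A : g_sigma_preimage coor A -> g_sigma_preimage coor (~` A).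
Proof. exact: sigma_algebraC. Qed.

Let rV_bigcup (F : _^nat) : (forall i, g_sigma_preimage coor (F i)) ->
  g_sigma_preimage coor (\bigcup_i (F i)).
Proof. exact: sigma_algebra_bigcup. Qed.

HB.instance Definition _ := @isMeasurable.Build measure_rV_display
  'rV[R]_n (g_sigma_preimage coor) rV_set0 rV_setC rV_bigcup.

Lemma measurable_coord (i : 'I_n) :
  measurable_fun [set: 'rV[R]_n] (fun x => x ord0 i : R).
Proof.
move=> _ Y mY; rewrite setTI; apply: sub_sigma_algebra => /=.
rewrite -bigcup_seq/=; exists i => /=; first by rewrite mem_index_enum.
by exists Y => //; rewrite setTI.
Qed.

Lemma measurable_rV d (T : measurableType d) (f : T -> 'rV[R]_n) :
  (forall i, measurable_fun setT (fun t => f t ord0 i : measurableTypeR R)) ->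
  measurable_fun setT f.
Proof.
move=> mf; apply: (@measurability _ _ _ _ _ _
  (\big[setU/set0]_(i < n) preimage_set_system setT (coor i) measurable)) => //.
move=> _ [A +] <-; rewrite -bigcup_seq/= => -[i _ [B mB <-]].
rewrite !setTI -comp_preimage -[_ @^-1` _]setTI.
exact: mf.
Qed.

End measurable_rV.

Section lebesgue_rV.
Variable R : realType.

Definition cons_rV n (p : measurableTypeR R * 'rV[R]_n) : 'rV[R]_n.+1 :=
  row_mx (const_mx p.1 : 'rV_1) p.2.

Lemma cons_rV0 n p : @cons_rV n p ord0 ord0 = p.1.
Proof. by rewrite mxE; case: splitP => // j _; rewrite mxE. Qed.

Lemma cons_rVS n p (j : 'I_n) : @cons_rV n p ord0 (lift ord0 j) = p.2 ord0 j.
Proof.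
rewrite mxE; case: splitP => [k|k] /=; first by rewrite ord1.
by rewrite /bump /= => -[jk]; congr (_ _ _); exact: val_inj.
Qed.

Lemma measurable_cons_rV n : measurable_fun setT (@cons_rV n).
Proof.
apply: measurable_rV => i; case: (unliftP ord0 i) => [j ->|->].
- under eq_fun do rewrite cons_rVS.
  apply: (measurableT_comp
    (f := fun x : 'rV[R]_n => x ord0 j : measurableTypeR R)) => //.
  exact: measurable_coord.
- by under eq_fun do rewrite cons_rV0; exact: measurable_fst.
Qed.

Section step.
Variables (n : nat) (m : {sigma_finite_measure set 'rV[R]_n -> \bar R}).

Let mcons := measurable_cons_rV (n := n).

Definition lebesgue_rV_step : set 'rV[R]_n.+1 -> \bar R :=
  pushforward (@lebesgue_measure R \x m)%E (@cons_rV n).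

Let step0 : lebesgue_rV_step set0 = 0%E.
Proof. by rewrite /lebesgue_rV_step /pushforward preimage_set0 measure0. Qed.

Let step_ge0 A : (0 <= lebesgue_rV_step A)%E.
Proof. exact: measure_ge0. Qed.

Let step_sigma_additive : semi_sigma_additive lebesgue_rV_step.
Proof.
exact: measure_semi_sigma_additive.
Qed.

HB.instance Definition _ := isMeasure.Build _ _ _ lebesgue_rV_step
  step0 step_ge0 step_sigma_additive.

Let step_sigma_finite : sigma_finite setT lebesgue_rV_step.
Proof.
have [F TF Foo] : sigma_finite setT (@lebesgue_measure R \x m)%E.
  have /sigma_finiteP[F [TF ndF Foo]] := sigma_finiteT (@lebesgue_measure R).
  have /sigma_finiteP[G [TG ndG Goo]] := sigma_finiteT m.
  exists (fun k => F k `*` G k).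
    rewrite -setXTT TF TG; apply/seteqP; split=> -[x y]/=.
      move=> [[i _ Fix] [j _ Gjy]]; exists (maxn i j) => //; split.
      - by move: x Fix; exact/subsetPset/ndF/leq_maxl.
      - by move: y Gjy; exact/subsetPset/ndG/leq_maxr.
    by move=> [k _ [? ?]]; split; exists k.
  move=> k; have [? ?] := Foo k; have [? ?] := Goo k.
  split; first exact: measurableX.
  by rewrite product_measure1E// lte_mul_pinfty// ge0_fin_numE.
pose uncons (x : 'rV[R]_n.+1) : measurableTypeR R * 'rV[R]_n :=
  (x ord0 ord0, \row_j x ord0 (lift ord0 j)).
have consK : cancel (@cons_rV n) uncons.
  move=> [a y]; rewrite /uncons cons_rV0; congr pair.
  by apply/rowP => j; rewrite mxE cons_rVS.
have unconsK : cancel uncons (@cons_rV n).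
  move=> x; apply/rowP => i.
  case: (unliftP ord0 i) => [j ->|->]; first by rewrite cons_rVS mxE.
  by rewrite cons_rV0.
have muncons : measurable_fun setT uncons.
  apply: measurable_fun_pair; first exact: measurable_coord.
  apply: measurable_rV => j; under eq_fun do rewrite mxE.
  exact: measurable_coord.
exists (fun k => uncons @^-1` F k).
  by rewrite -preimage_bigcup -TF preimage_setT.
move=> k; split.
  by rewrite -[X in measurable X]setTI; apply: muncons => //; exact: (Foo k).1.
rewrite /lebesgue_rV_step /pushforward -comp_preimage.
by rewrite (_ : uncons \o _ = id) ?preimage_id; [exact: (Foo k).2|apply/funext].
Qed.

HB.instance Definition _ := Measure_isSigmaFinite.Build _ _ _ lebesgue_rV_step
  step_sigma_finite.
End step.

Definition lebesgue_rV0 : set 'rV[R]_0 -> \bar R := \d_ (0 : 'rV[R]_0).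

HB.instance Definition _ := Measure.on lebesgue_rV0.

Let lebesgue_rV0_sigma_finite : sigma_finite setT lebesgue_rV0.
Proof.
apply: fin_num_fun_sigma_finite; first by rewrite measure0.
by move=> A mA; rewrite /lebesgue_rV0 diracE.
Qed.

HB.instance Definition _ := Measure_isSigmaFinite.Build _ _ _ lebesgue_rV0
  lebesgue_rV0_sigma_finite.

(* Lebesgue measure on R^n, as the n-fold product of lebesgue_measure. *)
Fixpoint lebesgue_rV n : {sigma_finite_measure set 'rV[R]_n -> \bar R} :=
  match n with
  | 0 => lebesgue_rV0
  | n'.+1 => lebesgue_rV_step (lebesgue_rV n')
  end.
End lebesgue_rV.

Section geometry.
Variables (R : realType) (d : nat).
Notation E := 'rV[R]_d.
Implicit Types (K S Omega : set E) (x : E).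

(* The library norm on matrices is the sup norm; this is the Euclidean one. *)
Definition enorm m n (M : 'M[R]_(m, n)) : R :=
  Num.sqrt (\sum_i \sum_j M i j ^+ 2).

Definition edist x K : R := inf [set enorm (x - y) | y in K].

Definition is_projection K x y := K y /\ enorm (x - y) = edist x K.

Definition reach K : \bar R :=
  ereal_sup [set r%:E | r in [set r : R |
    forall x, edist x K < r -> exists! y, is_projection K x y]].

Definition erosion (e : R) K : set E :=
  ~` [set x + y | x in ~` K & y in [set y : E | enorm y <= e]].

(* The closed ball of radius 0 is a point, so erosion 0 K = K. *)
Definition uniformly_positive_reach K (r0 : R) :=
  exists2 e0 : R, 0 < e0 & forall e, 0 <= e <= e0 ->
    erosion e K !=set0 /\ (r0%:E <= reach (erosion e K))%E.

Definition chull S : set E :=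
  [set x | exists n (P : 'M[R]_(n, d)) (w : 'rV[R]_n),
    [/\ forall i, S (row i P), forall i, 0 <= w ord0 i,
        \sum_i w ord0 i = 1 & x = w *m P]].

Definition bdry Omega : set E := closure Omega `\` interior Omega.

(* Polygonal: the boundary is a finite union of convex polytopes. *)
Definition polygonal_domain Omega :=
  [/\ open Omega, connected Omega, Omega !=set0, bounded_set Omega &
      exists F : seq (seq E),
        bdry Omega = \bigcup_(s in [set` F]) chull [set` s]].

End geometry.

Section smoothness.
Variables (R : realType) (d : nat).
Notation E := 'rV[R]_d.

Definition partial (i : 'I_d) (f : E -> R) : E -> R :=
  fun x => 'D_(delta_mx ord0 i : E) f x.

Definition laplacian (f : E -> R) : E -> R :=
  fun x => \sum_i partial i (partial i f) x.

Fixpoint Ck (k : nat) (U : set E) (f : E -> R) : Prop :=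
  (forall x, U x -> {for x, continuous f}) /\
  if k is k'.+1 then forall i : 'I_d,
    (forall x, U x -> derivable f x (delta_mx ord0 i)) /\ Ck k' U (partial i f)
  else True.

End smoothness.

Section sobolev.
Variables (R : realType) (d : nat).
Notation E := 'rV[R]_d.
Notation mu := (lebesgue_rV R d).
Variable Omega : set E.

Definition norm2 (v : E -> R) : \bar R :=
  'N[mu]_(2%:E)[EFin \o (v \_ Omega)].

Definition in_L2 (v : E -> R) :=
  measurable_fun Omega v /\ (norm2 v < +oo)%E.

Definition test_function (phi : E -> R) :=
  [/\ forall k, Ck k setT phi, compact (closure [set x | phi x != 0]) &
      closure [set x | phi x != 0] `<=` Omega].

Definition weak_partial (i : 'I_d) (v w : E -> R) :=
  forall phi, test_function phi ->
    (\int[mu]_(x in Omega) (v x * partial i phi x)%:E =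
     - \int[mu]_(x in Omega) (w x * phi x)%:E)%E.

(* sobolev m v: v belongs to H^m(Omega). *)
Fixpoint sobolev (m : nat) (v : E -> R) : Prop :=
  in_L2 v /\
  if m is m'.+1 then forall i, exists2 w, weak_partial i v w & sobolev m' w
  else True.

(* A representative of the weak derivative of v (unique almost everywhere) when
   there is one in L^2(Omega), and 0 otherwise. *)
Definition wpartial (i : 'I_d) (v : E -> R) : E -> R :=
  xget (fun=> 0) [set w | in_L2 w /\ weak_partial i v w].

Definition norm2_grad (v : E -> R) : \bar R :=
  norm2 (fun x => Num.sqrt (\sum_i wpartial i v x ^+ 2)).

Definition norm2_hess (v : E -> R) : \bar R :=
  (\sum_(i < d) \sum_(j < d) norm2 (wpartial i (wpartial j v)))%E.

Definition normH1 (v : E -> R) : \bar R := (norm2 v + norm2_grad v)%E.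

Definition normH2 (v : E -> R) : \bar R :=
  (norm2 v + norm2_grad v + norm2_hess v)%E.

Definition wlaplacian (v : E -> R) : E -> R :=
  fun x => \sum_i wpartial i (wpartial i v) x.

(* H^1_0(Omega): the closure of the test functions in H^1(Omega). *)
Definition sobolev10 (v : E -> R) :=
  sobolev 1 v /\ forall e : R, 0 < e ->
    exists2 phi, test_function phi & (normH1 (v \- phi)%R < e%:E)%E.

(* Weak solutions of - Delta u = f in Omega, u = g on the boundary; boundary
   values are those of u as a continuous function on the closure of Omega. *)
Definition poisson_solution (f g u : E -> R) :=
  [/\ {within closure Omega, continuous u},
      {ae mu, forall x, Omega x -> - wlaplacian u x = f x} &
      forall x, bdry Omega x -> u x = g x].

End sobolev.

Section splines.
Variables (R : realType) (d : nat).
Notation E := 'rV[R]_d.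

(* A simplex is given by the matrix whose rows are its d + 1 vertices. *)
Notation simplex := 'M[R]_(d.+1, d).

Definition vertices (T : simplex) : set E := [set row k T | k in setT].

Definition body (T : simplex) : set E := chull (vertices T).

Definition affine_mx (T : simplex) : 'M[R]_d.+1 :=
  row_mx (const_mx 1 : 'cV[R]_d.+1) T.

(* The row vector b with b *m affine_mx T = (1, x), that is, with entries of
   sum 1 and b *m T = x. *)
Definition barycentric (T : simplex) (x : E) : 'rV[R]_d.+1 :=
  (row_mx (const_mx 1 : 'rV[R]_1) x : 'rV[R]_d.+1) *m invmx (affine_mx T).

Definition longest_edge (T : simplex) : R :=
  \big[Num.max/0]_(i < d.+1) \big[Num.max/0]_(j < d.+1)
    enorm (row i T - row j T).

Definition inradius (T : simplex) : R :=
  sup [set r : R | 0 <= r /\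
    exists x : E, forall y : E, enorm (y - x) <= r -> body T y].

Definition is_triangulation (Omega : set E) n (T : 'I_n -> simplex) :=
  [/\ forall k, affine_mx (T k) \in unitmx,
      closure Omega = \bigcup_k body (T k),
      forall j k, vertices (T j) = vertices (T k) -> j = k &
      forall j k, body (T j) `&` body (T k) =
                  chull (vertices (T j) `&` vertices (T k))].

Definition quasi_uniform n (T : 'I_n -> simplex) (kappa : R) :=
  forall k, longest_edge (T k) <= kappa * inradius (T k).

Definition mesh_size n (T : 'I_n -> simplex) : R :=
  \big[Num.max/0]_(k < n) longest_edge (T k).

(* Multi-indices (a_0, ..., a_d) with a_0 + ... + a_d = D. *)
Definition multi_index D :=
  {a : {ffun 'I_d.+1 -> 'I_D.+1} | (\sum_k (a k : nat))%N == D}.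

Definition bernstein D (a : multi_index D) (b : 'rV[R]_d.+1) : R :=
  D`!%:R / (\prod_k ((val a k)`!)%:R) * \prod_k b ord0 k ^+ val a k.

Definition domain_point (T : simplex) D (a : multi_index D) : E :=
  D%:R^-1 *: \sum_k (val a k)%:R *: row k T.

Section triangulation.
Variables (Omega : set E) (n : nat) (T : 'I_n -> simplex).

(* The Bernstein-Bezier coefficients of degree D, and the domain points of
   degree D counted on each simplex, are indexed by node D. *)
Definition node D : finType := ('I_n * multi_index D)%type.

Definition node_point D (p : node D) : E := domain_point (T p.1) p.2.

(* The polynomial on T k of the spline with coefficient vector c. *)
Definition piece D (c : 'cV[R]_#|node D|) (k : 'I_n) (x : E) : R :=
  \sum_(a : multi_index D)
    c (enum_rank ((k, a) : node D)) ord0 * bernstein a (barycentric (T k) x).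

Definition represents D (c : 'cV[R]_#|node D|) (X : set E) (s : E -> R) :=
  forall k x, body (T k) x -> X x -> s x = piece c k x.

Definition smoothness_matrix D r m (H : 'M[R]_(m, #|node D|)) :=
  forall c, H *m c = 0 <-> exists2 s, Ck r Omega s & represents c Omega s.

Definition laplace_matrix D D' (K : 'M[R]_(#|node D'|, #|node D|)) :=
  forall c (i : 'I_#|node D'|), (K *m c) i ord0 =
    laplacian (piece c (enum_val i).1) (node_point (enum_val i)).

Definition node_values D' (f : E -> R) : 'cV[R]_#|node D'| :=
  \col_i f (node_point (enum_val i)).

Definition bdry_nodes D' : {set node D'} :=
  finset (fun p => `[< bdry Omega (node_point p) >]).

Definition bdry_matrix D D' (B : 'M[R]_(#|bdry_nodes D'|, #|node D|)) :=
  forall c (i : 'I_#|bdry_nodes D'|), (B *m c) i ord0 =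
    piece c (enum_val i).1 (node_point (enum_val i)).

Definition bdry_values D' (g : E -> R) : 'cV[R]_#|bdry_nodes D'| :=
  \col_i g (node_point (enum_val i)).

End triangulation.

Section collocation.
Variables (m0 mr mK mB N : nat) (alpha beta gamma eps1 : R).
Variables (H0 : 'M[R]_(m0, N)) (Hr : 'M[R]_(mr, N)) (K : 'M[R]_(mK, N)).
Variables (B : 'M[R]_(mB, N)) (fv : 'cV[R]_mK) (gv : 'cV[R]_mB).

Definition feasible (c : 'cV[R]_N) := enorm (K *m c + fv) <= eps1.

Definition objective (c : 'cV[R]_N) : R :=
  2^-1 * (alpha * enorm (B *m c - gv) ^+ 2 + beta * enorm (Hr *m c) ^+ 2 +
          gamma * enorm (H0 *m c) ^+ 2).

Definition spline_solution (c : 'cV[R]_N) :=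
  feasible c /\ forall c', feasible c' -> objective c <= objective c'.

End collocation.

End splines.

(* Main.v *)
(** Put v = u - u_s, so that -Delta v = f + Delta u_s almost everywhere. On a simplex, Delta u_s + f(x0)
is a polynomial of degree less than D'; at the domain points of degree D' the constraint of the
collocation problem and the uniform continuity of f bound it by 2 eps1 when the mesh is fine,
and Lagrange interpolation in barycentric coordinates then bounds it on the whole simplex by a
multiple of eps1 depending only on d and D'. Hence the L^2 norm of Delta v is at most
C eps1 |Omega|^(1/2), and the a priori estimate A |v|_{H^2} <= |Delta v|_{L^2} concludes.

It remains to see that v, which is continuous up to the boundary with zero boundary values, lies in
H^1_0. For this no regularity of the boundary is needed: if rho_k are mollifiers and G_m is a smooth
function vanishing near 0 with |G_m(t) - t| <= 2/(m+1), then G_m(rho_k * v) is, for k large, a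
test function, and as k and then m go to infinity it converges to v in L^2 while its gradient converges to
the restriction of grad v to the set where v is nonzero, which therefore is a weak gradient of v. *)

(* Lebesgue measure on ['rV[R]_n] is an iterated product, and this dictates the form of the
   mollifiers: they are tensor products of one-variable kernels, so their integrals and their
   convolutions with boxes factor into one-dimensional integrals known from an explicit primitive.
   Convergence of mollifications in L^2 then spreads from boxes to measurable sets by Dynkin's
   lemma, and from there to L^2 functions through simple functions, mollification being a
   contraction of L^2. [wpartial] chooses a representative of each weak derivative independently of
   the others, so it is linear only almost everywhere. Relating [wlaplacian] of [u - us] to that of
   [u] therefore rests on the uniqueness of weak derivatives. Polynomials on a simplex are treated
   as homogeneous polynomials in its barycentric coordinates; constants and derivatives are
   multiplied by powers of the coordinate sum, which equals 1 there, so that everything keeps one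
   degree. In these coordinates all simplices look alike, hence the interpolation constant is blind
   to the triangulation. *)
Require Import Defs.
From HB Require Import structures.
From mathcomp Require Import all_boot all_order all_algebra.
From mathcomp Require Import all_classical all_reals all_analysis.
From mathcomp Require Import measurable_realfun zify ring lra.
Set Implicit Arguments.
Unset Strict Implicit.
Unset Printing Implicit Defensive.
Import Order.TTheory GRing.Theory Num.Theory.
Import numFieldNormedType.Exports.
Local Open Scope classical_set_scope.
Local Open Scope ring_scope.

(** * Borel and Lebesgue structure of R^n *)

Section rV_topology.
Variables (R : realType) (n : nat).
Implicit Types (x y : 'rV[R]_n) (A U : set 'rV[R]_n).

Lemma coord_norm_le x i : `|x ord0 i| <= `|x|.
Proof.
rewrite [leRHS](_ : _ = mx_norm x)// mx_normrE.
exact: (le_bigmax _ (fun ij => `|x ij.1 ij.2|) (ord0, i)).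
Qed.

Lemma rV_norm_lt x (e : R) : 0 < e -> (forall i, `|x ord0 i| < e) -> `|x| < e.
Proof.
move=> e0 xe; rewrite [ltLHS](_ : _ = mx_norm x)// mx_normrE.
by apply/bigmax_ltP; split=> // -[i j] _ /=; rewrite ord1.
Qed.

Lemma rV_norm_le x (e : R) : 0 <= e -> (forall i, `|x ord0 i| <= e) -> `|x| <= e.
Proof.
move=> e0 xe; rewrite [leLHS](_ : _ = mx_norm x)// mx_normrE.
by apply/bigmax_leP; split=> // -[i j] _ /=; rewrite ord1.
Qed.

(** The sigma-algebra is generated by the coordinates. In the sup norm an open set is the union of
    the cubes [B p] with rational centre and radius that it contains, and each cube is a finite
    intersection of coordinate preimages. *)
Lemma open_measurable_rV U : open U -> measurable U.
Proof.
move=> oU.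
pose B (p : 'rV[rat]_n * rat) : set 'rV[R]_n :=
  [set x | forall i, `|x ord0 i - ratr (p.1 ord0 i)| < ratr p.2].
have mB p : measurable (B p).
  rewrite (_ : B p = \bigcap_(i in [set: 'I_n])
    ((fun x : 'rV[R]_n => x ord0 i : R) @^-1`
       (ball (ratr (p.1 ord0 i) : R) (ratr p.2 : R)))); last first.
    apply/seteqP; split=> x /=.
      by move=> xB i _; rewrite /ball/= distrC; exact: xB.
    by move=> xB i; rewrite distrC; exact: xB.
  apply: fin_bigcap_measurable => // i _.
  rewrite -[X in measurable X]setTI; apply: measurable_coord => //.
  exact: measurable_ball.
(* Cubes not contained in [U] are replaced by [set0], so that the index set stays a countable
   type. *)
have -> : U = \bigcup_(p : 'rV[rat]_n * rat) (if `[< B p `<=` U >] then B p else set0).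
  apply/seteqP; split=> x; last first.
    by move=> [p _]; case: ifPn => // /asboolP; exact.
  move=> Ux; have /nbhs_ballP[e /= e0 eU] : nbhs x U by exact: open_nbhs_nbhs.
  (* A radius below [e / 2] suffices: every point of the cube is within [r] of its rational centre,
     and so is [x]. *)
  have [r /andP[r0 re]] : exists r : rat, (0 < (ratr r : R)) && ((ratr r : R) < e / 2).
    have [r] := @rat_in_itvoo R 0 (e / 2) ltac:(by rewrite divr_gt0).
    by rewrite in_itv /=; exists r.
  have /choice[q qP] : forall i, exists q : rat, `|x ord0 i - ratr q| < ratr r.
    move=> i; have [q] := @rat_in_itvoo R (x ord0 i - ratr r) (x ord0 i + ratr r)
      ltac:(lra).
    by rewrite in_itv/= => qi; exists q; rewrite ltr_norml; lra.
  have Bx : B (\row_i q i, r) x by move=> i; rewrite mxE; exact: qP.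
  exists (\row_i q i, r) => //; case: ifPn => // /asboolP; apply: contra_notP => _.
  move=> y By; apply: eU; rewrite -ball_normE /=; apply: rV_norm_lt => // i.
  rewrite !mxE; have := By i; have := Bx i; rewrite /= !mxE => h1 h2.
  rewrite (_ : x ord0 i - y ord0 i =
    (x ord0 i - ratr (q i)) - (y ord0 i - ratr (q i))); last by ring.
  rewrite (le_lt_trans (ler_normB _ _))//.
  by move: h1 h2 re; lra.
apply: countable_bigcupT_measurable => // p; case: ifP => // _; exact: measurable0.
Qed.

Lemma open_continuous_measurable_rV (D : set 'rV[R]_n) (f : 'rV[R]_n -> R) :
  open D -> (forall x, D x -> {for x, continuous f}) -> measurable_fun D f.
Proof.
move=> oD cf; apply: (measurability _ (RGenOInfty.measurableE R)) => //=.
move=> _ [_ [a ->] <-]; apply: open_measurable_rV.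
rewrite openE => x /= [Dx]; rewrite in_itv/= andbT => afx.
apply: filterI; first exact: open_nbhs_nbhs.
have /cvgr_gt/(_ a afx) := cf x Dx.
by apply: filterS => y /=; rewrite in_itv/= andbT.
Qed.

Lemma continuous_measurable_rV (f : 'rV[R]_n -> R) :
  continuous f -> measurable_fun setT f.
Proof.
by move=> cf; apply: open_continuous_measurable_rV => [|x _]; [exact: openT|exact: cf].
Qed.

End rV_topology.

Section rV_fubini.
Variable R : realType.

Lemma measurable_prod_coord n (h : 'I_n -> R -> R) :
  (forall i, measurable_fun setT (h i)) ->
  measurable_fun setT (fun x : 'rV[R]_n => \prod_i h i (x ord0 i)).
Proof.
move=> mh; apply: measurable_prod => i _.
apply: (measurableT_comp (mh i)).
exact: measurable_coord.
Qed.

Local Open Scope ereal_scope.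

Lemma ge0_integral_rVS n (f : 'rV[R]_n.+1 -> \bar R) :
  measurable_fun setT f -> (forall x, 0 <= f x) ->
  \int[lebesgue_rV R n.+1]_x f x =
  \int[@lebesgue_measure R]_t \int[lebesgue_rV R n]_y f (cons_rV (t, y)).
Proof.
move=> mf f0.
transitivity (\int[pushforward (@lebesgue_measure R \x lebesgue_rV R n)
   (@cons_rV R n)]_x f x) => //.
rewrite (@ge0_integral_pushforward _ _ _ _ _ _ (@measurable_cons_rV R n))//.
rewrite preimage_setT fubini_tonelli1//; last by move=> z; exact: f0.
by apply: measurableT_comp => //; exact: measurable_cons_rV.
Qed.

(** Fubini, since [lebesgue_rV R n.+1] is the image of a product measure under [cons_rV]. Both
    orders are kept because [integral_partial] integrates first over the block containing the
    differentiated coordinate. *)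
Lemma integral_rVS n (f : 'rV[R]_n.+1 -> \bar R) :
  (lebesgue_rV R n.+1).-integrable setT f ->
  \int[lebesgue_rV R n.+1]_x f x =
    \int[@lebesgue_measure R]_t \int[lebesgue_rV R n]_y f (cons_rV (t, y)) /\
  \int[lebesgue_rV R n.+1]_x f x =
    \int[lebesgue_rV R n]_y \int[@lebesgue_measure R]_t f (cons_rV (t, y)).
Proof.
move=> /integrableP[mf intf].
have intfc : (@lebesgue_measure R \x lebesgue_rV R n).-integrable
    (@cons_rV R n @^-1` setT) (f \o @cons_rV R n).
  apply/integrableP; split.
    by apply: measurableT_comp => //; exact: measurable_cons_rV.
  rewrite -(@ge0_integral_pushforward _ _ _ _ _ _ (@measurable_cons_rV R n) _ setT
    (fun x => `|f x|))//.
  by apply: measurableT_comp.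
have E : \int[lebesgue_rV R n.+1]_x f x =
    \int[@lebesgue_measure R \x lebesgue_rV R n]_z (f \o @cons_rV R n) z.
  transitivity (\int[pushforward (@lebesgue_measure R \x lebesgue_rV R n)
     (@cons_rV R n)]_x f x) => //.
  by rewrite (integral_pushforward (@measurable_cons_rV R n)) // preimage_setT.
rewrite preimage_setT in intfc.
by rewrite E; split; [rewrite -integral12_prod_meas1|rewrite -integral21_prod_meas1].
Qed.

(** Tonelli peels off one coordinate at a time. All integrals of mollifiers and boxes reduce to
    dimension one through this. *)
Lemma ge0_integral_prod_coord n (g : 'I_n -> R -> R) :
  (forall i, measurable_fun setT (g i)) -> (forall i t, (0 <= g i t)%R) ->
  \int[lebesgue_rV R n]_x (\prod_i g i (x ord0 i))%:E =
  \prod_i \int[@lebesgue_measure R]_t (g i t)%:E.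
Proof.
elim: n g => [|n IH] g mg g0.
  rewrite big_ord0 /=.
  under eq_integral do rewrite big_ord0.
  rewrite integral_cst// mul1e.
  by change (lebesgue_rV0 [set: 'rV[R]_0] = 1); rewrite /lebesgue_rV0 diracT.
have mprod := measurable_prod_coord.
rewrite ge0_integral_rVS; last 2 first.
- by apply/measurable_EFinP; apply: mprod.
- by move=> x; rewrite lee_fin prodr_ge0.
transitivity (\int[@lebesgue_measure R]_t ((g ord0 t)%:E *
    \prod_(i < n) \int[@lebesgue_measure R]_t (g (lift ord0 i) t)%:E)).
  apply: eq_integral => t _; rewrite -IH//.
  rewrite -ge0_integralZl//; first last.
  - by rewrite lee_fin.
  - by move=> x _; rewrite lee_fin prodr_ge0.
  - by apply/measurable_EFinP; apply: (mprod _ (fun i => g (lift ord0 i))) => i; exact: mg.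
  apply: eq_integral => y _; rewrite big_ord_recl cons_rV0 EFinM /=; congr (_ * _%:E).
  by apply: eq_bigr => i _; rewrite cons_rVS.
rewrite ge0_integralZr//; first by rewrite [RHS]big_ord_recl.
- by apply/measurable_EFinP; exact: mg.
- by move=> t _; rewrite lee_fin.
- by apply: prode_ge0 => i _; apply: integral_ge0 => t _; rewrite lee_fin.
Qed.

End rV_fubini.

(** * Smooth functions *)

Section directional_derivative.
Variables (R : realType) (V : normedModType R).
Implicit Types (f g : V -> R) (x v : V) (d : R).

Lemma is_deriveP f x v d : is_derive x v f d <->
  (h^-1 * (f (h *: v + x) - f x)) @[h --> 0^'] --> d.
Proof.
split=> [[df <-]|fd]; first exact: df.
by split; [apply/cvg_ex; exists d|exact: cvg_lim].
Qed.

Lemma is_derive_ext f g x v d : (\forall y \near x, f y = g y) ->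
  is_derive x v g d -> is_derive x v f d.
Proof.
move=> fg /is_deriveP gd; apply/is_deriveP; apply: cvg_trans gd.
have fgx := nbhs_singleton fg.
apply: near_eq_cvg.
have : (h *: v + x) @[h --> 0^'] --> x.
  have zv : (h *: v) @[h --> 0^'] --> (0 : R) *: v.
    by apply: (@cvgZr_tmp _ _ _ _ _ (fun h : R => h)); exact: cvg_within.
  have := cvgD zv (cvg_cst x); rewrite scale0r add0r; exact.
move=> zvx; have fgh : \forall h \near (0:R)^', f (h *: v + x) = g (h *: v + x) := zvx _ fg.
by near do rewrite fgx (near fgh _ _)//.
Unshelve. all: by end_near.
Qed.

End directional_derivative.

Section directional_derivative_line.
Variables (R : realType) (V : normedModType R).
Implicit Types (f g : V -> R) (x v : V) (d : R).

(** The difference quotients of [f] along [v] and of its restriction to the line are the same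
    expression, so one-variable rules such as the chain rule carry over to directional
    derivatives. *)
Lemma is_derive_line f x v (t d : R) :
  is_derive t 1 (fun s : R => f (s *: v + x)) d <-> is_derive (t *: v + x) v f d.
Proof.
have E : (fun h : R => h^-1 * (f ((h *: (1 : R) + t) *: v + x) - f (t *: v + x))) =
   (fun h : R => h^-1 * (f (h *: v + (t *: v + x)) - f (t *: v + x))).
  by apply/funext => h; rewrite addrA -scalerDl (_ : h *: (1 : R) = h)//; exact: mulr1.
by split=> /(@is_deriveP R) H; apply/is_deriveP; [rewrite -E|rewrite E].
Qed.

Lemma is_derive_line0 f x v d :
  is_derive (0 : R) 1 (fun s : R => f (s *: v + x)) d <-> is_derive x v f d.
Proof. by rewrite is_derive_line scale0r add0r. Qed.

Lemma is_derive_comp1 (G : R -> R) f x v d d' :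
  is_derive (f x) 1 G d' -> is_derive x v f d ->
  is_derive x v (fun y => G (f y)) (d' * d).
Proof.
move=> dG /is_derive_line0 df; apply/is_derive_line0.
apply: (@is_derive1_comp _ G (fun s : R => f (s *: v + x)) 0 d' d) => //.
by rewrite scale0r add0r.
Qed.

Lemma is_derive_mul f g x v d d' : is_derive x v f d -> is_derive x v g d' ->
  is_derive x v (fun y => f y * g y) (f x * d' + g x * d).
Proof. by move=> df dg; exact: is_deriveM. Qed.

Lemma is_derive_add f g x v d d' : is_derive x v f d -> is_derive x v g d' ->
  is_derive x v (fun y => f y + g y) (d + d').
Proof. by move=> df dg; exact: is_deriveD. Qed.

Lemma is_derive_scale f x v d (c : R) : is_derive x v f d ->
  is_derive x v (fun y => c * f y) (c * d).
Proof. by move=> df; exact: is_deriveZ. Qed.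

Lemma is_derive_const x v (c : R) : is_derive x v (fun=> c) 0.
Proof. exact: is_derive_cst. Qed.

Lemma is_derive_eqr f x v d d' : is_derive x v f d -> d = d' -> is_derive x v f d'.
Proof. by move=> + <-. Qed.

End directional_derivative_line.

Lemma is_derive_continuous (R : realType) (f : R -> R) (x d : R) :
  is_derive x 1 f d -> {for x, continuous f}.
Proof.
by move=> fd; apply/differentiable_continuous/derivable1_diffP; exact: ex_derive.
Qed.

Lemma is_derive1E (R : realType) (f : R -> R) (x d : R) :
  is_derive x 1 f d -> derive1 f x = d.
Proof. by move=> fd; rewrite derive1E derive_val. Qed.

Section smooth.
Variable R : realType.
Implicit Types (f g : R -> R) (k : nat).

Fixpoint derivable_upto k g : Prop :=
  if k is k'.+1 then (forall x : R, derivable g x 1) /\ derivable_upto k' (derive1 g)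
  else True.

Definition smooth g := forall k, derivable_upto k g.

Lemma derivable_uptoS k g g' : (forall x : R, is_derive x 1 g (g' x)) ->
  derivable_upto k g' -> derivable_upto k.+1 g.
Proof.
move=> gg' g'k; split=> [x|]; first exact: ex_derive.
by rewrite (_ : derive1 g = g')//; apply/funext => x; rewrite (is_derive1E (gg' x)).
Qed.

Lemma derivable_upto_is_derive k g x : derivable_upto k.+1 g -> is_derive (x : R) 1 g (derive1 g x).
Proof. by case=> dg _; rewrite derive1E; exact/derivableP. Qed.

Lemma derivable_uptoW k g : derivable_upto k.+1 g -> derivable_upto k g.
Proof.
elim: k g => // k IH g [dg g'k]; split=> //; exact: IH.
Qed.

Lemma smooth_derive1 g : smooth g -> smooth (derive1 g).
Proof. by move=> sg k; have [] := sg k.+1. Qed.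

Lemma smooth_is_derive g x : smooth g -> is_derive (x : R) 1 g (derive1 g x).
Proof. by move=> sg; exact: derivable_upto_is_derive (sg 1%N). Qed.

Lemma smooth_continuous g : smooth g -> continuous g.
Proof. by move=> sg x; exact: is_derive_continuous (smooth_is_derive x sg). Qed.

Lemma smooth_cst (c : R) : smooth (fun=> c).
Proof.
move=> k; elim: k c => // k IH c; apply: (@derivable_uptoS _ _ (fun=> 0)) => //.
Qed.

Lemma smooth_id : smooth id.
Proof.
case=> // k; apply: (@derivable_uptoS _ _ (fun=> 1)) => //.
exact: smooth_cst.
Qed.

Lemma derivable_uptoD k f g :
  derivable_upto k f -> derivable_upto k g -> derivable_upto k (fun x => f x + g x).
Proof.
elim: k f g => // k IH f g fk gk.
apply: (@derivable_uptoS _ _ (fun x => derive1 f x + derive1 g x)) => [x|].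
  exact: is_derive_add (derivable_upto_is_derive x fk) (derivable_upto_is_derive x gk).
by apply: IH; [case: fk|case: gk].
Qed.

Lemma derivable_uptoM k f g :
  derivable_upto k f -> derivable_upto k g -> derivable_upto k (fun x => f x * g x).
Proof.
elim: k f g => // k IH f g fk gk.
apply: (@derivable_uptoS _ _ (fun x => f x * derive1 g x + g x * derive1 f x)) => [x|].
  exact: is_derive_mul (derivable_upto_is_derive x fk) (derivable_upto_is_derive x gk).
have := derivable_uptoW fk; have := derivable_uptoW gk; case: fk gk => _ fk [_ gk] *.
by apply: derivable_uptoD; apply: IH.
Qed.

Lemma derivable_upto_comp k f g :
  derivable_upto k f -> derivable_upto k g -> derivable_upto k (fun x => f (g x)).
Proof.
elim: k f g => // k IH f g fk gk.
refine (@derivable_uptoS k (fun x => f (g x)) (fun x => derive1 f (g x) * derive1 g x) _ _) => [x|].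
  exact: is_derive_comp1 (derivable_upto_is_derive _ fk) (derivable_upto_is_derive x gk).
apply: derivable_uptoM; last by case: gk.
by apply: IH; [case: fk|exact: derivable_uptoW].
Qed.

(** The derivative of [1 / g] is, up to sign, the derivative of [g] times two copies of [1 / g],
    each needed to one order less, so the induction closes. *)
Lemma derivable_uptoV k g : (forall x, g x != 0) ->
  derivable_upto k g -> derivable_upto k (fun x => (g x)^-1).
Proof.
move=> g0; elim: k => // k IH gk.
apply: (@derivable_uptoS _ _ (fun x => - 1 * ((g x)^-1 * (g x)^-1) * derive1 g x)) => [x|].
  apply: (@is_derive_comp1 _ _ (fun y => y^-1) g x 1 _ _ _ (derivable_upto_is_derive x gk)).
  have di : is_derive (g x) (1 : R) id (1 : R) by exact: is_derive_id.
  split; first by apply: (@derivableV _ _ id); [exact: g0|exact: ex_derive].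
  rewrite (@deriveV _ _ id) ?g0//.
  by rewrite derive_val [LHS]mulr1 mulN1r -exprVn expr2.
apply: derivable_uptoM; last by case: gk.
apply: derivable_uptoM; first exact: smooth_cst.
by have := IH (derivable_uptoW gk) => ?; exact: derivable_uptoM.
Qed.

Lemma smoothD f g : smooth f -> smooth g -> smooth (fun x => f x + g x).
Proof. by move=> sf sg k; exact: derivable_uptoD. Qed.

Lemma smoothM f g : smooth f -> smooth g -> smooth (fun x => f x * g x).
Proof. by move=> sf sg k; exact: derivable_uptoM. Qed.

Lemma smooth_comp f g : smooth f -> smooth g -> smooth (fun x => f (g x)).
Proof. by move=> sf sg k; exact: derivable_upto_comp. Qed.

Lemma smoothV g : (forall x, g x != 0) -> smooth g -> smooth (fun x => (g x)^-1).
Proof. by move=> g0 sg k; exact: derivable_uptoV. Qed.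

Lemma smooth_affine (a b : R) : smooth (fun x => a * x + b).
Proof.
apply: smoothD; last exact: smooth_cst.
by apply: smoothM; [exact: smooth_cst|exact: smooth_id].
Qed.

End smooth.

(** * A smooth transition function *)

Section smooth_step.
Variable R : realType.
Implicit Types (t : R) (k m : nat).

(* [t^-k e^(-1/t)], a family closed under differentiation up to linear combinations. *)
Definition flat k t : R := if 0 < t then t^-1 ^+ k * expR (- t^-1) else 0.

Lemma flat_gt0 k t : 0 < t -> 0 < flat k t.
Proof. by move=> t0; rewrite /flat t0 mulr_gt0 ?expR_gt0// exprn_gt0// invr_gt0. Qed.

Lemma flat_eq0 k t : t <= 0 -> flat k t = 0.
Proof. by move=> t0; rewrite /flat ltNge t0. Qed.

Lemma flat_ge0 k t : 0 <= flat k t.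
Proof. by case: (ltP 0 t) => [/flat_gt0/ltW//|/flat_eq0 ->]. Qed.

(** With [s = t^-1], the exponential series gives [s^k / k! <= expR s]. *)
Lemma flat_le k t : flat k t <= k`!%:R.
Proof.
case: (ltP 0 t) => [t0|/flat_eq0 -> //]; rewrite /flat t0.
have s0 : 0 <= t^-1 by rewrite invr_ge0 ltW.
rewrite expRN ler_pdivrMr ?expR_gt0//.
case: k => [|k]; first by rewrite expr0 mul1r; apply: le_trans (expR_ge1Dx t^-1); rewrite lerDl.
have := expR_ge1Dxn k s0 => h.
rewrite mulrC -ler_pdivrMr ?ltr0n ?fact_gt0//.
by apply: le_trans h; rewrite lerDr.
Qed.

Lemma flat_rec k t : flat k t = t * flat k.+1 t.
Proof.
case: (ltP 0 t) => t0; last by rewrite !flat_eq0// mulr0.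
rewrite /flat t0 exprS !mulrA divff ?mul1r//; exact: lt0r_neq0.
Qed.

(** The only delicate point is 0, where the difference quotient [flat k h / h] equals
    [h * flat k.+2 h] by applying [flat_rec] twice; [flat_le] bounds this by a multiple of the norm
    of [h]. *)
Lemma is_derive_flat k t :
  is_derive t 1 (flat k) (- k%:R * flat k.+1 t + flat k.+2 t).
Proof.
case: (ltgtP 0 t) => [t0|t0|<-].
- apply: (@is_derive_ext R _ (flat k) (fun u : R => u^-1 ^+ k * expR (- u^-1))).
    by near=> u; rewrite /flat ifT//; near: u; exact: lt_nbhsr.
  have dV : is_derive t (1 : R) (fun u : R => u^-1) (- t^-1 ^+ 2).
    have di : is_derive t (1 : R) id (1 : R) by exact: is_derive_id.
    split; first by apply: (@derivableV _ _ id); [exact: lt0r_neq0|exact: ex_derive].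
    rewrite (@deriveV _ _ id) ?lt0r_neq0//.
    by rewrite derive_val [LHS]mulr1 exprVn.
  have dX : is_derive (t^-1) (1 : R) (fun s : R => s ^+ k) (k%:R * t^-1 ^+ k.-1).
    have := @is_deriveX _ _ id k (t^-1) (1 : R) 1 (is_derive_id _ _).
    by rewrite exprfctE => /is_derive_eqr; apply; exact: mulr1.
  have dE : is_derive (t^-1) (1 : R) (fun s : R => expR (- s)) (expR (- t^-1) * - 1).
    exact: (@is_derive_comp1 _ _ expR (fun s : R => - s)).
  have := is_derive_comp1 (is_derive_mul dX dE) dV.
  move=> /is_derive_eqr; apply.
  rewrite /flat t0; case: k {dX} => [|k] /=; first by rewrite !mulr0n expr0; ring.
  by rewrite !exprS -natr1; ring.
- rewrite !flat_eq0 ?(ltW t0)// mulr0 addr0.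
  apply: (@is_derive_ext R _ (flat k) (fun u : R => 0)).
    by near=> u; rewrite flat_eq0// ltW//; near: u; exact: lt_nbhsl.
- rewrite !flat_eq0// mulr0 addr0; apply/is_deriveP.
  have cz : ((k.+2)`!%:R * `|h|) @[h --> (0:R)^'] --> (0 : R).
    have n0 : `|h| @[h --> (0:R)^'] --> `|0 : R| by apply: cvg_norm; exact: cvg_within.
    have : ((k.+2)`!%:R * `|h|) @[h --> (0:R)^'] --> (k.+2)`!%:R * `|0 : R|.
      by apply: cvgM => //; exact: cvg_cst.
    by rewrite normr0 mulr0.
  have cNz : (- ((k.+2)`!%:R * `|h|)) @[h --> (0:R)^'] --> (0 : R).
    by have := cvgN cz; rewrite oppr0; exact.
  apply: (squeeze_cvgr _ cNz cz).
  near=> h; rewrite addr0 (_ : h *: 1 = h); last exact: mulr1.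
  rewrite (flat_eq0 k (lexx 0)) subr0.
  rewrite -ler_norml.
  have h0 : h != 0 by near: h; exact: nbhs_dnbhs_neq.
  rewrite (flat_rec k) mulKf// (flat_rec k.+1) normrM mulrC ler_wpM2r//.
  by rewrite ger0_norm ?flat_ge0// flat_le.
Unshelve. all: by end_near. Qed.

Lemma smooth_flat k : smooth (flat k).
Proof.
move=> m; elim: m k => // m IH k.
apply: derivable_uptoS (is_derive_flat k) _.
apply: derivable_uptoD => //; apply: derivable_uptoM => //; exact: smooth_cst.
Qed.

(** The standard smooth transition from 0 on [t <= 0] to 1 on [1 <= t]. One of [t] and [1 - t] is
    always positive, so the denominator does not vanish. *)
Definition step t : R := flat 0 t / (flat 0 t + flat 0 (1 - t)).

(** The derivative of [step], simplified so that its sign is visible. It is a bump on [[0, 1]] whose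
    integral is 1 because [step] climbs from 0 to 1, so the mollifiers built from it need no
    normalizing constant. *)
Definition dstep t : R := (flat 2 t * flat 0 (1 - t) + flat 0 t * flat 2 (1 - t)) /
  (flat 0 t + flat 0 (1 - t)) ^+ 2.

Let denom_gt0 t : 0 < flat 0 t + flat 0 (1 - t).
Proof.
case: (ltP 0 t) => t0; first by rewrite ltr_pwDl ?flat_gt0 ?flat_ge0.
by rewrite ltr_wpDl ?flat_ge0// flat_gt0//; lra.
Qed.

Lemma step_eq0 t : t <= 0 -> step t = 0.
Proof. by move=> t0; rewrite /step (flat_eq0 0 t0) mul0r. Qed.

Lemma step_eq1 t : 1 <= t -> step t = 1.
Proof.
move=> t1; have e : flat 0 (1 - t) = 0 by apply: flat_eq0; lra.
by rewrite /step; have := denom_gt0 t; rewrite e addr0 => /lt0r_neq0/divff.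
Qed.

Lemma step_ge0 t : 0 <= step t.
Proof. by rewrite /step divr_ge0 ?flat_ge0// ltW. Qed.

Lemma step_le1 t : step t <= 1.
Proof. by rewrite /step ler_pdivrMr// mul1r lerDl flat_ge0. Qed.

Lemma smooth_step : smooth step.
Proof.
have s1 : smooth (fun t => flat 0 (1 - t)).
  apply: smooth_comp; first exact: smooth_flat.
  rewrite (_ : (fun x => 1 - x) = (fun x => -1 * x + 1)); first exact: smooth_affine.
  by apply/funext => x; ring.
apply: smoothM; first exact: smooth_flat.
apply: smoothV; first by move=> x; exact: lt0r_neq0.
by apply: smoothD => //; exact: smooth_flat.
Qed.

Lemma is_derive_step t : is_derive t 1 step (dstep t).
Proof.
have d0 s : is_derive s (1:R) (flat 0) (flat 2 s).
  by apply: (is_derive_eqr (is_derive_flat 0 s)); rewrite mulr0n oppr0 mul0r add0r.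
have d1 : is_derive t (1 : R) (fun s => 1 - s) (- 1).
  by apply: (is_derive_eqr (is_derive_add (is_derive_const t 1 1) (is_deriveNid t 1))); rewrite add0r.
have d2 := @is_derive_comp1 _ _ (flat 0) (fun s : R => 1 - s) t 1 _ _ (d0 (1 - t)) d1.
have d3 := is_derive_add (d0 t) d2.
have dn : flat 0 t + flat 0 (1 - t) != 0 by exact: lt0r_neq0.
have dV : is_derive (flat 0 t + flat 0 (1 - t)) (1 : R) (fun u : R => u^-1)
   (- (flat 0 t + flat 0 (1 - t))^-1 ^+ 2).
  have di : is_derive (flat 0 t + flat 0 (1 - t)) (1 : R) id (1 : R) by exact: is_derive_id.
  split; first by apply: (@derivableV _ _ id); [exact: dn|exact: ex_derive].
  rewrite (@deriveV _ _ id)//.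
  by rewrite derive_val [LHS]mulr1 exprVn.
have := is_derive_mul (d0 t) (@is_derive_comp1 _ _ (fun u : R => u^-1)
  (fun s : R => flat 0 s + flat 0 (1 - s)) t 1 _ _ dV d3).
by move=> /is_derive_eqr; apply; rewrite /dstep; field.
Qed.

Lemma dstep_ge0 t : 0 <= dstep t.
Proof. by rewrite /dstep divr_ge0 ?sqr_ge0// addr_ge0// mulr_ge0// flat_ge0. Qed.

Lemma derive1_step : derive1 step = dstep.
Proof. by apply/funext => t; exact: is_derive1E (is_derive_step t). Qed.

Lemma smooth_dstep : smooth dstep.
Proof. by rewrite -derive1_step; apply: smooth_derive1; exact: smooth_step. Qed.

Lemma dstep_eq0 t : t <= 0 \/ 1 <= t -> dstep t = 0.
Proof.
rewrite /dstep => -[t0|t1]; first by rewrite !(flat_eq0 _ t0) !mul0r addr0 mul0r.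
by rewrite !(@flat_eq0 _ (1 - t)) ?mulr0 ?addr0 ?mul0r//; lra.
Qed.

End smooth_step.

Lemma integrable_bounded_mul d (T : measurableType d) (R : realType)
    (mu : {measure set T -> \bar R}) (D : set T) (h w : T -> R) (M : R) :
  measurable D -> measurable_fun D h -> (forall x, D x -> `|h x| <= M) ->
  mu.-integrable D (EFin \o w) ->
  mu.-integrable D (EFin \o (fun x => h x * w x)).
Proof.
move=> mD mh hM iw.
have mw : measurable_fun D w by apply/measurable_EFinP; exact: measurable_int iw.
apply: (@le_integrable _ _ _ mu D mD _ (fun x => M%:E * (w x)%:E)%E).
- by apply/measurable_EFinP; exact: measurable_funM.
- move=> x Dx /=; rewrite lee_fin !normrM ler_wpM2r//.
  by rewrite (le_trans (hM x Dx))// ler_norm.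
- by apply: integrableZl.
Qed.

Lemma lipschitz_continuous_at (R : realType) (V W : normedModType R) (C : R) (f : V -> W) (x : V) :
  (forall y, `|f y - f x| <= C * `|y - x|) -> {for x, continuous f}.
Proof.
move=> lip; apply/cvgrPdist_le => /= e e0.
have c0 : 0 < `|C| + 1 by rewrite ltr_wpDl.
near=> y; rewrite distrC (le_trans (lip y))//.
have yx : `|y - x| <= e / (`|C| + 1).
  rewrite distrC; near: y; apply: cvgr_dist_le; first exact: cvg_id.
  by rewrite divr_gt0.
apply: (@le_trans _ _ ((`|C| + 1) * `|y - x|)).
  rewrite ler_wpM2r//; apply: (@le_trans _ _ `|C|); first exact: ler_norm.
  by rewrite lerDl.
by rewrite mulrC -ler_pdivlMr.
Unshelve. all: by end_near. Qed.

Section lipschitz.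
Variable R : realType.

Lemma lipschitz_of_is_derive (g g' : R -> R) (M a b : R) :
  (forall t : R, is_derive t 1 g (g' t)) -> (forall t, `|g' t| <= M) ->
  `|g b - g a| <= M * `|b - a|.
Proof.
move=> dg g'M.
wlog ab : a b / a <= b => [H|].
  have [/H//|/ltW/H] := leP a b.
  by rewrite distrC (distrC a).
have cg : {within `[a, b], continuous g}.
  by apply: continuous_subspaceT => x; exact: is_derive_continuous (dg x).
have [c _ ->] := @MVT_segment R g g' a b ab (fun x _ => dg x) cg.
by rewrite normrM ler_wpM2r.
Qed.

(** Going from [x] to [y] one coordinate at a time, the mean value theorem bounds each increment, so
    [F] is Lipschitz. Tensor products and convolutions get their continuity this way. *)
Lemma continuous_bounded_partial n (F : 'rV[R]_n -> R) (F' : 'I_n -> 'rV[R]_n -> R) (M : R) :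
  (forall i x, is_derive x (delta_mx ord0 i) F (F' i x)) ->
  (forall i x, `|F' i x| <= M) -> continuous F.
Proof.
move=> dF FM x.
(* The sign of [M] is read off from a partial derivative, and in dimension 0 there is none. *)
have M0 : (n = 0%N) \/ 0 <= M.
  case: n F F' x dF FM => [|n] F F' x _ FM; first by left.
  by right; apply: le_trans (FM ord0 x).
have lip y : `|F y - F x| <= n%:R * (M * `|y - x|).
  pose z k : 'rV[R]_n := \row_i (if (i < k)%N then y ord0 i else x ord0 i).
  have -> : F y = F (z n) by congr F; apply/rowP => i; rewrite mxE ltn_ord.
  have -> : F x = F (z 0%N) by congr F; apply/rowP => i; rewrite mxE ltn0.
  rewrite -(telescope_sumr (fun k => F (z k)))// big_mkord.
  rewrite (le_trans (ler_norm_sum _ _ _))//.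
  rewrite (_ : n%:R * _ = \sum_(i < n) (M * `|y - x|)); last first.
    by rewrite sumr_const card_ord mulr_natl.
  apply: ler_sum => i _.
  have zS : z i.+1 = (y ord0 i - x ord0 i) *: delta_mx ord0 i + z i.
    apply/rowP => j; rewrite !mxE eqxx /= eq_sym.
    have [<-|ji] := eqVneq i j; first by rewrite ltnn leqnn mulr1 addrNK.
    by rewrite mulr0 add0r ltnS leq_eqVlt (inj_eq val_inj) eq_sym (negbTE ji).
  have dFi t : is_derive t (1 : R) (fun s : R => F (s *: delta_mx ord0 i + z i))
      (F' i (t *: delta_mx ord0 i + z i)) by apply/is_derive_line; exact: dF.
  have := @lipschitz_of_is_derive _ _ M 0 (y ord0 i - x ord0 i) dFi (fun t => FM i _).
  rewrite scale0r add0r -zS subr0 => /le_trans -> //.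
  case: M0 => [n0|M0]; first by have := ltn_ord i; rewrite {2}n0.
    by rewrite ler_wpM2l//; have := coord_norm_le (y - x) i; rewrite !mxE.
apply: (@lipschitz_continuous_at _ _ _ (n%:R * M)) => y.
by rewrite -mulrA.
Qed.

End lipschitz.

Lemma smooth_continuous_at (R : realType) (g : R -> R) x : smooth g -> {for x, continuous g}.
Proof. by move=> sg; exact: is_derive_continuous (smooth_is_derive x sg). Qed.

Section Ck_class.
Variables (R : realType) (n : nat).
Implicit Types (f g : 'rV[R]_n -> R).

(** Tensor products and convolutions are differentiated within their own family; a family of
    continuous functions stable in this sense consists of smooth functions. *)
Lemma Ck_class (S : set ('rV[R]_n -> R)) :
  (forall f, S f -> continuous f) ->
  (forall f i, S f -> exists2 f', S f' & forall x, is_derive x (delta_mx ord0 i) f (f' x)) ->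
  forall k f, S f -> Ck k setT f.
Proof.
move=> Sc Sd; elim=> [|k IH] f Sf; split=> //=; try by move=> x _; exact: Sc.
move=> i; have [f' Sf' df] := Sd f i Sf; split=> [x _|]; first exact: ex_derive.
rewrite (_ : partial i f = f'); first exact: IH.
by apply/funext => x; rewrite /partial derive_val.
Qed.

Lemma CkW k f : Ck k.+1 setT f -> Ck k setT f.
Proof.
elim: k f => [|k IH] f [cf df]; split=> // i.
by have [dfi Cfi] := df i; split=> //; exact: IH.
Qed.

Lemma Ck_is_derive k f i x : Ck k.+1 setT f -> is_derive x (delta_mx ord0 i) f (partial i f x).
Proof. by move=> [_ /(_ i)[df _]]; apply/derivableP; exact: df. Qed.

Lemma Ck_continuous k f x : Ck k setT f -> {for x, continuous f}.
Proof. by case: k => [|k] [cf _]; exact: cf. Qed.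

Lemma Ck_step k f (f' : 'I_n -> 'rV[R]_n -> R) : (forall x, {for x, continuous f}) ->
  (forall i x, is_derive x (delta_mx ord0 i) f (f' i x)) ->
  (forall i, Ck k setT (f' i)) -> Ck k.+1 setT f.
Proof.
move=> cf df Cf; split=> [x _|i]; first exact: cf.
split=> [x _|]; first exact: ex_derive.
by rewrite (_ : partial i f = f' i)//; apply/funext => x; rewrite /partial derive_val.
Qed.

Lemma CkD k f g : Ck k setT f -> Ck k setT g -> Ck k setT (fun x => f x + g x).
Proof.
elim: k f g => [|k IH] f g Cf Cg.
  by split=> // x _; apply: continuousD; [exact: (Ck_continuous Cf)|exact: (Ck_continuous Cg)].
apply: (@Ck_step _ _ (fun i x => partial i f x + partial i g x)).
- by move=> x; apply: continuousD; [exact: (Ck_continuous Cf)|exact: (Ck_continuous Cg)].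
- by move=> i x; apply: is_derive_add; [exact: Ck_is_derive Cf|exact: Ck_is_derive Cg].
- by move=> i; apply: IH; [case: Cf => _ /(_ i)[]|case: Cg => _ /(_ i)[]].
Qed.

Lemma CkM k f g : Ck k setT f -> Ck k setT g -> Ck k setT (fun x => f x * g x).
Proof.
elim: k f g => [|k IH] f g Cf Cg.
  by split=> // x _; apply: continuousM; [exact: (Ck_continuous Cf)|exact: (Ck_continuous Cg)].
apply: (@Ck_step _ _ (fun i x => f x * partial i g x + g x * partial i f x)).
- by move=> x; apply: continuousM; [exact: (Ck_continuous Cf)|exact: (Ck_continuous Cg)].
- by move=> i x; apply: is_derive_mul; [exact: Ck_is_derive Cf|exact: Ck_is_derive Cg].
- move=> i; apply: CkD; apply: IH; try exact: CkW.
    by case: Cg => _ /(_ i)[].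
  by case: Cf => _ /(_ i)[].
Qed.

Lemma Ck_comp k (G : R -> R) f : smooth G -> Ck k setT f -> Ck k setT (fun x => G (f x)).
Proof.
move=> sG Cf; elim: k G sG Cf => [|k IH] G sG Cf.
  split=> // x _; apply: (@continuous_comp _ _ _ f G); first exact: (Ck_continuous Cf).
  exact: smooth_continuous_at.
apply: (@Ck_step _ _ (fun i x => derive1 G (f x) * partial i f x)).
- move=> x; apply: (@continuous_comp _ _ _ f G); first exact: (Ck_continuous Cf).
  exact: smooth_continuous_at.
- move=> i x; apply: (is_derive_comp1 (G := G)); last exact: Ck_is_derive Cf.
  exact: smooth_is_derive.
- move=> i; apply: CkM; last by case: Cf => _ /(_ i)[].
  by apply: IH; [exact: smooth_derive1|exact: CkW].
Qed.

End Ck_class.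

Section bump_function.
Variable R : realType.
Implicit Types g : R -> R.

Definition smooth_compact g := smooth g /\ exists L : R, forall t, L < `|t| -> g t = 0.

Lemma smooth_compact_derive1 g : smooth_compact g -> smooth_compact (derive1 g).
Proof.
move=> [sg [L gL]]; split; first exact: smooth_derive1.
exists L => t Lt; apply: is_derive1E.
apply: (@is_derive_ext R _ g (fun=> 0)).
have : \forall y \near t, L < `|y|.
  have nt : `|y| @[y --> t] --> `|t| by apply: cvg_norm; exact: cvg_id.
  exact: (cvgr_gt _ nt).
by apply: filterS => y; exact: gL.
Qed.

Lemma smooth_compact_bounded g : smooth_compact g -> exists M, forall t, `|g t| <= M.
Proof.
move=> [sg [L gL]].
have L0 : - `|L| <= `|L| by rewrite ge0_cp.
have cg : {within `[- `|L|, `|L|], continuous (fun t => `|g t|)}.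
  by apply: continuous_subspaceT => t; apply: cvg_norm; exact: smooth_continuous_at.
have [c _ cM] := EVT_max L0 cg.
exists `|g c| => t; have [tL|tL] := leP `|t| `|L|.
  by apply: cM; rewrite in_itv/= -ler_norml.
by rewrite gL ?normr0// (le_lt_trans (ler_norm L)).
Qed.

Lemma smooth_measurable g : smooth g -> measurable_fun setT g.
Proof. by move=> sg; apply: continuous_measurable_fun; exact: smooth_continuous. Qed.

Lemma smooth_compact_affine g (a b : R) : a != 0 -> smooth_compact g ->
  smooth_compact (fun t => g (a * t + b)).
Proof.
move=> a0 [sg [L gL]]; split.
  by apply: smooth_comp => //; exact: smooth_affine.
exists ((L + `|b|) / `|a|) => t.
rewrite ltr_pdivrMr ?normr_gt0// => h; apply: gL.
have : `|a * t| <= `|a * t + b| + `|b| by rewrite -{1}[a * t](addrK b) (le_trans (ler_normB _ _)).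
by rewrite normrM mulrC; lra.
Qed.

End bump_function.

(** * Tensor products and their convolutions *)

Section tensor.
Variables (R : realType) (n : nat).
Notation E := 'rV[R]_n.
Notation mu := (lebesgue_rV R n).
Implicit Types (h : 'I_n -> R -> R) (x y : E) (w : E -> R).

Definition tensor h x : R := \prod_i h i (x ord0 i).

Definition derive_factor h (j : 'I_n) : 'I_n -> R -> R :=
  fun i => if i == j then derive1 (h i) else h i.

Lemma smooth_compact_derive_factor h j : (forall i, smooth_compact (h i)) ->
  forall i, smooth_compact (derive_factor h j i).
Proof.
by move=> hi i; rewrite /derive_factor; case: ifP => // _; exact: smooth_compact_derive1.
Qed.

Lemma is_derive_tensor h x j : (forall i, smooth (h i)) ->
  is_derive x (delta_mx ord0 j) (tensor h) (tensor (derive_factor h j) x).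
Proof.
move=> sh; apply/is_derive_line0.
pose c := \prod_(i < n | i != j) h i (x ord0 i).
have E : (fun s : R => tensor h (s *: delta_mx ord0 j + x)) =
         (fun s : R => c * h j (s + x ord0 j)).
  apply/funext => s; rewrite /tensor (bigD1 j)//= !mxE !eqxx mulr1 mulrC; congr (_ * _).
  by apply: eq_bigr => i /negbTE ij; rewrite !mxE eqxx ij mulr0 add0r.
have -> : tensor (derive_factor h j) x = c * derive1 (h j) (0 + x ord0 j).
  rewrite /tensor (bigD1 j)//= {1}/derive_factor eqxx add0r mulrC; congr (_ * _).
  by apply: eq_bigr => i /negbTE ij; rewrite /derive_factor ij.
rewrite E; apply: is_derive_scale.
have d1 : is_derive (0 : R) (1 : R) (fun s : R => s + x ord0 j) (1 : R).
  by apply: (is_derive_eqr (is_derive_add (is_derive_id _ _) (is_derive_const _ _ _))); rewrite addr0.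
apply: (is_derive_eqr (@is_derive_comp1 _ _ (h j) (fun s : R => s + x ord0 j) 0 1 _ _
  (smooth_is_derive _ (sh j)) d1)).
by rewrite mulr1.
Qed.

Lemma tensor_bounded h : (forall i, smooth_compact (h i)) -> exists M, forall x, `|tensor h x| <= M.
Proof.
move=> hi; have /choice[M hM] i := smooth_compact_bounded (hi i).
exists (\prod_i M i) => x; rewrite /tensor normr_prod.
by apply: ler_prod => i _; rewrite normr_ge0 hM.
Qed.

Lemma tensor_bounded_partial h : (forall i, smooth_compact (h i)) ->
  exists M, forall j x, `|tensor (derive_factor h j) x| <= M.
Proof.
move=> hi.
have /choice[M hM] j := tensor_bounded (smooth_compact_derive_factor j hi).
exists (\sum_j `|M j|) => j x.
rewrite (le_trans (hM j x))// (le_trans (ler_norm _))// (bigD1 j)//= lerDl.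
by apply: sumr_ge0.
Qed.

Lemma tensor_continuous h : (forall i, smooth_compact (h i)) -> continuous (tensor h).
Proof.
move=> hi; have [M hM] := tensor_bounded_partial hi.
by apply: (continuous_bounded_partial _ hM) => i x; apply: is_derive_tensor => j; case: (hi j).
Qed.

Lemma Ck_tensor k h : (forall i, smooth_compact (h i)) -> Ck k setT (tensor h).
Proof.
move=> hi; apply: (@Ck_class _ _ [set tensor h | h in [set h | forall i, smooth_compact (h i)]]).
- by move=> _ [g /= gi <-]; exact: tensor_continuous.
- move=> _ j [g /= gi <-]; exists (tensor (derive_factor g j)).
    by exists (derive_factor g j) => //=; exact: smooth_compact_derive_factor.
  by move=> x; apply: is_derive_tensor => i; case: (gi i).
- by exists h.
Qed.

Lemma measurable_tensor h : (forall i, smooth (h i)) -> measurable_fun setT (tensor h).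
Proof. by move=> hi; apply: measurable_prod_coord => i; exact: smooth_measurable. Qed.

Lemma measurable_tensor_sub h x : (forall i, smooth (h i)) ->
  measurable_fun setT (fun y => tensor h (x - y)).
Proof.
move=> hi; rewrite (_ : (fun y => _) = tensor (fun i t => h i (x ord0 i - t))); last first.
  by apply/funext => y; rewrite /tensor; apply: eq_bigr => i _; rewrite !mxE.
apply: measurable_tensor => i; apply: smooth_comp => //.
rewrite (_ : (fun t => _) = (fun t => -1 * t + x ord0 i)); first exact: smooth_affine.
by apply/funext => t; ring.
Qed.

Definition convol h w x : R := (\int[mu]_y (tensor h (x - y) * w y))%R.

Lemma integrable_convol h w x : (forall i, smooth_compact (h i)) ->
  mu.-integrable setT (EFin \o w) ->
  mu.-integrable setT (EFin \o (fun y => tensor h (x - y) * w y)).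
Proof.
move=> hi iw; have [M hM] := tensor_bounded hi.
apply: (@integrable_bounded_mul _ _ _ mu _ _ _ M) => //.
by apply: measurable_tensor_sub => i; case: (hi i).
Qed.

Lemma convol_bounded h w : (forall i, smooth_compact (h i)) ->
  mu.-integrable setT (EFin \o w) -> exists M, forall x, `|convol h w x| <= M.
Proof.
move=> hi iw; have [M hM] := tensor_bounded hi.
exists (\int[mu]_y (M * `|w y|))%R => x.
apply: (le_trans (le_normr_Rintegral measurableT (integrable_convol x hi iw))).
have iaw : mu.-integrable setT (EFin \o (fun y => `|w y|)) by exact: (integrable_norm iw).
apply: le_Rintegral => //.
- exact: (integrable_norm (integrable_convol x hi iw)).
- exact: (integrableZl measurableT M iaw).
- by move=> y _; rewrite normrM ler_wpM2r.
Qed.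

(** Differentiation under the integral sign along the line through [x]. The dominating function is a
    bound of the differentiated kernel times the modulus of [w]. *)
Lemma is_derive_convol h w x j : (forall i, smooth_compact (h i)) ->
  mu.-integrable setT (EFin \o w) ->
  is_derive x (delta_mx ord0 j) (convol h w) (convol (derive_factor h j) w x).
Proof.
move=> hi iw; have sh i : smooth (h i) by case: (hi i).
apply/is_derive_line0.
pose f (s : R) y := tensor h (s *: delta_mx ord0 j + x - y) * w y.
have df s y : is_derive s (1 : R) (f ^~ y)
    (tensor (derive_factor h j) (s *: delta_mx ord0 j + x - y) * w y).
  rewrite (_ : f ^~ y = fun s => w y * tensor h (s *: delta_mx ord0 j + (x - y))); last first.
    by apply/funext => t; rewrite /f addrA mulrC.
  rewrite -addrA mulrC; apply: is_derive_scale; apply/is_derive_line.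
  exact: is_derive_tensor.
have d1E s y : partial1of2 f s y =
    tensor (derive_factor h j) (s *: delta_mx ord0 j + x - y) * w y.
  by rewrite /partial1of2; exact: is_derive1E (df s y).
have [M hM] := tensor_bounded (smooth_compact_derive_factor j hi).
pose G y := `|M * w y|.
(* Any open interval around 0 would do, as the domination is uniform in the parameter. *)
have I0 : [set` (`]-1, 1[ : interval R)] 0 by rewrite /= in_itv/=; lra.
have H1 s : [set` (`]-1, 1[ : interval R)] s -> mu.-integrable setT (EFin \o f s).
  by move=> _; exact: integrable_convol.
have H2 s y : [set` (`]-1, 1[ : interval R)] s -> [set: E] y -> derivable (f ^~ y) s 1.
  by move=> _ _; have [] := df s y.
have H3 : mu.-integrable setT (EFin \o G).
  exact: (integrable_norm (integrableZl measurableT M iw)).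
have H4 s y : [set` (`]-1, 1[ : interval R)] s -> [set: E] y -> `|partial1of2 f s y| <= G y.
  move=> _ _; rewrite d1E /G !normrM ler_wpM2r// (le_trans (hM _))//; exact: ler_norm.
have G0 y : 0 <= G y by exact: normr_ge0.
have HD := @derivable_under_integral R _ _ mu f setT measurableT 0 (-1) 1 I0 H1 H2 G G0 H3 H4.
have HE := @differentiation_under_integral R _ _ mu f setT measurableT 0 (-1) 1 I0 H1 H2 G G0 H3 H4.
split; first exact: HD.
rewrite -derive1E HE /convol; apply: eq_Rintegral => y _.
by rewrite d1E scale0r add0r.
Qed.

Lemma convol_continuous h w : (forall i, smooth_compact (h i)) ->
  mu.-integrable setT (EFin \o w) -> continuous (convol h w).
Proof.
move=> hi iw.
have /choice[M hM] j := convol_bounded (smooth_compact_derive_factor j hi) iw.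
apply: (@continuous_bounded_partial _ _ _ (fun j => convol (derive_factor h j) w) (\sum_j `|M j|)).
- by move=> i x; exact: is_derive_convol.
- move=> j x; rewrite (le_trans (hM j x))// (le_trans (ler_norm _))// (bigD1 j)//= lerDl.
  by apply: sumr_ge0.
Qed.

Lemma Ck_convol k h w : (forall i, smooth_compact (h i)) ->
  mu.-integrable setT (EFin \o w) -> Ck k setT (convol h w).
Proof.
move=> hi iw; apply: (@Ck_class _ _ [set convol h w | h in [set h | forall i, smooth_compact (h i)]]).
- by move=> _ [g /= gi <-]; exact: convol_continuous.
- move=> _ j [g /= gi <-]; exists (convol (derive_factor g j) w).
    by exists (derive_factor g j) => //=; exact: smooth_compact_derive_factor.
  by move=> x; exact: is_derive_convol.
- by exists h.
Qed.

End tensor.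

(** * Mollification in L^2 *)

Section square_integral.
Context d (T : measurableType d) (R : realType) (mu : {measure set T -> \bar R}).
Implicit Types (f g h : T -> R).

(** The square of the L^2 norm; estimates are carried out on it and turned into norms only by
    [norm2_le], so no root intervenes. *)
Definition sqint f : \bar R := (\int[mu]_x ((f x) ^+ 2)%:E)%E.

Lemma measurable_sq f : measurable_fun setT f ->
  measurable_fun setT (fun x => ((f x) ^+ 2)%:E).
Proof. by move=> mf; apply/measurable_EFinP; exact: measurable_funX. Qed.

Lemma sqint_ge0 f : (0 <= sqint f)%E.
Proof. by apply: integral_ge0 => x _; rewrite lee_fin sqr_ge0. Qed.

Lemma le_sqint f g : measurable_fun setT f -> measurable_fun setT g ->
  (forall x, `|f x| <= `|g x|) -> (sqint f <= sqint g)%E.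
Proof.
move=> mf mg fg; apply: ge0_le_integral => //.
- by move=> x _; rewrite lee_fin sqr_ge0.
- exact: measurable_sq.
- exact: measurable_sq.
- by move=> x _; rewrite lee_fin -[leLHS]real_normK ?num_real// -[leRHS]real_normK ?num_real// lerXn2r ?nnegrE.
Qed.

(** Substitute for the triangle inequality, from [(g + h)^2 <= 2 g^2 + 2 h^2], where the two sides
    differ by [(g - h)^2]. The quarters of [e] in later estimates compensate its factor 2. *)
Lemma sqint_split f g h (a b : R) :
  measurable_fun setT f -> measurable_fun setT g -> measurable_fun setT h ->
  (forall x, f x = g x + h x) ->
  (sqint g <= a%:E)%E -> (sqint h <= b%:E)%E -> (sqint f <= (2 * (a + b))%:E)%E.
Proof.
move=> mf mg mh fgh ga hb.
apply: (@le_trans _ _ (\int[mu]_x (2%:E * (((g x) ^+ 2)%:E + ((h x) ^+ 2)%:E)))%E).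
  apply: ge0_le_integral => //.
  - by move=> x _; rewrite lee_fin sqr_ge0.
  - exact: measurable_sq.
  - by apply: measurable_funeM; apply: emeasurable_funD; exact: measurable_sq.
  - move=> x _; rewrite -EFinD -EFinM lee_fin fgh -subr_ge0.
    by rewrite (_ : _ - _ = (g x - h x) ^+ 2) ?sqr_ge0//; ring.
rewrite ge0_integralZl//; last 2 first.
- by apply: emeasurable_funD; exact: measurable_sq.
- by move=> x _; rewrite adde_ge0// lee_fin sqr_ge0.
rewrite ge0_integralD//; last 4 first.
- by move=> x _; rewrite lee_fin sqr_ge0.
- exact: measurable_sq.
- by move=> x _; rewrite lee_fin sqr_ge0.
- exact: measurable_sq.
rewrite EFinM EFinD; apply: lee_wpmul2l; last by rewrite EFinD; exact: leeD ga hb.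
by rewrite -EFinD lee_fin; lra.
Qed.

Lemma sqintZ f (c : R) : measurable_fun setT f ->
  sqint (fun x => c * f x) = ((c ^+ 2)%:E * sqint f)%E.
Proof.
move=> mf; rewrite /sqint -ge0_integralZl//; last 3 first.
- exact: measurable_sq.
- by move=> x _; rewrite lee_fin sqr_ge0.
- by rewrite lee_fin sqr_ge0.
by apply: eq_integral => x _; rewrite exprMn EFinM.
Qed.

Lemma integrable_sq f : measurable_fun setT f -> (sqint f < +oo)%E ->
  mu.-integrable setT (EFin \o (fun x => f x ^+ 2)).
Proof.
move=> mf Qf; apply/integrableP; split; first exact: measurable_sq.
apply: le_lt_trans Qf; apply: ge0_le_integral => //.
- by apply: measurableT_comp => //; exact: measurable_sq.
- exact: measurable_sq.
- by move=> x _; rewrite /= lee_fin ger0_norm ?sqr_ge0.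
Qed.

(** Dominated convergence in epsilon form, which is how L^2 limits are combined below. *)
Lemma sqint_dct (u : nat -> T -> R) (G : T -> R) :
  (forall k, measurable_fun setT (u k)) ->
  (forall x, u k x @[k --> \oo] --> 0) ->
  mu.-integrable setT (EFin \o G) -> (forall k x, (u k x) ^+ 2 <= G x) ->
  forall e, 0 < e -> exists N, forall k, (N <= k)%N -> (sqint (u k) <= e%:E)%E.
Proof.
move=> mu_ u0 iG uG e e0.
have H1 : {ae mu, forall x, [set: T] x -> ((u k x) ^+ 2)%:E @[k --> \oo] --> 0%E}.
  apply: aeW => x _; apply: cvg_EFin; first exact: nearW.
  rewrite [X in X @ _ --> _](_ : _ = (fun k => u k x * u k x)); last first.
    by apply/funext => k; rewrite /= expr2.
  rewrite -[0](mul0r 0). exact: (cvgM (u0 x) (u0 x)).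
have H2 : {ae mu, forall x (k : nat), [set: T] x -> (`|((u k x) ^+ 2)%:E| <= (EFin \o G) x)%E}.
  by apply: aeW => x k _; rewrite /= lee_fin ger0_norm ?sqr_ge0.
have [_ _] := @dominated_convergence _ _ _ mu setT measurableT
  (fun k x => ((u k x) ^+ 2)%:E) (fun=> 0%E) (EFin \o G)
  (fun k => measurable_sq (mu_ k)) (measurable_cst _) H1 iG H2.
rewrite integral0 => /fine_cvgP[[N1 _ fin] /cvgrPdist_le/(_ e e0)[N2 _ le]].
exists (maxn N1 N2) => k; rewrite geq_max => /andP[N1k N2k].
have := le k N2k; rewrite /= sub0r normrN => h.
have /= fk := fineK (fin k N1k).
rewrite /sqint -fk lee_fin.
exact: le_trans (ler_norm _) h.
Qed.

End square_integral.

(** * Mollifiers in one variable *)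

Section mollifier_1d.
Variable R : realType.
Notation leb := (@lebesgue_measure R).

Lemma integral_is_derive (F f : R -> R) (a b : R) : a <= b ->
  (forall t : R, is_derive t 1 F (f t)) -> continuous f ->
  (\int[leb]_(t in `[a, b]) (f t)%:E = (F b - F a)%:E)%E.
Proof.
rewrite le_eqVlt => /predU1P[<- _ _|ab dF cf].
  by rewrite set_itv1 integral_set1 subrr.
have cF t : {for t, continuous F} by exact: is_derive_continuous (dF t).
rewrite (@continuous_FTC2 _ f F a b ab) ?EFinB//.
- exact: continuous_subspaceT.
- split=> [t _|//|]; first by have [] := dF t.
    by apply: cvg_at_right_filter; exact: cF.
  by apply: cvg_at_left_filter; exact: cF.
- by move=> t _; exact: is_derive1E (dF t).
Qed.

Lemma integral_is_derive_support (F f : R -> R) (a b : R) : a <= b ->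
  (forall t : R, is_derive t 1 F (f t)) -> continuous f ->
  (forall t, t < a \/ b < t -> f t = 0) ->
  (\int[leb]_t (f t)%:E = (F b - F a)%:E)%E.
Proof.
move=> ab dF cf f0; rewrite -(integral_is_derive ab dF cf) [RHS]integral_mkcond.
apply: eq_integral => t _; rewrite patchE; case: ifPn => //.
rewrite notin_setE /= in_itv/= => /negP; rewrite negb_and -!ltNge => /orP h.
by rewrite f0.
Qed.

(** A one-sided kernel, supported in [[0, 1/(k+1)]], with explicit primitive [mol_prim].
    One-sidedness pays off in [mollify_cvg_box]. *)
Definition mol (k : nat) (t : R) : R := k.+1%:R * dstep (k.+1%:R * t).
Definition mol_prim (k : nat) (t : R) : R := step (k.+1%:R * t).

Lemma is_derive_mol_prim k (t : R) : is_derive (t : R) 1 (mol_prim k) (mol k t).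
Proof.
have d1 : is_derive t (1 : R) (fun s : R => k.+1%:R * s) (k.+1%:R).
  by apply: (is_derive_eqr (is_derive_scale k.+1%:R (is_derive_id t (1 : R)))); rewrite mulr1.
apply: (is_derive_eqr (@is_derive_comp1 _ _ (@step R) (fun s : R => k.+1%:R * s) t 1 _ _
  (is_derive_step _) d1)).
by rewrite mulrC.
Qed.

Lemma mol_ge0 k t : 0 <= mol k t.
Proof. by rewrite /mol mulr_ge0// dstep_ge0. Qed.

Lemma mol_eq0 k t : t <= 0 \/ k.+1%:R^-1 <= t -> mol k t = 0.
Proof.
move=> h; rewrite /mol dstep_eq0 ?mulr0//; case: h => h; [left|right].
  by rewrite pmulr_rle0.
by rewrite -ler_pdivrMl// mulr1.
Qed.

Lemma mol_eq01 k t : t <= 0 \/ 1 <= t -> mol k t = 0.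
Proof.
move=> h; apply: mol_eq0; case: h => h; [by left|right].
by apply: le_trans h; rewrite invf_le1// ler1n.
Qed.

Lemma smooth_compact_mol k : smooth_compact (mol k).
Proof.
split.
  apply: smoothM; first exact: smooth_cst.
  apply: smooth_comp; first exact: smooth_dstep.
  apply: smoothM; [exact: smooth_cst|exact: smooth_id].
exists 1 => t; rewrite ltr_normr => h; apply: mol_eq01.
by case/orP: h => h; [right|left]; lra.
Qed.

Lemma mol_continuous k : continuous (mol k).
Proof. by apply: smooth_continuous; case: (smooth_compact_mol k). Qed.

Lemma mol_prim_eq0 k t : t <= 0 -> mol_prim k t = 0.
Proof. by move=> t0; rewrite /mol_prim step_eq0// pmulr_rle0. Qed.

Lemma mol_prim_eq1 k t : k.+1%:R^-1 <= t -> mol_prim k t = 1.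
Proof. by move=> t1; rewrite /mol_prim step_eq1// -ler_pdivrMl// mulr1. Qed.

Lemma mol_prim_eq11 k t : 1 <= t -> mol_prim k t = 1.
Proof. by move=> t1; apply: mol_prim_eq1; apply: le_trans t1; rewrite invf_le1// ler1n. Qed.

Lemma mol_prim_ge0 k t : 0 <= mol_prim k t. Proof. exact: step_ge0. Qed.
Lemma mol_prim_le1 k t : mol_prim k t <= 1. Proof. exact: step_le1. Qed.

Lemma is_derive_mol_prim_sub k x t :
  is_derive t (1 : R) (fun s : R => - mol_prim k (x - s)) (mol k (x - t)).
Proof.
have d1 : is_derive t (1 : R) (fun s : R => x - s) (- 1).
  by apply: (is_derive_eqr (is_derive_add (is_derive_const t 1 x) (is_deriveNid t 1))); rewrite add0r.
have d2 := @is_derive_comp1 _ _ (mol_prim k) (fun s : R => x - s) t 1 _ _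
  (is_derive_mol_prim k (x - t)) d1.
by have := is_deriveN d2 => /is_derive_eqr; apply; rewrite mulrN1 opprK.
Qed.

Lemma mol_sub_continuous k x : continuous (fun t => mol k (x - t)).
Proof.
apply: smooth_continuous; apply: smooth_comp; first by case: (smooth_compact_mol k).
rewrite (_ : (fun t => _) = (fun t => -1 * t + x)); first exact: smooth_affine.
by apply/funext => t; ring.
Qed.

Lemma integral_mol_sub k x : (\int[leb]_t (mol k (x - t))%:E = 1)%E.
Proof.
have x1 : x - 1 <= x by lra.
have s0 t : t < x - 1 \/ x < t -> mol k (x - t) = 0 by move=> h; apply: mol_eq01; lra.
rewrite (integral_is_derive_support x1 (is_derive_mol_prim_sub k x)
  (@mol_sub_continuous k x) s0).
rewrite subrr (mol_prim_eq0 _ (lexx 0)) (_ : x - (x - 1) = 1); last by ring.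
by rewrite (mol_prim_eq11 _ (lexx 1)) oppr0 sub0r opprK.
Qed.

Lemma integral_mol_shift k y : (\int[leb]_t (mol k (t - y))%:E = 1)%E.
Proof.
have aff : (fun t => t - y) = (fun t => 1 * t + - y) by apply/funext => t; ring.
have y1 : y <= y + 1 by lra.
have s0 t : t < y \/ y + 1 < t -> mol k (t - y) = 0 by move=> h; apply: mol_eq01; lra.
have dF (t : R) : is_derive t (1 : R) (fun s : R => mol_prim k (s - y)) (mol k (t - y)).
  have d1 : is_derive t (1 : R) (fun s : R => s - y) 1.
    by apply: (is_derive_eqr (is_derive_add (is_derive_id _ _) (is_derive_const _ _ _))); rewrite addr0.
  apply: (is_derive_eqr (@is_derive_comp1 _ _ (mol_prim k) (fun s : R => s - y) t 1 _ _
    (is_derive_mol_prim k _) d1)).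
  by rewrite mulr1.
have cf : continuous (fun t => mol k (t - y)).
  apply: smooth_continuous; apply: smooth_comp; first by case: (smooth_compact_mol k).
  by rewrite aff; exact: smooth_affine.
rewrite (integral_is_derive_support y1 dF cf s0).
rewrite subrr (mol_prim_eq0 _ (lexx 0)) (_ : y + 1 - y = 1); last by ring.
by rewrite (mol_prim_eq11 _ (lexx 1)) subr0.
Qed.

(** The convolution of [mol k] with an interval, in closed form; [mollify_box] is the product of
    such formulas. *)
Lemma integral_mol_itv k x (a b : R) : a <= b ->
  (\int[leb]_t (mol k (x - t) * \1_(`]a, b]%classic) t)%:E =
   (mol_prim k (x - a) - mol_prim k (x - b))%:E)%E.
Proof.
move=> ab; transitivity (\int[leb]_(t in `]a, b]) (mol k (x - t))%:E)%E.
  rewrite [RHS]integral_mkcond; apply: eq_integral => t _.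
  by rewrite patchE indicE; case: ifPn => _ /=; rewrite ?mulr1 ?mulr0.
rewrite integral_itv_obnd_cbnd; last first.
  apply/measurable_EFinP; apply: measurable_funTS; apply: continuous_measurable_fun.
  exact: mol_sub_continuous.
rewrite (integral_is_derive ab (is_derive_mol_prim_sub k x) (@mol_sub_continuous k x)).
by rewrite opprK addrC.
Qed.

End mollifier_1d.

Section mollifier.
Variables (R : realType) (n : nat).
Notation E := 'rV[R]_n.
Notation mu := (lebesgue_rV R n).
Implicit Types (x y a b : E) (w z : E -> R) (k : nat).

Definition mol_rV k : E -> R := tensor (fun=> mol k).

Definition mollify k w : E -> R := convol (fun=> mol k) w.

Lemma mol_rV_ge0 k x : 0 <= mol_rV k x.
Proof. by apply: prodr_ge0 => i _; exact: mol_ge0. Qed.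

Lemma integral_mol_rV_sub k x : (\int[mu]_y (mol_rV k (x - y))%:E = 1)%E.
Proof.
transitivity (\int[mu]_y (\prod_i mol k (x ord0 i - y ord0 i))%:E)%E.
  by apply: eq_integral => y _; congr EFin; apply: eq_bigr => i _; rewrite !mxE.
rewrite (@ge0_integral_prod_coord _ _ (fun i t => mol k (x ord0 i - t))).
- by rewrite big1// => i _; exact: integral_mol_sub.
- by move=> i; apply: continuous_measurable_fun; exact: mol_sub_continuous.
- by move=> i t; exact: mol_ge0.
Qed.

(** Unit mass in the other variable, as required after exchanging the integrals in
    [sqint_mollify]. *)
Lemma integral_mol_rV_shift k y : (\int[mu]_x (mol_rV k (x - y))%:E = 1)%E.
Proof.
transitivity (\int[mu]_x (\prod_i mol k (x ord0 i - y ord0 i))%:E)%E.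
  by apply: eq_integral => x _; congr EFin; apply: eq_bigr => i _; rewrite !mxE.
rewrite (@ge0_integral_prod_coord _ _ (fun i t => mol k (t - y ord0 i))).
- by rewrite big1// => i _; exact: integral_mol_shift.
- move=> i; apply: smooth_measurable; apply: smooth_comp.
    by case: (smooth_compact_mol R k).
  rewrite (_ : (fun t => _) = (fun t => 1 * t + - y ord0 i)); first exact: smooth_affine.
  by apply/funext => t; ring.
- by move=> i t; exact: mol_ge0.
Qed.

(** Half-open like the intervals of [ocitv], so that intersecting a cylinder with a box gives a
    box. *)
Definition box a b : set E := [set x | forall i, a ord0 i < x ord0 i <= b ord0 i].

Lemma indic_box a b x :
  \1_(box a b) x = \prod_i \1_(`]a ord0 i, b ord0 i]%classic) (x ord0 i) :> R.
Proof.
rewrite indicE; case: (boolP (x \in box a b)); rewrite ?inE ?notin_setE /= => h.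
  by rewrite big1// => i _; rewrite indicE mem_set//= in_itv/=; exact: h.
have [i hi] : exists i, ~ (a ord0 i < x ord0 i <= b ord0 i) by exact/existsNP.
by rewrite (bigD1 i)//= indicE memNset ?mul0r//= in_itv.
Qed.

Lemma measurable_box a b : measurable (box a b).
Proof.
rewrite (_ : box a b = \bigcap_(i in [set: 'I_n])
    ((fun x : E => x ord0 i : R) @^-1` `]a ord0 i, b ord0 i]%classic)); last first.
  by apply/seteqP; split=> x /= h i; [move=> _|]; have := h i; rewrite /= in_itv/=; [|apply].
apply: fin_bigcap_measurable => // i _.
by rewrite -[X in measurable X]setTI; exact: measurable_coord.
Qed.

Lemma lebesgue_box_lty a b : (forall i, a ord0 i <= b ord0 i) -> (mu (box a b) < +oo)%E.
Proof.
move=> ab; rewrite -[X in mu X]setIT -integral_indic//; last exact: measurable_box.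
under eq_integral do rewrite indic_box.
rewrite (@ge0_integral_prod_coord _ _ (fun i t => \1_(`]a ord0 i, b ord0 i]%classic) t)).
- rewrite (eq_bigr (fun i => (b ord0 i - a ord0 i)%:E)); first by rewrite prodEFin ltry.
  move=> i _; rewrite integral_indic// setIT; apply: (eq_trans (lebesgue_measure_itv _)).
  rewrite /= lte_fin.
  have := ab i; rewrite le_eqVlt => /predU1P[->|->]; last by rewrite EFinB.
  by rewrite ltxx subrr.
- by move=> i; exact: measurable_indic.
- by move=> i t; rewrite indicE.
Qed.

Lemma mollify_box k a b x : (forall i, a ord0 i <= b ord0 i) ->
  mollify k \1_(box a b) x =
  \prod_i (mol_prim k (x ord0 i - a ord0 i) - mol_prim k (x ord0 i - b ord0 i)).
Proof.
move=> ab; rewrite /mollify /convol /Rintegral.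
transitivity (fine (\int[mu]_y
   (\prod_i (mol k (x ord0 i - y ord0 i) * \1_(`]a ord0 i, b ord0 i]%classic) (y ord0 i)))%:E)%E).
  congr fine; apply: eq_integral => y _; congr EFin.
  rewrite indic_box /tensor -big_split/=; apply: eq_bigr => i _; by rewrite !mxE.
rewrite (@ge0_integral_prod_coord _ _
  (fun i t => mol k (x ord0 i - t) * \1_(`]a ord0 i, b ord0 i]%classic) t)).
- rewrite (eq_bigr (fun i => (mol_prim k (x ord0 i - a ord0 i) - mol_prim k (x ord0 i - b ord0 i))%:E)).
    by rewrite prodEFin.
  by move=> i _; exact: integral_mol_itv.
- move=> i; apply: measurable_funM; last exact: measurable_indic.
  by apply: continuous_measurable_fun; exact: mol_sub_continuous.
- by move=> i t; rewrite mulr_ge0// ?mol_ge0// indicE.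
Qed.

End mollifier.

Section mollifier_L2.
Variables (R : realType) (n : nat).
Notation E := 'rV[R]_n.
Notation mu := (lebesgue_rV R n).
Implicit Types (x y a b : E) (w z : E -> R) (k : nat).

Lemma smooth_compact_mol' k : forall i : 'I_n, smooth_compact (mol (R := R) k).
Proof. by move=> _; exact: smooth_compact_mol. Qed.

Lemma mollify_continuous k w : mu.-integrable setT (EFin \o w) -> continuous (mollify k w).
Proof. exact: convol_continuous (smooth_compact_mol' k). Qed.

Lemma measurable_mollify k w : mu.-integrable setT (EFin \o w) ->
  measurable_fun setT (mollify k w).
Proof. by move=> iw; apply: continuous_measurable_rV; exact: mollify_continuous. Qed.

Lemma integrable_mollify_integrand k w x : mu.-integrable setT (EFin \o w) ->
  mu.-integrable setT (EFin \o (fun y => mol_rV k (x - y) * w y)).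
Proof. exact: integrable_convol (smooth_compact_mol' k). Qed.

Lemma measurable_mol_rV_sub k x : measurable_fun setT (fun y => mol_rV k (x - y)).
Proof. by apply: measurable_tensor_sub => _; case: (smooth_compact_mol R k). Qed.

Lemma integrable_mol_rV_sub k x :
  mu.-integrable setT (EFin \o (fun y => mol_rV k (x - y))).
Proof.
apply/integrableP; split; first by apply/measurable_EFinP; exact: measurable_mol_rV_sub.
under eq_integral do rewrite /= ger0_norm ?mol_rV_ge0//.
by rewrite integral_mol_rV_sub ltry.
Qed.

Lemma Rintegral_mol_rV_sub k x : (\int[mu]_y mol_rV k (x - y))%R = 1.
Proof. by rewrite /Rintegral integral_mol_rV_sub. Qed.

Lemma mollifyD k w z x : mu.-integrable setT (EFin \o w) -> mu.-integrable setT (EFin \o z) ->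
  mollify k (fun y => w y + z y) x = mollify k w x + mollify k z x.
Proof.
move=> iw iz; rewrite /mollify /convol -RintegralD//; try exact: integrable_mollify_integrand.
by apply: eq_Rintegral => y _; rewrite mulrDr.
Qed.

Lemma mollifyZ k (c : R) w x : mu.-integrable setT (EFin \o w) ->
  mollify k (fun y => c * w y) x = c * mollify k w x.
Proof.
move=> iw; rewrite /mollify /convol -RintegralZl//; try exact: integrable_mollify_integrand.
by apply: eq_Rintegral => y _; rewrite mulrCA.
Qed.

(** Jensen's inequality for the probability density [mol_rV k (x - y)]: integrate
    [0 <= mol_rV k (x - y) * (w y - a)^2], where [a] is the mean of [w] for that density. *)
Lemma mollify_sq_le k w x : mu.-integrable setT (EFin \o w) ->
  mu.-integrable setT (EFin \o (fun y => w y ^+ 2)) ->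
  (((mollify k w x) ^+ 2)%:E <= \int[mu]_y (mol_rV k (x - y) * w y ^+ 2)%:E)%E.
Proof.
move=> iw iw2; set a := mollify k w x.
have i1 := integrable_mollify_integrand k x iw.
have i2 := integrable_mollify_integrand k x iw2.
have i3 := integrable_mol_rV_sub k x.
have i1' : mu.-integrable setT (EFin \o (fun y => 2 * a * (mol_rV k (x - y) * w y))).
  exact: (integrableZl measurableT (2 * a) i1).
have i3' : mu.-integrable setT (EFin \o (fun y => a ^+ 2 * mol_rV k (x - y))).
  exact: (integrableZl measurableT (a ^+ 2) i3).
have i4 : mu.-integrable setT (EFin \o (fun y => mol_rV k (x - y) * w y ^+ 2 + a ^+ 2 * mol_rV k (x - y))).
  exact: (integrableD measurableT i2 i3').
have := le_Rintegral measurableT i1' i4 _.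
rewrite RintegralD// !RintegralZl// Rintegral_mol_rV_sub mulr1.
rewrite -[X in 2 * a * X]/a => h.
have {}h : a ^+ 2 <= (\int[mu]_y (mol_rV k (x - y) * w y ^+ 2))%R.
  rewrite -(lerD2r (a ^+ 2)); apply: le_trans (h _); first by rewrite expr2; lra.
  move=> y _; rewrite -subr_ge0 (_ : _ - _ = mol_rV k (x - y) * (w y - a) ^+ 2); last by ring.
  by rewrite mulr_ge0 ?sqr_ge0 ?mol_rV_ge0.
rewrite -(fineK (integrable_fin_num measurableT i2)) lee_fin; exact: h.
Qed.

Lemma measurable_mol_rV_sub2 k :
  measurable_fun setT (fun p : E * E => mol_rV k (p.1 - p.2)).
Proof.
rewrite (_ : (fun p => _) = (fun p : E * E => \prod_i mol k (p.1 ord0 i - p.2 ord0 i))); last first.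
  by apply/funext => p; apply: eq_bigr => i _; rewrite !mxE.
apply: measurable_prod => i _.
apply: (measurableT_comp (f := mol (R := R) k)).
  by apply: continuous_measurable_fun; exact: mol_continuous.
apply: measurable_funB.
- by apply: (measurableT_comp (f := fun x : E => x ord0 i)); [exact: measurable_coord|exact: measurable_fst].
- by apply: (measurableT_comp (f := fun x : E => x ord0 i)); [exact: measurable_coord|exact: measurable_snd].
Qed.

(** Integrate [mollify_sq_le] over [x] and exchange the integrals; the inner one is then the mass of
    the kernel in [x], which is 1. *)
Lemma sqint_mollify k w : mu.-integrable setT (EFin \o w) ->
  (sqint mu w < +oo)%E -> (sqint mu (mollify k w) <= sqint mu w)%E.
Proof.
move=> iw Qw; have mw : measurable_fun setT w by apply/measurable_EFinP; exact: measurable_int iw.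
have iw2 := integrable_sq mw Qw.
pose F (p : E * E) := (mol_rV k (p.1 - p.2) * w p.2 ^+ 2)%:E.
have F0 p : (0 <= F p)%E by rewrite lee_fin mulr_ge0 ?sqr_ge0 ?mol_rV_ge0.
have mF : measurable_fun setT F.
  apply/measurable_EFinP; apply: measurable_funM; first exact: measurable_mol_rV_sub2.
  apply: measurable_funX.
  by apply: (measurableT_comp (f := w)) => //; exact: measurable_snd.
apply: (@le_trans _ _ (\int[mu]_x \int[mu]_y F (x, y))%E).
  apply: ge0_le_integral => //.
  - by move=> x _; rewrite lee_fin sqr_ge0.
  - by apply: measurable_sq; exact: measurable_mollify.
  - exact: (@measurable_fun_fubini_tonelli_F _ _ E E R mu F mF F0).
  - by move=> x _; exact: mollify_sq_le.
rewrite (@fubini_tonelli _ _ E E R mu mu F mF F0) /sqint le_eqVlt; apply/orP; left; apply/eqP.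
apply: eq_integral => y _; rewrite /F /=.
under eq_integral do rewrite mulrC EFinM.
rewrite ge0_integralZl//.
- by rewrite integral_mol_rV_shift mule1.
- apply/measurable_EFinP.
  exact: (measurable_fun_pair1 y (measurable_mol_rV_sub2 k)).
- by move=> x _; rewrite lee_fin mol_rV_ge0.
- by rewrite lee_fin sqr_ge0.
Qed.

End mollifier_L2.

Section mollifier_convergence.
Variables (R : realType) (n : nat).
Notation E := 'rV[R]_n.
Notation mu := (lebesgue_rV R n).
Implicit Types (x y a b c : E) (w z : E -> R) (k : nat).

Definition mollify_cvg w := forall e : R, 0 < e -> exists N, forall k, (N <= k)%N ->
  (sqint mu (fun x => mollify k w x - w x)%R <= e%:E)%E.

Lemma integrable_indic_box a b : (forall i, a ord0 i <= b ord0 i) ->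
  mu.-integrable setT (EFin \o (\1_(box a b) : E -> R)).
Proof.
move=> ab; apply/integrableP; split.
  by apply/measurable_EFinP; apply: measurable_indic; exact: measurable_box.
rewrite (eq_integral (fun x => (\1_(box a b) x)%:E)); last first.
  by move=> x _; rewrite /= ger0_norm// indicE.
rewrite integral_indic//; last exact: measurable_box.
by rewrite setIT; exact: lebesgue_box_lty.
Qed.

(** Because the kernel is one-sided and the box half-open on the matching side, the mollification
    equals the indicator for large [k] at every point, faces included; dominated convergence then
    applies. *)
Lemma mollify_cvg_box a b : (forall i, a ord0 i <= b ord0 i) -> mollify_cvg \1_(box a b).
Proof.
move=> ab e e0.
have i1 := integrable_indic_box ab.
have m1 : measurable_fun setT (\1_(box a b) : E -> R).
  by apply: measurable_indic; exact: measurable_box.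
(* Mollification spreads the box upwards by at most 1 in each coordinate, so everything vanishes
   outside [box a c]. *)
pose c := \row_i (b ord0 i + 1).
have ac i : a ord0 i <= c ord0 i by rewrite mxE; have := ab i; lra.
pose f k i t := mol_prim (R := R) k (t - a ord0 i) - mol_prim k (t - b ord0 i).
have f01 k i t : 0 <= f k i t <= 1.
  rewrite /f; have [tb|tb] := leP t (b ord0 i).
    rewrite (@mol_prim_eq0 _ _ (t - b ord0 i)); last lra.
    by rewrite subr0 mol_prim_ge0 mol_prim_le1.
  have tb' : 0 <= t - b ord0 i by lra.
  have ta : mol_prim k (t - b ord0 i) <= mol_prim k (t - a ord0 i).
    have H : 0 <= t - b ord0 i <= t - a ord0 i by have := ab i; lra.
    have tba : t - b ord0 i <= t - a ord0 i by have := ab i; lra.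
    have cS : {within `[t - b ord0 i, t - a ord0 i], continuous (mol_prim (R := R) k)}.
      apply: continuous_subspaceT => s; exact: is_derive_continuous (is_derive_mol_prim k s).
    have [s _] := MVT_segment tba (fun s _ => is_derive_mol_prim k s) cS.
    by move=> E'; rewrite -subr_ge0 E' mulr_ge0 ?mol_ge0//; lra.
  have := mol_prim_le1 k (t - a ord0 i); have := mol_prim_ge0 k (t - b ord0 i); lra.
have fE k x : mollify k \1_(box a b) x = \prod_i f k i (x ord0 i) by exact: mollify_box.
apply: (@sqint_dct _ _ _ mu (fun k x => mollify k \1_(box a b) x - \1_(box a b) x) \1_(box a c)) => //.
- by move=> k; apply: measurable_funB => //; exact: measurable_mollify.
- move=> x; apply: cvg_near_cst.
  have /choice[N NP] : forall i, exists N, forall k, (N <= k)%N ->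
      f k i (x ord0 i) = \1_(`]a ord0 i, b ord0 i]%classic) (x ord0 i).
    move=> i; set t := x ord0 i.
    have [ta|ta] := leP t (a ord0 i).
      exists 0%N => k _; rewrite /f !mol_prim_eq0 ?subrr; [|have := ab i; lra|lra].
      by rewrite indicE memNset//= in_itv/= ltNge ta.
    have ta' : 0 < t - a ord0 i by rewrite subr_gt0.
    have ev (s : R) : 0 < s -> exists N, forall k, (N <= k)%N -> mol_prim k s = 1.
      move=> s0; exists (Num.bound s^-1) => k Nk; apply: mol_prim_eq1.
      rewrite invf_ple ?posrE//; apply: ltW.
      have : s^-1 < (Num.bound s^-1)%:R by apply: archi_boundP; rewrite invr_ge0 ltW.
      by move=> /lt_le_trans; apply; rewrite ler_nat leqW.
    have [N1 N1P] := ev _ ta'.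
    have [tb|tb] := leP t (b ord0 i).
      exists N1 => k N1k; rewrite /f N1P// mol_prim_eq0 ?subr0; last lra.
      by rewrite indicE mem_set//= in_itv/= ta tb.
    have tb' : 0 < t - b ord0 i by rewrite subr_gt0.
    have [N2 N2P] := ev _ tb'.
    exists (maxn N1 N2) => k; rewrite geq_max => /andP[N1k N2k].
    rewrite /f N1P// N2P// subrr indicE memNset//= in_itv/= ta /=.
    by rewrite leNgt tb.
  exists (\max_i N i)%N => // k /= Nk; rewrite fE indic_box.
  apply/eqP; rewrite subr_eq0; apply/eqP; apply: eq_bigr => i _; apply: NP.
  by apply: leq_trans Nk; exact: (leq_bigmax i).
- exact: integrable_indic_box.
- move=> k x; rewrite fE; have [xc|xc] := boolP (x \in box a c).
    have -> : \1_(box a c) x = 1 :> R by rewrite indicE xc.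
    have h1 : 0 <= \prod_i f k i (x ord0 i) <= 1.
      rewrite prodr_ge0 => [|i _]; last by case/andP: (f01 k i (x ord0 i)).
      apply: (@le_trans _ _ (\prod_(i < n) 1)); last by rewrite big1.
      by apply: ler_prod => i _; exact: f01.
    have h2 : 0 <= (\1_(box a b) x : R) <= 1 by rewrite indicE ler0n lern1 leq_b1.
    by move: h1 h2; nra.
  have nx : ~ box a c x by move: xc; rewrite notin_setE.
  have [i hi] : exists i, ~ (a ord0 i < x ord0 i <= c ord0 i) by exact/existsNP.
  have f0 : f k i (x ord0 i) = 0.
    move: hi; rewrite mxE /f => /negP; rewrite negb_and -leNgt -ltNge => /orP[h|h].
      by rewrite !mol_prim_eq0 ?subrr//; have := ab i; lra.
    by rewrite !mol_prim_eq11 ?subrr//; have := ab i; lra.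
  have -> : \1_(box a c) x = 0 :> R by rewrite indicE memNset.
  rewrite (bigD1 i)//= f0 mul0r indicE memNset ?subrr ?expr0n//.
  by move=> /(_ i) h; apply: hi; rewrite mxE; move: h => /andP[-> h]; lra.
Qed.

Section within_box.
Variables (a b : E).
Hypothesis ab : forall i, a ord0 i <= b ord0 i.

Definition L2box w := [/\ measurable_fun setT w, (forall x, ~ box a b x -> w x = 0) &
  (sqint mu w < +oo)%E].

(** On the box the modulus of [w] is at most [1 + w^2], and the box has finite measure. *)
Lemma L2box_integrable w : L2box w -> mu.-integrable setT (EFin \o w).
Proof.
move=> [mw w0 Qw].
have i1 := integrable_indic_box ab; have i2 := integrable_sq mw Qw.
apply: (le_integrable measurableT _ _ (integrableD measurableT i1 i2)).
  exact/measurable_EFinP.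
move=> x _ /=; rewrite lee_fin.
have [xB|xB] := boolP (x \in box a b).
  rewrite indicE xB /= mulr1n [leRHS]ger0_norm; last by rewrite addr_ge0// sqr_ge0.
  by rewrite -[w x ^+ 2]real_normK ?num_real//; have := normr_ge0 (w x); nra.
by rewrite w0 ?normr0//; move: xB; rewrite notin_setE.
Qed.

Lemma L2boxD w z : L2box w -> L2box z -> L2box (fun x => w x + z x).
Proof.
move=> [mw w0 Qw] [mz z0 Qz].
have mwz : measurable_fun setT (fun x => w x + z x) by exact: measurable_funD.
split=> //; first by move=> x xB; rewrite w0// z0// addr0.
have fw : sqint mu w \is a fin_num by rewrite ge0_fin_numE// sqint_ge0.
have fz : sqint mu z \is a fin_num by rewrite ge0_fin_numE// sqint_ge0.
apply: le_lt_trans (ltry (2 * (fine (sqint mu w) + fine (sqint mu z)))).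
by apply: (sqint_split mwz mw mz) => //; rewrite fineK.
Qed.

Lemma L2boxZ (r : R) w : L2box w -> L2box (fun x => r * w x).
Proof.
move=> [mw w0 Qw]; split; first exact: measurable_funM.
  by move=> x xB; rewrite w0// mulr0.
have fw : sqint mu w \is a fin_num by rewrite ge0_fin_numE// sqint_ge0.
by rewrite sqintZ// -(fineK fw) -EFinM ltry.
Qed.

Lemma measurable_mollify_sub k w : L2box w ->
  measurable_fun setT (fun x => mollify k w x - w x).
Proof.
move=> gw; apply: measurable_funB; last by case: gw.
by apply: measurable_mollify; exact: L2box_integrable.
Qed.

Lemma mollify_cvgD w z : L2box w -> L2box z -> mollify_cvg w -> mollify_cvg z ->
  mollify_cvg (fun x => w x + z x).
Proof.
move=> gw gz cw cz e e0.
have e4 : 0 < e / 4 by rewrite divr_gt0.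
have [N1 h1] := cw _ e4; have [N2 h2] := cz _ e4.
exists (maxn N1 N2) => k; rewrite geq_max => /andP[N1k N2k].
rewrite (_ : e = 2 * (e / 4 + e / 4)); last by field.
apply: (sqint_split _ (measurable_mollify_sub k gw) (measurable_mollify_sub k gz) _ (h1 k N1k) (h2 k N2k)).
  exact: (measurable_mollify_sub k (L2boxD gw gz)).
by move=> x; rewrite mollifyD; [ring|exact: L2box_integrable..].
Qed.

Lemma mollify_cvgZ (r : R) w : L2box w -> mollify_cvg w -> mollify_cvg (fun x => r * w x).
Proof.
move=> gw cw e e0.
have e4 : 0 < e / (r ^+ 2 + 1) by rewrite divr_gt0// ltr_wpDl// sqr_ge0.
have [N h] := cw _ e4; exists N => k Nk.
rewrite (_ : (fun x => _) = (fun x => r * (mollify k w x - w x))); last first.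
  by apply/funext => x; rewrite mollifyZ ?mulrBr//; exact: L2box_integrable.
rewrite sqintZ; last exact: measurable_mollify_sub.
apply: (@le_trans _ _ ((r ^+ 2)%:E * (e / (r ^+ 2 + 1))%:E)%E).
  by apply: lee_wpmul2l; [rewrite lee_fin sqr_ge0|exact: h].
rewrite -EFinM lee_fin mulrA ler_pdivrMr; last by rewrite ltr_wpDl// sqr_ge0.
by rewrite mulrC ler_wpM2l// ?lerDl// ltW.
Qed.

(** Three-term argument: the mollification of [w - z] is no larger in L^2 than [w - z], uniformly in
    [k], so functions with convergent mollifications form a closed class. *)
Lemma mollify_cvg_lim w : L2box w ->
  (forall e : R, 0 < e -> exists z, [/\ L2box z, mollify_cvg z &
    (sqint mu (fun x => w x - z x)%R <= e%:E)%E]) -> mollify_cvg w.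
Proof.
move=> gw H e e0.
have e10 : 0 < e / 10 by rewrite divr_gt0.
have [z [gz cz wz]] := H _ e10.
have [N h] := cz _ e10; exists N => k Nk.
have gwz : L2box (fun x => w x - z x).
  have := L2boxD gw (L2boxZ (-1) gz).
  by under [X in L2box X]eq_fun do rewrite mulN1r.
have iw := L2box_integrable gw; have iz := L2box_integrable gz.
have iwz := L2box_integrable gwz.
(* Two nested uses of [sqint_split] turn three errors of [e / 10] into [e]. *)
rewrite (_ : e = 2 * (e / 10 + 2 * (e / 10 + e / 10))); last by field.
apply: (@sqint_split _ _ _ mu _ (mollify k (fun x => w x - z x))
  (fun x => (mollify k z x - z x) + -1 * (w x - z x))).
- exact: measurable_mollify_sub.
- exact: measurable_mollify.
- apply: measurable_funD; first exact: measurable_mollify_sub.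
  by case: (L2boxZ (-1) gwz).
- move=> x; rewrite (_ : mollify k w x = mollify k (fun x => w x - z x) x + mollify k z x).
    by ring.
  by rewrite -mollifyD//; congr (mollify k _ x); apply/funext => y; ring.
- apply: le_trans wz; apply: sqint_mollify => //; by case: gwz.
apply: (@sqint_split _ _ _ mu _ (fun x => mollify k z x - z x) (fun x => -1 * (w x - z x))) => //.
- apply: measurable_funD; first exact: measurable_mollify_sub.
  by case: (L2boxZ (-1) gwz).
- exact: measurable_mollify_sub.
- by case: (L2boxZ (-1) gwz).
- exact: h.
- by rewrite sqintZ ?sqrrN ?expr1n ?mul1e//; case: gwz.
Qed.

End within_box.
End mollifier_convergence.

(** * From boxes to all of L^2 on a box *)

Section mollifier_density.
Import HBSimple HBNNSimple.
Variables (R : realType) (n : nat).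
Notation E := 'rV[R]_n.
Notation mu := (lebesgue_rV R n).
Implicit Types (x y : E) (w z : E -> R) (k : nat).

(** Full sides are allowed so that the preimage of an interval under a single coordinate belongs to
    the family, which makes it generate the sigma-algebra; it is stable under intersection, as
    Dynkin's lemma requires. *)
Definition cylinder : set (set E) := [set A | exists Z : 'I_n -> set R,
  (forall i, Z i = setT \/ ocitv (Z i)) /\ A = [set x : E | forall i, Z i (x ord0 i)]].

Lemma measurable_cylinder : @measurable _ E = <<s cylinder >>.
Proof.
apply/seteqP; split.
  apply: smallest_sub; first exact: smallest_sigma_algebra.
  rewrite -bigcup_seq => A /= [i _ [B mB <-]]; rewrite setTI.
  have mcoord : measurable_fun setT
      ((fun x : g_sigma_algebraType cylinder => (x : E) ord0 i) : _ -> measurableTypeR R).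
    apply: (@measurability _ _ _ _ _ _ (@ocitv R)) => //.
    move=> _ [C oC <-]; apply: sub_sigma_algebra; rewrite setTI.
    exists (fun j => if j == i then C else setT); split.
      by move=> j; case: ifP => _; [right|left].
    apply/seteqP; split=> x /=; first by move=> Cx j; case: eqVneq => // ->.
    by move=> /(_ i); rewrite eqxx.
  by have := mcoord measurableT B mB; rewrite setTI.
apply: smallest_sub; first exact: sigma_algebra_measurable.
move=> _ [Z [ZP ->]].
rewrite (_ : [set x | _] = \bigcap_(i in [set: 'I_n]) ((fun x : E => x ord0 i : R) @^-1` Z i)).
  apply: fin_bigcap_measurable => // i _.
  rewrite -[X in measurable X]setTI; apply: measurable_coord => //.
  by case: (ZP i) => [->//|oZ]; exact: sub_sigma_algebra.
by apply/seteqP; split=> x /= h i; [move=> _|]; apply: h.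
Qed.

Lemma cylinderI : setI_closed cylinder.
Proof.
move=> _ _ [Z [ZP ->]] [Y [YP ->]]; exists (fun i => Z i `&` Y i); split.
  move=> i; case: (ZP i) => [->|oZ]; first by rewrite setTI.
  by right; case: (YP i) => [->|oY]; rewrite ?setIT//; exact: ocitvI.
apply/seteqP; split=> x /=; first by move=> [h1 h2] i.
by move=> h; split=> i; case: (h i).
Qed.

Variables (a b : E).
Hypothesis ab : forall i, a ord0 i <= b ord0 i.

Lemma L2box_indic A : measurable A -> L2box a b \1_(A `&` box a b).
Proof.
move=> mA; have mAB : measurable (A `&` box a b).
  by apply: measurableI => //; exact: measurable_box.
split; first exact: measurable_indic.
  by move=> x nx; rewrite indicE memNset// => -[].
rewrite /sqint (eq_integral (fun x => (\1_(A `&` box a b) x)%:E)); last first.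
  by move=> x _; rewrite indicE; case: (x \in _); rewrite ?expr1n ?expr0n.
rewrite integral_indic// setIT.
apply: le_lt_trans (lebesgue_box_lty ab); apply: le_measure; rewrite ?inE//.
  exact: measurable_box.
Qed.

Lemma mollify_cvg_cylinder A : cylinder A -> mollify_cvg (\1_(A `&` box a b) : E -> R).
Proof.
move=> [Z [ZP ->]].
have /choice[cd cdP] : forall i, exists cd : R * R, cd.1 <= cd.2 /\
    Z i `&` `]a ord0 i, b ord0 i]%classic = `]cd.1, cd.2]%classic.
  move=> i; have : ocitv (Z i `&` `]a ord0 i, b ord0 i]%classic).
    by case: (ZP i) => [->|oZ]; [rewrite setTI|apply: ocitvI => //]; exact: is_ocitv.
  (* An empty interval with [d < c] is rewritten as []c, c]], since [mollify_cvg_box] asks for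
     ordered endpoints. *)
  move=> [[c d] _ <-]; exists (c, Num.max c d); split; first by rewrite le_max lexx.
  rewrite /=; have [cd|cd] := leP c d; first by [].
  by rewrite !set_itv_ge// bnd_simp -?leNgt// ?ltW.
rewrite (_ : _ `&` _ = box (\row_i (cd i).1) (\row_i (cd i).2)).
  by apply: mollify_cvg_box => i; rewrite !mxE; case: (cdP i).
have cdE i (t : R) : (cd i).1 < t <= (cd i).2 <-> Z i t /\ (a ord0 i < t <= b ord0 i).
  have [_ e] := cdP i; have := congr1 (fun X : set R => X t) e; rewrite /= !in_itv/= => e'.
  by rewrite -e'.
apply/seteqP; split=> x /=.
  by move=> [h1 h2] i; rewrite !mxE; apply/cdE; split; [exact: h1|exact: h2].
by move=> h; split=> i; have := h i; rewrite !mxE => /cdE[].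
Qed.

(** Dynkin induction from cylinders. Complements are taken inside the box, by linearity; a disjoint
    countable union is the L^2 limit of its finite partial unions, by dominated convergence. *)
Lemma mollify_cvg_measurable A : measurable A -> mollify_cvg (\1_(A `&` box a b) : E -> R).
Proof.
move=> mA; have sA : <<s cylinder >> A by rewrite -measurable_cylinder.
apply: (@dynkin_induction _ E cylinder (fun A => mollify_cvg (\1_(A `&` box a b) : E -> R))
  measurable_cylinder cylinderI _ _ _ _ A sA) => {A mA sA}.
- by rewrite /= setTI; exact: mollify_cvg_box.
- by move=> A /=; exact: mollify_cvg_cylinder.
- move=> A mA /= cA.
  have g1 := L2box_indic measurableT; have g2 := L2boxZ (-1) (L2box_indic mA).
  rewrite (_ : \1__ = (fun x => \1_(setT `&` box a b) x + -1 * \1_(A `&` box a b) x : R)); last first.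
    apply/funext => x; rewrite !indicE !in_setI in_setT in_setC /=.
    by case: (x \in A); case: (x \in box a b) => /=; ring.
  apply: (mollify_cvgD ab g1 g2); last exact: mollify_cvgZ (L2box_indic mA) cA.
  by rewrite setTI; exact: mollify_cvg_box.
- move=> F mF tF cF /=.
  have mU : measurable (\bigcup_k F k) by exact: bigcupT_measurable.
  apply: (mollify_cvg_lim ab (L2box_indic mU)).
  pose z N : E -> R := \1_(\big[setU/set0]_(k < N) F k `&` box a b).
  have mz N : measurable (\big[setU/set0]_(k < N) F k) by exact: bigsetU_measurable.
  have zS N : z N.+1 = (fun x => z N x + \1_(F N `&` box a b) x).
    apply/funext => x; rewrite /z big_ord_recr /= !indicE setIUl in_setU.
    case: (boolP (x \in \big[setU/set0]_(k < N) F k `&` box a b)) => h1;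
      case: (boolP (x \in F N `&` box a b)) => h2 /=; rewrite ?addr0 ?add0r//.
    (* A common point of [F N] and an earlier set would contradict disjointness, so the indicators
       do add up. *)
    exfalso; move: h1 h2; rewrite !inE => -[+ _] [h2 _].
    rewrite -bigcup_mkord => -[j /= jN Fj].
    have := tF j N Logic.I Logic.I; move=> /(_ (ex_intro _ x (conj Fj h2))) jNE.
    by rewrite jNE ltnn in jN.
  have cz N : mollify_cvg (z N).
    elim: N => [|N IH].
      rewrite /z big_ord0 set0I indic0 => e e0; exists 0%N => k _.
      rewrite (_ : (fun x => _) = (fun=> 0)).
        by rewrite /sqint integral0_eq ?lee_fin ?ltW// => x _; rewrite expr0n.
      apply/funext => x; rewrite /mollify /convol subr0 /Rintegral integral0_eq//.
      by move=> y _; rewrite mulr0.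
    rewrite zS; apply: (mollify_cvgD ab) => //; exact: L2box_indic.
  have D := @sqint_dct _ _ _ mu (fun N x => \1_((\bigcup_k F k) `&` box a b) x - z N x)
    \1_(box a b) _ _ (integrable_indic_box ab) _.
  have {}D : forall e : R, 0 < e -> exists N, forall k, (N <= k)%N ->
     (sqint mu (fun x => \1_((\bigcup_k F k) `&` box a b) x - z k x)%R <= e%:E)%E.
    apply: D.
    + move=> N; apply: measurable_funB; first by case: (L2box_indic mU).
      by case: (L2box_indic (mz N)).
    + move=> x; apply: cvg_near_cst.
      have [[j _ Fj]|nU] := pselect ((\bigcup_k F k) x); last first.
        exists 0%N => // N _; rewrite /z !indicE !memNset ?subrr//; last by move=> [].
        by move=> [+ _]; rewrite -bigcup_mkord => -[j _ Fj]; apply: nU; exists j.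
      exists j.+1 => // N /= jN; rewrite /z !indicE !in_setI.
      have e1 : x \in \bigcup_k F k by rewrite inE; exists j.
      have e2 : x \in \big[setU/set0]_(k < N) F k by rewrite inE -bigcup_mkord; exists j.
      by rewrite e1 e2 subrr.
    + move=> N x; rewrite /z !indicE !in_setI.
      case: (x \in box a b); rewrite ?andbF ?subrr ?expr0n//= !andbT.
      by case: (x \in _); case: (x \in _); rewrite /= ?subrr ?subr0 ?sub0r ?sqrrN ?expr1n ?expr0n ?ler01.
  move=> e /D[N /(_ N (leqnn N)) h]; exists (z N); split=> //.
  exact: L2box_indic.
Qed.

(** The increasing simple approximations vanish off the box, are finite combinations of indicators,
    and converge to [w] in L^2 with domination by [w^2]. *)
Lemma mollify_cvg_ge0 w : (forall x, 0 <= w x) -> L2box a b w -> mollify_cvg w.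
Proof.
move=> w0 gw; have [mw wB Qw] := gw.
have mEw : measurable_fun setT (EFin \o w) by exact/measurable_EFinP.
pose g N := nnsfun_approx measurableT mEw N.
have gle N x : 0 <= g N x <= w x.
  rewrite fun_ge0 /= -lee_fin /g nnsfun_approxE.
  by apply: (@le_approx _ _ _ setT (EFin \o w)) => // y _; rewrite lee_fin.
have gB N x : ~ box a b x -> g N x = 0.
  move=> nx; apply/eqP; rewrite eq_le; have := gle N x; rewrite wB// => /andP[-> ->]//.
have simple N : L2box a b (g N) /\ mollify_cvg (g N).
  have E1 : (g N : E -> R) = (fun x => \sum_(r <- finmap.enum_fset (fset_set (range (g N))))
      r * \1_((g N @^-1` [set r]) `&` box a b) x).
    apply/funext => x; rewrite [LHS]fimfunE fsbig_finite//=; apply: eq_bigr => r _.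
    rewrite !indicE in_setI; have [xB|xB] := boolP (x \in box a b); first by rewrite andbT.
    rewrite andbF /=; case: (boolP (x \in _)) => //; rewrite inE /= => gr.
    by rewrite -gr gB ?mul0r//; move: xB; rewrite notin_setE.
  rewrite E1; elim: (finmap.enum_fset _) => [|r s [g1 c1]].
    have -> : (fun x => \sum_(r <- [::]) r * \1_(g N @^-1` [set r] `&` box a b) x) =
      (\1_(set0 `&` box a b) : E -> R).
      by apply/funext => x; rewrite big_nil set0I indic0.
    by split; [exact: L2box_indic|exact: mollify_cvg_measurable].
  have mr : measurable (g N @^-1` [set r]) by exact: measurable_sfunP.
  have gr := L2boxZ r (L2box_indic mr).
  have cr : mollify_cvg (fun x => r * \1_((g N @^-1` [set r]) `&` box a b) x) :=
    mollify_cvgZ ab r (L2box_indic mr) (mollify_cvg_measurable mr).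
  under eq_fun do rewrite big_cons.
  by split; [exact: L2boxD|exact: mollify_cvgD].
apply: (mollify_cvg_lim ab gw).
have D : forall e : R, 0 < e -> exists N, forall k, (N <= k)%N ->
     (sqint mu (fun x => w x - g k x)%R <= e%:E)%E.
  apply: (@sqint_dct _ _ _ mu (fun k x => w x - g k x) (fun x => w x ^+ 2)).
  - by move=> k; apply: measurable_funB.
  - move=> x; rewrite -(subrr (w x)); apply: cvgB; first exact: cvg_cst.
    have := @cvg_nnsfun_approx _ _ _ setT measurableT _ mEw _ x Logic.I.
    move=> H; have {}H := H (fun y _ => w0 y).
    by move/fine_cvgP : H => [_]; exact.
  - exact: integrable_sq.
  - move=> k x; have /andP[h1 h2] := gle k x; have := w0 x; nra.
move=> e /D[N /(_ N (leqnn N)) h]; exists (g N); have [? ?] := simple N; split=> //.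
Qed.

Lemma mollify_cvgT w : L2box a b w -> mollify_cvg w.
Proof.
move=> [mw w0 Qw].
(* Here [s] stands for 1 or -1, so the positive and negative parts are treated at once. *)
have part (s : R) : s ^+ 2 = 1 -> L2box a b (fun x => Num.max (s * w x) 0).
  move=> s2; have m1 : measurable_fun setT (fun x => Num.max (s * w x) 0).
    by apply: measurable_maxr => //; exact: measurable_funM.
  split=> //; first by move=> x /w0 ->; rewrite mulr0 maxxx.
  apply: le_lt_trans Qw; apply: le_sqint => // x.
  have -> : `|w x| = `|s * w x|.
    rewrite normrM (_ : `|s| = 1) ?mul1r//.
    by apply/eqP; rewrite -(@eqrXn2 _ 2) ?real_normK ?num_real ?expr1n ?s2.
  by have [h|h] := leP (s * w x) 0; rewrite ?normr0.
have p1 := part 1 (expr1n _ _); have p2 := part (-1) ltac:(by rewrite sqrrN expr1n).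
rewrite (_ : w = (fun x => Num.max (1 * w x) 0 + -1 * Num.max (-1 * w x) 0)); last first.
  apply/funext => x; rewrite mul1r !mulN1r.
  have [h|h] := leP (w x) 0; have [h'|h'] := leP (- w x) 0; lra.
apply: (mollify_cvgD ab p1 (L2boxZ (-1) p2)).
  by apply: mollify_cvg_ge0 => // x; rewrite le_max lexx orbT.
apply: (mollify_cvgZ ab _ p2).
by apply: mollify_cvg_ge0 => // x; rewrite le_max lexx orbT.
Qed.

End mollifier_density.

Lemma ext_in (T : Type) (R : realType) (D : set T) (f : T -> R) x : D x -> (f \_ D) x = f x.
Proof. by move=> Dx; rewrite patchE mem_set. Qed.

Lemma ext_out (T : Type) (R : realType) (D : set T) (f : T -> R) x : ~ D x -> (f \_ D) x = 0.
Proof. by move=> Dx; rewrite patchE memNset. Qed.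

Section norm2.
Variables (R : realType) (n : nat) (Omega : set 'rV[R]_n).
Notation E := 'rV[R]_n.
Notation mu := (lebesgue_rV R n).
Implicit Types (v w : E -> R).

Lemma norm2E v : norm2 Omega v = ((sqint mu (v \_ Omega)) `^ 2^-1)%E.
Proof.
rewrite /norm2 unlock /= /sqint; congr (_ `^ _)%E; apply: eq_integral => x _.
by rewrite /= powR_mulrn// real_normK ?num_real.
Qed.

Lemma norm2_lty v : (norm2 Omega v < +oo)%E = (sqint mu (v \_ Omega) < +oo)%E.
Proof.
rewrite norm2E; apply/idP/idP; last exact: poweR_lty.
exact: lty_poweRy.
Qed.

Lemma norm2_le v (c : R) : 0 <= c ->
  (norm2 Omega v <= c%:E)%E = (sqint mu (v \_ Omega) <= (c ^+ 2)%:E)%E.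
Proof.
move=> c0; rewrite norm2E.
have [Qf|Qi] := boolP (sqint mu (v \_ Omega) \is a fin_num); last first.
  have -> : sqint mu (v \_ Omega) = +oo%E.
    by apply/eqP; rewrite -leye_eq leNgt; apply: contra Qi => h; rewrite ge0_fin_numE// sqint_ge0.
  by rewrite poweRyr// !leye_eq.
have Q0 := sqint_ge0 mu (v \_ Omega); move: Q0; rewrite -(fineK Qf) lee_fin => Q0.
rewrite poweR_EFin !lee_fin powR12_sqrt//.
by rewrite -{2}(sqr_sqrtr Q0) ler_sqr ?nnegrE ?sqrtr_ge0.
Qed.

End norm2.

(** * Test functions and weak derivatives *)

Section test_functions.
Variables (R : realType) (n : nat) (Omega : set 'rV[R]_n).
Hypotheses (oOmega : open Omega).
Notation E := 'rV[R]_n.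
Notation mu := (lebesgue_rV R n).
Implicit Types (x y : E) (v w phi : E -> R) (k : nat).

Lemma measurable_Omega : measurable Omega.
Proof. exact: open_measurable_rV. Qed.

Let mOmega := measurable_Omega.

Lemma in_L2P v : in_L2 Omega v <->
  measurable_fun setT (v \_ Omega) /\ (sqint mu (v \_ Omega) < +oo)%E.
Proof.
by rewrite /in_L2 norm2_lty; split=> -[mv ?]; split=> //; apply/(measurable_restrictT _ mOmega).
Qed.

Lemma test_function_of_support phi (C : set E) : (forall k, Ck k setT phi) ->
  compact C -> C `<=` Omega -> (forall x, phi x != 0 -> C x) -> test_function Omega phi.
Proof.
move=> sphi cC CO phiC.
have clC : closed C by apply: compact_closed => //; exact: norm_hausdorff.
have sub : closure [set x | phi x != 0] `<=` C.
  by rewrite [X in _ `<=` X](closure_id C).1//; apply: closureS.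
split=> //; last exact: subset_trans CO.
apply: subclosed_compact sub => //; exact: closed_closure.
Qed.

Definition cbox (a b : E) : set E := [set x | forall i, a ord0 i <= x ord0 i <= b ord0 i].

Lemma compact_cbox a b : compact (cbox a b).
Proof.
rewrite (_ : cbox a b = [set x : E | forall i, [set` `[a ord0 i, b ord0 i]] (x ord0 i)]).
  by apply: (@rV_compact R n (fun i => [set` `[a ord0 i, b ord0 i]])) => i; exact: segment_compact.
by apply/seteqP; split=> x /= h i; have := h i; rewrite /= in_itv.
Qed.

(** The cube with upper corner [x] outside which the kernel [mol_rV k (x - y)] vanishes as a
    function of [y]. *)
Definition mol_support k x : set E := cbox (\row_i (x ord0 i - k.+1%:R^-1)) x.

Lemma mol_rV_eq0 k x y : ~ mol_support k x y -> mol_rV k (x - y) = 0.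
Proof.
move=> /existsNP[i] hi; rewrite /mol_rV /tensor (bigD1 i)//= !mxE mol_eq0 ?mul0r//.
move: hi; rewrite mxE => /negP; rewrite negb_and -!ltNge => /orP[h|h]; [right|left].
  by rewrite lerBrDr addrC -lerBrDr ltW.
by rewrite subr_le0 ltW.
Qed.

Lemma test_mol k x : mol_support k x `<=` Omega -> test_function Omega (fun y => mol_rV k (x - y)).
Proof.
move=> sO; apply: (@test_function_of_support _ (mol_support k x)) => //; last 2 first.
- exact: compact_cbox.
- by move=> y; apply: contra_neqP => /mol_rV_eq0.
  move=> m; rewrite (_ : (fun y => _) = tensor (fun i t => mol k (-1 * t + x ord0 i))).
    apply: Ck_tensor => i; apply: (@smooth_compact_affine R (mol k)); last exact: smooth_compact_mol.
    by rewrite oppr_eq0 oner_eq0.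
  by apply/funext => y; apply: eq_bigr => i _; rewrite !mxE mulN1r addrC.
Qed.

Lemma partial_mol k x i y : partial i (fun y => mol_rV k (x - y)) y =
  - tensor (derive_factor (fun=> mol k) i) (x - y).
Proof.
suff H : is_derive y (delta_mx ord0 i) (fun y => mol_rV k (x - y))
    (- tensor (derive_factor (fun=> mol k) i) (x - y)).
  by rewrite /partial derive_val.
apply/is_derive_line0.
have d0 : is_derive (x - y) (delta_mx ord0 i) (tensor (fun=> mol k))
    (tensor (derive_factor (fun=> mol k) i) (x - y)).
  by apply: is_derive_tensor => j; case: (smooth_compact_mol R k).
have /is_derive_line0 d1 := d0.
have d2 : is_derive (0 : R) (1 : R) (fun s : R => - s) (- 1) by exact: is_deriveNid.
have d1' : is_derive (- (0 : R)) (1 : R)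
   (fun s : R => tensor (fun=> mol k) (s *: delta_mx ord0 i + (x - y)))
   (tensor (derive_factor (fun=> mol k) i) (x - y)) by rewrite oppr0.
have := @is_derive_comp1 _ _ _ _ _ _ _ _ d1' d2.
rewrite mulrN1; congr (is_derive _ _ _ _); apply/funext => s.
by rewrite /mol_rV; congr tensor; rewrite scaleNr opprD addrCA.
Qed.

Lemma integrable_ext v : mu.-integrable Omega (EFin \o v) <->
  mu.-integrable setT (EFin \o (v \_ Omega)).
Proof.
rewrite (integrable_mkcond _ mOmega) (_ : (EFin \o v) \_ Omega = EFin \o (v \_ Omega))//.
by apply/funext => x; rewrite /= !patchE; case: ifP.
Qed.

Lemma integral_ext v : (\int[mu]_(x in Omega) (v x)%:E = \int[mu]_x ((v \_ Omega) x)%:E)%E.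
Proof.
rewrite integral_mkcond; apply: eq_integral => x _; rewrite !patchE; case: ifP => //.
Qed.

(** When the cube lies in [Omega], the kernel in [y] is a test function. Its derivative in [y] is
    minus the derivative in [x], and this sign cancels the one in [weak_partial]. *)
Lemma partial_mollify k v w i x :
  mu.-integrable setT (EFin \o (v \_ Omega)) -> mu.-integrable setT (EFin \o (w \_ Omega)) ->
  weak_partial Omega i v w -> mol_support k x `<=` Omega ->
  partial i (mollify k (v \_ Omega)) x = mollify k (w \_ Omega) x.
Proof.
move=> iv iw vw sO.
have dm := is_derive_convol x i (fun _ : 'I_n => smooth_compact_mol R k) iv.
rewrite /partial (_ : mollify k (v \_ Omega) = convol (fun=> mol k) (v \_ Omega))// derive_val.
have := vw _ (test_mol sO); rewrite !integral_ext => /(congr1 fine); rewrite fineN => h.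
have i1 := integrable_convol x (smooth_compact_derive_factor i (fun _ : 'I_n => smooth_compact_mol R k)) iv.
have e1 : fine (\int[mu]_y (((fun y => v y * partial i (fun y => mol_rV k (x - y)) y) \_ Omega) y)%:E)
  = -1 * convol (derive_factor (fun=> mol k) i) (v \_ Omega) x.
  rewrite /convol -RintegralZl//; congr fine; apply: eq_integral => y _; congr EFin.
  have [Oy|nO] := pselect (Omega y); last by rewrite !ext_out// !mulr0.
  by rewrite !ext_in// partial_mol; ring.
rewrite e1 mulN1r in h; have {}h := oppr_inj h; rewrite h.
congr fine; apply: eq_integral => y _; congr EFin.
have [Oy|nO] := pselect (Omega y); last by rewrite !ext_out// mulr0.
by rewrite !ext_in// mulrC.
Qed.

Lemma bounded_box : bounded_set Omega -> exists a b : E,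
  (forall i, a ord0 i <= b ord0 i) /\ Omega `<=` box a b.
Proof.
move=> [M [Mr HM]].
have HM1 x : Omega x -> `|x| <= `|M| + 1.
  by move=> Ox; apply: (HM (`|M| + 1)) => //; rewrite (le_lt_trans (ler_norm _))// ltrDl.
exists (const_mx (- (`|M| + 2))), (const_mx (`|M| + 2)); split.
  by move=> i; rewrite !mxE; have := normr_ge0 M; lra.
move=> x /HM1 xM i; rewrite !mxE.
by have := le_trans (coord_norm_le x i) xM; rewrite ler_norml; lra.
Qed.

Section bounded.
Hypothesis bO : bounded_set Omega.

Lemma in_L2_L2box v : in_L2 Omega v -> exists a b : E,
  [/\ forall i, a ord0 i <= b ord0 i, Omega `<=` box a b & L2box a b (v \_ Omega)].
Proof.
move=> /in_L2P[mv Qv]; have [a [b [ab Oab]]] := bounded_box bO.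
exists a, b; split=> //; split=> // x nx; apply: ext_out; exact: contra_not (Oab x) nx.
Qed.

Lemma in_L2_integrable v : in_L2 Omega v -> mu.-integrable setT (EFin \o (v \_ Omega)).
Proof. by move=> /in_L2_L2box[a [b [ab _]]]; exact: L2box_integrable. Qed.

Lemma in_L2_mollify_cvg v : in_L2 Omega v -> mollify_cvg (v \_ Omega).
Proof. by move=> /in_L2_L2box[a [b [ab _]]]; exact: mollify_cvgT. Qed.

Lemma mu_bounded_lty : (mu Omega < +oo)%E.
Proof.
have [a [b [ab Oab]]] := bounded_box bO.
apply: le_lt_trans (lebesgue_box_lty ab); apply: le_measure; rewrite ?inE//.
exact: measurable_box.
Qed.

Lemma mol_support_eventually x : Omega x -> exists N, forall k, (N <= k)%N -> mol_support k x `<=` Omega.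
Proof.
move=> Ox; have /nbhs_ballP[e /= e0 eO] : nbhs x Omega by exact: open_nbhs_nbhs.
exists (Num.bound (e^-1)) => k Nk y hy; apply: eO; rewrite -ball_normE /=.
have ke : k.+1%:R^-1 < e.
  rewrite invf_plt ?posrE//.
  have : e^-1 < (Num.bound e^-1)%:R by apply: archi_boundP; rewrite invr_ge0 ltW.
  by move=> /lt_le_trans; apply; rewrite ler_nat leqW.
apply: rV_norm_lt => // i; have := hy i; rewrite !mxE => /andP[h1 h2].
rewrite ger0_norm ?subr_ge0//; apply: le_lt_trans ke.
by rewrite lerBlDr addrC -lerBlDr.
Qed.

(** Testing against the kernels shows that the mollifications vanish at each point of [Omega] for
    large [k], while they converge to [w] in L^2. Fatou's lemma for the squared differences then
    leaves no room for a nonzero [w]. *)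
Lemma fundamental_lemma w : in_L2 Omega w ->
  (forall phi, test_function Omega phi -> (\int[mu]_(x in Omega) (w x * phi x)%:E = 0)%E) ->
  sqint mu (w \_ Omega) = 0%E.
Proof.
move=> gw hw; have iw := in_L2_integrable gw.
have [mw Qw] := (in_L2P w).1 gw.
have mm k : measurable_fun setT (fun x => mollify k (w \_ Omega) x - (w \_ Omega) x).
  by apply: measurable_funB => //; exact: measurable_mollify.
have ev x : Omega x -> exists N, forall k, (N <= k)%N -> mollify k (w \_ Omega) x = 0.
  move=> /mol_support_eventually[N NP]; exists N => k /NP sO.
  have := hw _ (test_mol sO); rewrite integral_ext => /(congr1 fine) /= <-.
  congr fine; apply: eq_integral => y _; congr EFin.
  have [Oy|nO] := pselect (Omega y); last by rewrite !ext_out// mulr0.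
  by rewrite !ext_in// mulrC.
pose f k x := (((mollify k (w \_ Omega) x - (w \_ Omega) x)) ^+ 2)%:E.
have fat : (\int[mu]_(x in Omega) limn_einf (f ^~ x) <=
    limn_einf (fun k => \int[mu]_(x in Omega) f k x))%E.
  apply: fatou => //.
  - by move=> k; apply: measurable_funTS; exact: measurable_sq.
  - by move=> k x _; rewrite lee_fin sqr_ge0.
have lim0 : (\int[mu]_(x in Omega) f k x)%E @[k --> \oo] --> 0%E.
  have [N0 HN0] := in_L2_mollify_cvg gw ltr01.
  have le k : (\int[mu]_(x in Omega) f k x <= sqint mu (fun x => mollify k (w \_ Omega) x - (w \_ Omega) x)%R)%E.
    apply: ge0_subset_integral => //; first exact: measurable_sq.
    by move=> x _; rewrite lee_fin sqr_ge0.
  have ge k : (0 <= \int[mu]_(x in Omega) f k x)%E.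
    by apply: integral_ge0 => x _; rewrite lee_fin sqr_ge0.
  apply/fine_cvgP; split.
    exists N0 => // k /= Nk; rewrite ge0_fin_numE//.
    by apply: le_lt_trans (le k) _; apply: le_lt_trans (HN0 k Nk) _; exact: ltry.
  apply/cvgrPdist_le => e e0; have [N HN] := in_L2_mollify_cvg gw e0.
  exists N => // k /= Nk; rewrite sub0r normrN ger0_norm ?fine_ge0//.
  have h := le_trans (le k) (HN k Nk).
  have fk : (\int[mu]_(x in Omega) f k x)%E \is a fin_num.
    by rewrite ge0_fin_numE//; apply: le_lt_trans h _; exact: ltry.
  by rewrite -lee_fin fineK.
have := fat; rewrite (cvg_limn_einf_sup lim0).1 => {}fat.
apply/eqP; rewrite eq_le sqint_ge0 andbT; apply: le_trans fat.
rewrite le_eqVlt; apply/orP; left; apply/eqP.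
rewrite /sqint [RHS]integral_mkcond; apply: eq_integral => x _.
rewrite [RHS]patchE; have [Ox|nO] := pselect (Omega x); last by rewrite memNset// ext_out// expr0n.
rewrite mem_set//; apply/esym; apply: (cvg_limn_einf_sup _).1.
have [N NP] := ev x Ox; apply: cvg_near_cst; exists N => // k /= Nk.
by rewrite /f NP// sub0r sqrrN.
Qed.

End bounded.
End test_functions.

Section continuity.
Variables (R : realType) (V W : normedModType R).

Lemma continuous_near_eq (f g : V -> W) (x : V) :
  (\forall y \near x, f y = g y) -> {for x, continuous g} -> {for x, continuous f}.
Proof.
move=> fg cg; have fgx := nbhs_singleton fg.
suff : f y @[y --> x] --> g x by rewrite -fgx.
by apply: cvg_trans cg; apply: near_eq_cvg; apply: filterS fg => y ->.
Qed.

Lemma is_derive_norm_gt (f : V -> R) (x v : V) (M : R) :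
  M < `|x| -> (forall y, M < `|y| -> f y = 0) -> is_derive x v f 0.
Proof.
move=> Mx f0; apply: (@is_derive_ext _ _ _ (fun=> 0)).
have nx : {for x, continuous (fun y : V => `|y|)} by exact: norm_continuous.
have H : \forall y \near x, M < `|y| by exact: (cvgr_gt _ nx).
by apply: filterS H => y; exact: f0.
Qed.

End continuity.

(** * Integration by parts against test functions *)

Section integral_partial.
Variable R : realType.

Lemma bounded_continuous_support n (g : 'rV[R]_n -> R) (M : R) :
  continuous g -> (forall x : 'rV[R]_n, M < `|x| -> g x = 0) ->
  exists B, forall x, `|g x| <= B.
Proof.
move=> cg gM.
pose a : 'rV[R]_n := const_mx (- (`|M| + 1)); pose b : 'rV[R]_n := const_mx (`|M| + 1).
have inb x : ~ cbox a b x -> g x = 0.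
  move=> nx; apply: gM; rewrite ltNge; apply/negP => xM; apply: nx => i.
  have := le_trans (coord_norm_le x i) (le_trans xM (ler_norm M)).
  by rewrite !mxE ler_norml; lra.
have Kne : cbox a b !=set0.
  by exists a => i; rewrite lexx !mxE; have := normr_ge0 M; lra.
have cng : {within cbox a b, continuous (fun x => `|g x|)}.
  by apply: continuous_subspaceT => x; apply: continuous_comp; [exact: cg|exact: norm_continuous].
have [c _ gc] := EVT_max_rV Kne (compact_cbox (a:=a) (b:=b)) cng.
exists `|g c| => x; have [xB|/inb ->] := pselect (cbox a b x); last by rewrite normr0.
by apply: gc; rewrite inE.
Qed.

Lemma integrable_continuous_bounded_support n (g : 'rV[R]_n -> R) (M : R) :
  continuous g -> (forall x : 'rV[R]_n, M < `|x| -> g x = 0) ->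
  (lebesgue_rV R n).-integrable setT (EFin \o g).
Proof.
move=> cg gM; have [B gB] := bounded_continuous_support cg gM.
pose a : 'rV[R]_n := const_mx (- (`|M| + 1)); pose b : 'rV[R]_n := const_mx (`|M| + 1).
have ab i : a ord0 i <= b ord0 i by rewrite !mxE; have := normr_ge0 M; lra.
have inb x : ~ box a b x -> g x = 0.
  move=> nx; apply: gM; rewrite ltNge; apply/negP => xM; apply: nx => i.
  have := le_trans (coord_norm_le x i) (le_trans xM (ler_norm M)).
  by rewrite !mxE ler_norml; lra.
rewrite (_ : g = (fun x => g x * \1_(box a b) x)); last first.
  apply/funext => x; rewrite indicE; have [xB|xB] := boolP (x \in box a b); first by rewrite mulr1.
  by rewrite mulr0 inb//; move: xB; rewrite notin_setE.
apply: (@integrable_bounded_mul _ _ _ _ _ _ _ B) => //.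
  exact: continuous_measurable_rV.
exact: integrable_indic_box.
Qed.

Lemma sub_coord n (x y : 'rV[R]_n) i : (x - y) ord0 i = x ord0 i - y ord0 i.
Proof. by rewrite !mxE. Qed.

Lemma cons_rV_lineE n (p : R * 'rV[R]_n) i : cons_rV p ord0 i =
  if unlift ord0 i is Some j then p.2 ord0 j else p.1.
Proof. by case: unliftP => [j ->|->]; rewrite ?cons_rVS ?cons_rV0. Qed.

Lemma cons_rV_line0 n (t : R) (y : 'rV[R]_n) :
  cons_rV (t, y) = t *: delta_mx ord0 ord0 + cons_rV (0 : R, y).
Proof.
apply/rowP => i; rewrite [RHS]mxE !cons_rV_lineE !mxE eqxx /=.
case: unliftP => [j ->|->] /=; last by rewrite ?eqxx ?mulr1 addr0.
by rewrite mulr0 add0r.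
Qed.

Lemma cons_rV_lineS n (t h : R) (y : 'rV[R]_n) j :
  cons_rV (t, h *: delta_mx ord0 j + y) = h *: delta_mx ord0 (lift ord0 j) + cons_rV (t, y).
Proof.
apply/rowP => i; rewrite [RHS]mxE !cons_rV_lineE !mxE eqxx /=.
case: unliftP => [k ->|->] /=; last by rewrite mulr0 add0r.
by rewrite !mxE eqxx (inj_eq lift_inj).
Qed.

Lemma cons_rV_norm_le n (t : R) (y : 'rV[R]_n) : `|t| <= `|cons_rV (t, y)| /\ `|y| <= `|cons_rV (t, y)|.
Proof.
split; first by have := coord_norm_le (cons_rV (t, y)) ord0; rewrite cons_rV0.
apply: rV_norm_le => // j.
by have := coord_norm_le (cons_rV (t, y)) (lift ord0 j); rewrite cons_rVS.
Qed.

(** Induction on the dimension with Fubini: the slices are covered by the induction hypothesis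
    unless the first coordinate is the differentiated one, where the fundamental theorem of calculus
    applies on a segment with [F] zero at both ends. *)
Lemma integral_partial n (i : 'I_n) (F : 'rV[R]_n -> R) (M : R) :
  (forall x, derivable F x (delta_mx ord0 i)) -> continuous (partial i F) ->
  (forall x : 'rV[R]_n, M < `|x| -> F x = 0) ->
  (\int[lebesgue_rV R n]_x (partial i F x)%:E = 0)%E.
Proof.
have zero m (j : 'I_m) (G : 'rV[R]_m -> R) : (forall x : 'rV[R]_m, M < `|x| -> G x = 0) ->
    forall x : 'rV[R]_m, M < `|x| -> partial j G x = 0.
  move=> G0 x Mx; rewrite /partial.
  suff H : is_derive x (delta_mx ord0 j) G 0 by rewrite derive_val.
  exact: is_derive_norm_gt Mx G0.
elim: n i F => [[]//|n IH] i F dF cF F0.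
have iF := integrable_continuous_bounded_support cF (zero _ _ _ F0).
have [E1 E2] := integral_rVS iF.
case: (unliftP ord0 i) => [j ij|i0].
- rewrite E1; apply: integral0_eq => t _.
  have dl y : is_derive y (delta_mx ord0 j) (fun y => F (cons_rV (t, y))) (partial i F (cons_rV (t, y))).
    apply/is_derive_line0.
    have d1 : is_derive (cons_rV (t, y)) (delta_mx ord0 i) F (partial i F (cons_rV (t, y))).
      by apply/derivableP; exact: dF.
    have /is_derive_line0 := d1; congr (is_derive _ _ _ _); apply/funext => s.
    by rewrite cons_rV_lineS ij.
  have pE : partial j (fun y => F (cons_rV (t, y))) = (fun y => partial i F (cons_rV (t, y))).
    by apply/funext => y; rewrite {1}/partial derive_val.
  have := IH j (fun y => F (cons_rV (t, y))); rewrite pE; apply.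
  + by move=> y; have [] := dl y.
  + move=> y; apply: (@continuous_comp _ _ _ (fun y => cons_rV (t, y))); last exact: cF.
    apply: (@lipschitz_continuous_at _ _ _ 1) => z; rewrite mul1r.
    apply: rV_norm_le => // k; rewrite sub_coord !cons_rV_lineE; case: unliftP => [l _|_] /=.
      by have := coord_norm_le (z - y) l; rewrite !mxE.
    by rewrite subrr normr0.
  + by move=> y My; apply: F0; apply: lt_le_trans My _; have [] := cons_rV_norm_le t y.
- rewrite E2; apply: integral0_eq => y _.
  have dl (t : R) : is_derive t (1 : R) (fun t => F (cons_rV (t, y))) (partial i F (cons_rV (t, y))).
    rewrite (_ : (fun t => _) = (fun t => F (t *: delta_mx ord0 i + cons_rV (0, y)))); last first.
      by apply/funext => s; rewrite cons_rV_line0 i0.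
    rewrite (cons_rV_line0 t y) -i0; apply/is_derive_line; apply/derivableP; exact: dF.
  have M0 : - (`|M| + 1) <= `|M| + 1 by have := normr_ge0 M; lra.
  have ct : continuous (fun t => partial i F (cons_rV (t, y))).
    move=> t; apply: (@continuous_comp _ _ _ (fun t => cons_rV (t, y))); last exact: cF.
    apply: (@lipschitz_continuous_at _ _ _ 1) => z; rewrite mul1r.
    apply: rV_norm_le => // k; rewrite sub_coord !cons_rV_lineE; case: unliftP => [l _|_] //=.
    by rewrite subrr normr0.
  have big (t : R) : `|M| < `|t| -> M < `|cons_rV (t, y)|.
    move=> Mt; apply: le_lt_trans (ler_norm M) _; apply: lt_le_trans Mt _.
    by have [] := cons_rV_norm_le t y.
  have s0 t : t < - (`|M| + 1) \/ `|M| + 1 < t -> partial i F (cons_rV (t, y)) = 0.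
    move=> ht; apply: zero F0 _ _; apply: big; rewrite ltr_normr.
    by case: ht => ht; apply/orP; [right|left]; lra.
  rewrite (integral_is_derive_support M0 dl ct s0).
  have n1 : `| `|M| + 1 | = `|M| + 1 by rewrite ger0_norm// addr_ge0.
  by rewrite !F0 ?subrr//; apply: big; rewrite ?normrN n1 ltrDl.
Qed.

End integral_partial.

Section weak_partial_C1.
Variables (R : realType) (n : nat) (Omega : set 'rV[R]_n).
Hypotheses (oOmega : open Omega).
Notation E := 'rV[R]_n.
Notation mu := (lebesgue_rV R n).
Implicit Types (x y : E) (f g phi psi : E -> R) (i : 'I_n).

Definition support phi : set E := closure [set x | phi x != 0].

Lemma near_notin_support phi x : ~ support phi x -> \forall y \near x, phi y = 0.
Proof.
move=> nx; have oS : open (~` support phi) by rewrite openC; exact: closed_closure.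
have : nbhs x (~` support phi) by exact: open_nbhs_nbhs.
apply: filterS => y ny; apply: contrapT => /eqP y0; apply: ny; exact: subset_closure.
Qed.

Lemma test_is_derive phi i x : test_function Omega phi ->
  is_derive x (delta_mx ord0 i) phi (partial i phi x).
Proof. by move=> [/(_ 1%N) C1 _ _]; exact: Ck_is_derive C1. Qed.

Lemma test_continuous phi x : test_function Omega phi -> {for x, continuous phi}.
Proof. by move=> [/(_ 0%N) C0 _ _]; exact: Ck_continuous C0. Qed.

Lemma test_partial_continuous phi i x : test_function Omega phi -> {for x, continuous (partial i phi)}.
Proof. by move=> [/(_ 1%N)[_ /(_ i)[_ C0]] _ _]; exact: (@Ck_continuous _ _ 0%N _ _ C0). Qed.

Lemma partial_eq0_notin_support phi i x : ~ support phi x -> partial i phi x = 0.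
Proof.
move=> nx; suff H : is_derive x (delta_mx ord0 i) phi 0 by rewrite /partial derive_val.
apply: (@is_derive_ext _ _ _ (fun=> 0)).
exact: near_notin_support.
Qed.

Lemma near_partial_eq0 phi i x : ~ support phi x -> \forall y \near x, partial i phi y = 0.
Proof.
move=> nx; have oS : open (~` support phi) by rewrite openC; exact: closed_closure.
have : nbhs x (~` support phi) by exact: open_nbhs_nbhs.
by apply: filterS => y ny; exact: partial_eq0_notin_support.
Qed.

Lemma test_bounded_support phi : test_function Omega phi ->
  exists M : R, forall x : E, M < `|x| -> ~ support phi x.
Proof.
move=> [_ cS _]; have [M [_ HM]] := compact_bounded cS.
by exists (M + 1) => x Mx Sx; have /= := HM (M + 1) ltac:(by rewrite ltrDl) x Sx; rewrite leNgt Mx.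
Qed.

(** A factor that vanishes near every point outside [S] makes the product vanish near the boundary
    of [Omega], so extension by zero creates no jump. *)
Lemma ext_continuous f psi (S : set E) : (forall x, Omega x -> {for x, continuous f}) ->
  (forall x, {for x, continuous psi}) -> S `<=` Omega ->
  (forall x, ~ S x -> \forall y \near x, psi y = 0) ->
  continuous ((fun x => f x * psi x) \_ Omega).
Proof.
move=> cf cpsi SO S0 x; have [Ox|nO] := pselect (Omega x).
  apply: (@continuous_near_eq _ _ _ _ (fun x => f x * psi x)).
    have : nbhs x Omega by exact: open_nbhs_nbhs.
    by apply: filterS => y Oy; rewrite ext_in.
  by apply: continuousM; [exact: cf|exact: cpsi].
apply: (@continuous_near_eq _ _ _ _ (fun=> 0)); last exact: cst_continuous.
have : \forall y \near x, psi y = 0 by apply: S0 => /SO.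
apply: filterS => y y0; have [Oy|nOy] := pselect (Omega y); last by rewrite ext_out.
by rewrite ext_in// y0 mulr0.
Qed.

(** The product [f * phi], extended by zero, is differentiable in direction [i] on the whole space
    with continuous derivative and bounded support; [integral_partial] and the product rule give the
    identity. *)
Lemma weak_partial_C1 f i : (forall x, Omega x -> {for x, continuous f}) ->
  (forall x, Omega x -> derivable f x (delta_mx ord0 i)) ->
  (forall x, Omega x -> {for x, continuous (partial i f)}) ->
  weak_partial Omega i f (partial i f).
Proof.
move=> cf df cdf phi tphi; have [_ _ SO] := tphi.
have [M HM] := test_bounded_support tphi.
have c1 := ext_continuous cf (fun x => @test_partial_continuous phi i x tphi) SO
  (fun x => @near_partial_eq0 phi i x).
have c2 := ext_continuous cdf (fun x => @test_continuous phi x tphi) SO (@near_notin_support phi).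
have z1 x : M < `|x| -> ((fun x => f x * partial i phi x) \_ Omega) x = 0.
  move=> /HM nx; have [Ox|nO] := pselect (Omega x); last exact: ext_out.
  by rewrite ext_in// partial_eq0_notin_support ?mulr0.
have phi0 x : ~ support phi x -> phi x = 0.
  by move=> nx; apply: contrapT => /eqP y0; apply: nx; exact: subset_closure.
have z2 x : M < `|x| -> ((fun x => partial i f x * phi x) \_ Omega) x = 0.
  move=> /HM nx; have [Ox|nO] := pselect (Omega x); last exact: ext_out.
  by rewrite ext_in// phi0 ?mulr0.
have i1 := integrable_continuous_bounded_support c1 z1.
have i2 := integrable_continuous_bounded_support c2 z2.
pose F := (fun x => f x * phi x) \_ Omega.
have dF x : is_derive x (delta_mx ord0 i) F
    (((fun x => f x * partial i phi x) \_ Omega) x + ((fun x => partial i f x * phi x) \_ Omega) x).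
  have [Ox|nO] := pselect (Omega x).
    rewrite !ext_in//; apply: (@is_derive_ext _ _ _ (fun x => f x * phi x)).
      have : nbhs x Omega by exact: open_nbhs_nbhs.
      by apply: filterS => y Oy; rewrite /F ext_in.
    rewrite [X in _ + X]mulrC; apply: is_derive_mul; last exact: test_is_derive.
    by apply/derivableP; exact: df.
  rewrite !ext_out// addr0; apply: (@is_derive_ext _ _ _ (fun=> 0)).
  have : \forall y \near x, phi y = 0 by apply: near_notin_support => /SO.
  apply: filterS => y y0; rewrite /F; have [Oy|nOy] := pselect (Omega y); last by rewrite ext_out.
  by rewrite ext_in// y0 mulr0.
have pF : partial i F = (fun x => ((fun x => f x * partial i phi x) \_ Omega) x +
    ((fun x => partial i f x * phi x) \_ Omega) x).
  by apply/funext => x; rewrite {1}/partial derive_val.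
have h1 x : derivable F x (delta_mx ord0 i) by have [] := dF x.
have h2 : continuous (partial i F).
  by rewrite pF => x; apply: continuousD; [exact: c1|exact: c2].
have h3 x : M < `|x| -> F x = 0.
  move=> /HM nx; rewrite /F; have [Ox|nO] := pselect (Omega x); last exact: ext_out.
  by rewrite ext_in// phi0 ?mulr0.
have := integral_partial h1 h2 h3; rewrite pF.
under eq_integral do rewrite EFinD.
rewrite integralD_EFin// !(@integral_ext R n Omega) => /eqP.
have f1 := integrable_fin_num measurableT i1; have f2 := integrable_fin_num measurableT i2.
by rewrite -[X in (X + _)%E](fineK f1) -[X in (_ + X)%E](fineK f2) -EFinD eqe addr_eq0 => /eqP h;
  rewrite -(fineK f1) -(fineK f2) h EFinN.
Qed.

Lemma test_partial phi i : test_function Omega phi -> test_function Omega (partial i phi).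
Proof.
move=> tphi; have [Cphi cS SO] := tphi.
apply: (@test_function_of_support _ _ _ _ (support phi)) => //.
  by move=> k; have [_ /(_ i)[]] := Cphi k.+1.
by move=> x; apply: contra_neqP => /partial_eq0_notin_support ->.
Qed.

Lemma test_support_eq0 phi : test_function Omega phi ->
  exists M : R, forall x : E, M < `|x| -> phi x = 0.
Proof.
move=> tphi; have [M HM] := test_bounded_support tphi; exists M => x /HM nx.
by apply: contrapT => /eqP y0; apply: nx; exact: subset_closure.
Qed.

Lemma test_bounded phi : test_function Omega phi -> exists B, forall x, `|phi x| <= B.
Proof.
move=> tphi; have [M HM] := test_support_eq0 tphi.
by apply: bounded_continuous_support HM => x; exact: test_continuous tphi.
Qed.

Lemma test_notin phi x : test_function Omega phi -> ~ Omega x -> phi x = 0.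
Proof.
move=> [_ _ SO] nO; apply: contrapT => /eqP h; apply: nO; apply: SO; exact: subset_closure.
Qed.

End weak_partial_C1.

Section uniform_continuity.
Variables (R : realType) (V : normedModType R).
Implicit Types (K : set V) (f : V -> R) (x y : V).

Lemma within_continuous_dist K f x : {within K, continuous f} -> K x ->
  forall e : R, 0 < e -> exists2 r : R, 0 < r & forall y, K y -> `|x - y| < r -> `|f x - f y| < e.
Proof.
move=> cf Kx e e0.
have cfx : f y @[y --> within K (nbhs x)] --> f x.
  by move/subspace_continuousP : cf; exact.
have H : \forall y \near within K (nbhs x), `|f x - f y| < e.
  by move/cvgrPdist_lt : cfx; apply.
have /nbhs_ballP[r /= r0 rP] : nbhs x [set y | K y -> `|f x - f y| < e] by exact: H.
by exists r => // y Ky xy; apply: rP => //; rewrite -ball_normE.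
Qed.

Lemma continuous_at_dist f x : (forall e : R, 0 < e -> exists2 r : R, 0 < r &
    forall y, `|x - y| < r -> `|f x - f y| < e) -> {for x, continuous f}.
Proof.
move=> H; apply/cvgrPdist_lt => e e0; have [r r0 rP] := H e e0.
have : nbhs x (ball x r) by apply/nbhs_ballP; exists r.
by apply: filterS => y; rewrite -ball_normE; exact: rP.
Qed.

(** Compactness in its near-covering form: the radius [r / 2] lets the centre move by [r / 2] and
    still keeps [y] within [r] of the original point. *)
Lemma compact_unif_continuous K f : compact K -> {within K, continuous f} ->
  forall e : R, 0 < e -> exists2 r : R, 0 < r &
    forall x y, K x -> K y -> `|x - y| < r -> `|f x - f y| < e.
Proof.
move=> cK cf e e0.
have e2 : 0 < e / 2 by rewrite divr_gt0.
pose P (r : R) (x : V) := K x -> forall y, K y -> `|x - y| < r -> `|f x - f y| < e.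
have /compact_near_coveringP ncK := cK.
have : \forall r \near (0 : R)^'+, K `<=` P r.
  apply: ncK => x Kx.
  have [r r0 rP] := within_continuous_dist cf Kx e2.
  have r2 : 0 < r / 2 by rewrite divr_gt0.
  near=> x' s => Kx' y Ky x'y.
  have xx' : `|x - x'| < r / 2.
    by near: x'; have : nbhs x (ball x (r / 2)) by [apply/nbhs_ballP; exists (r / 2)]; rewrite -ball_normE.
  have sr : s < r / 2 by near: s; exact: nbhs_right_lt.
  have xy : `|x - y| < r.
    rewrite (_ : x - y = (x - x') + (x' - y)); last by rewrite addrA subrK.
    apply: le_lt_trans (ler_normD _ _) _; rewrite [r]splitr; apply: ltrD => //.
    exact: lt_trans sr.
  have h1 : `|f x - f x'| < e / 2.
    by apply: rP => //; apply: lt_trans xx' _; rewrite ltr_pdivrMr// mulr_natr mulr2n ltrDl.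
  have h2 := rP y Ky xy.
  rewrite (_ : f x' - f y = (f x - f y) - (f x - f x')); last by ring.
  by apply: le_lt_trans (ler_normB _ _) _; lra.
move=> H; near (0 : R)^'+ => r.
exists r; first by near: r; exact: nbhs_right_gt.
have KP : K `<=` P r by near: r.
by move=> x y Kx Ky; apply: (KP x Kx Kx y Ky).
Unshelve. all: by end_near. Qed.

End uniform_continuity.

(** * Functions with zero boundary values *)

Section truncation.
Variable R : realType.
Implicit Types (m : nat) (t : R).

(* [trunc m] vanishes on [|t| <= 1/(m+1)]: composed with a mollification uniformly
   close to a function that is small near the boundary, it gives a test function. *)
Definition trunc m t : R := t * step ((m.+1%:R * t) ^+ 2 - 1).
Definition trunc' m t : R := step ((m.+1%:R * t) ^+ 2 - 1) +
  2 * (m.+1%:R * t) ^+ 2 * dstep ((m.+1%:R * t) ^+ 2 - 1).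

Lemma smooth_trunc m : smooth (trunc m).
Proof.
apply: smoothM; first exact: smooth_id.
apply: smooth_comp; first exact: smooth_step.
rewrite (_ : (fun t => _) = (fun t => (m.+1%:R * t) * (m.+1%:R * t) + -1)); last first.
  by apply/funext => t; rewrite expr2.
apply: smoothD; last exact: smooth_cst.
have sm : smooth (fun t : R => m.+1%:R * t).
  by apply: smoothM; [exact: smooth_cst|exact: smooth_id].
exact: smoothM.
Qed.

Lemma is_derive_trunc m t : is_derive t 1 (trunc m) (trunc' m t).
Proof.
have d0 : is_derive t (1 : R) (fun s : R => m.+1%:R * s) (m.+1%:R).
  by apply: (is_derive_eqr (is_derive_scale m.+1%:R (is_derive_id t (1 : R)))); rewrite mulr1.
have d1 : is_derive t (1 : R) (fun s : R => (m.+1%:R * s) ^+ 2 - 1)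
    (2 * m.+1%:R ^+ 2 * t).
  rewrite (_ : (fun s => _) = (fun s => (m.+1%:R * s) * (m.+1%:R * s) + -1)); last first.
    by apply/funext => s; rewrite expr2.
  apply: (is_derive_eqr (is_derive_add (is_derive_mul d0 d0) (is_derive_const _ _ _))).
  by ring.
have d2 := @is_derive_comp1 _ _ (@step R) _ t 1 _ _ (is_derive_step _) d1.
apply: (is_derive_eqr (is_derive_mul (is_derive_id t (1 : R)) d2)).
by rewrite /trunc'; ring.
Qed.

Lemma derive1_trunc m : derive1 (trunc m) = trunc' m.
Proof. by apply/funext => t; exact: is_derive1E (is_derive_trunc m t). Qed.

Lemma trunc'_continuous m : continuous (trunc' m).
Proof. by rewrite -derive1_trunc; apply: smooth_continuous; apply: smooth_derive1; exact: smooth_trunc. Qed.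

Lemma trunc_small m t : m.+1%:R * `|t| <= 1 -> trunc m t = 0 /\ trunc' m t = 0.
Proof.
move=> h; have s0 : (m.+1%:R * t) ^+ 2 - 1 <= 0.
  rewrite subr_le0 -[leLHS]real_normK ?num_real// exprn_ile1//.
  by rewrite normrM ger0_norm.
rewrite /trunc /trunc' step_eq0// dstep_eq0; last by left.
by rewrite !mulr0 addr0.
Qed.

Lemma trunc_large m t : 2 <= m.+1%:R * `|t| -> trunc m t = t /\ trunc' m t = 1.
Proof.
move=> h; have s1 : 1 <= (m.+1%:R * t) ^+ 2 - 1.
  rewrite lerBrDr -[leRHS]real_normK ?num_real// normrM (@ger0_norm _ m.+1%:R)//.
  by rewrite expr2; nra.
rewrite /trunc /trunc' step_eq1// dstep_eq0; last by right.
by rewrite !mulr0 addr0 mulr1.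
Qed.

Lemma trunc_dist m t : `|t - trunc m t| <= 2 / m.+1%:R.
Proof.
have [h|/ltW h] := leP 2 (m.+1%:R * `|t|); first by have [-> _] := trunc_large h; rewrite subrr normr0.
rewrite ler_pdivlMr// mulrC; apply: le_trans h; rewrite ler_wpM2l//.
rewrite /trunc -{1}[t]mulr1 -mulrBr normrM ler_piMr// ger0_norm ?subr_ge0 ?step_le1//.
by rewrite gerBl step_ge0.
Qed.

(** The bound is uniform in [m] since [trunc'] depends on [m] only through [s = ((m+1) t)^2], and
    the term [2 s * dstep (s - 1)] vanishes for [2 <= s]. *)
Lemma trunc'_bounded : exists C : R, 1 <= C /\ forall m t, `|trunc' m t| <= C.
Proof.
have [B HB] : exists B, forall t, `|@dstep R t| <= B.
  apply: smooth_compact_bounded; split; first exact: smooth_dstep.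
  exists 1 => t; rewrite ltr_normr => h; apply: dstep_eq0.
  by case/orP: h => h; [right|left]; lra.
have B0 : 0 <= B by apply: le_trans (HB 0).
exists (1 + 4 * B); split; first lra.
move=> m t; rewrite /trunc'; set s := (m.+1%:R * t) ^+ 2.
have s0 : 0 <= s by exact: sqr_ge0.
apply: le_trans (ler_normD _ _) _; apply: lerD.
  by rewrite ger0_norm ?step_le1 ?step_ge0.
have [h|h] := leP 2 s; first by rewrite dstep_eq0 ?mulr0 ?normr0; [lra|right; lra].
rewrite normrM ger0_norm; last by rewrite mulr_ge0.
by apply: ler_pM => //; [rewrite mulr_ge0|lra].
Qed.

End truncation.

Section zero_extension.
Variables (R : realType) (n : nat) (Omega : set 'rV[R]_n) (v : 'rV[R]_n -> R).
Notation E := 'rV[R]_n.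
Notation mu := (lebesgue_rV R n).
Hypotheses (oO : open Omega) (bO : bounded_set Omega)
  (cv : {within closure Omega, continuous v}) (v0 : forall x, bdry Omega x -> v x = 0).

Let V := v \_ Omega.

Lemma ext_closure x : closure Omega x -> V x = v x.
Proof.
move=> clx; have [Ox|nO] := pselect (Omega x); first exact: ext_in.
rewrite /V ext_out// v0//; split=> // ix; apply: nO; exact: interior_subset ix.
Qed.

(** The zero boundary values make [V] agree with [v] on the whole closure, and off the closure [V]
    is locally zero. *)
Lemma zero_ext_continuous x : {for x, continuous V}.
Proof.
apply: continuous_at_dist => e e0.
have [clx|nclx] := pselect (closure Omega x); last first.
  have /nbhs_ballP[r /= r0 rP] : nbhs x (~` closure Omega).
    by apply: open_nbhs_nbhs; split=> //; rewrite openC; exact: closed_closure.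
  exists r => // y xy; have ny : ~ closure Omega y by apply: rP; rewrite -ball_normE.
  by rewrite /V !ext_out ?subrr ?normr0// => h; [apply: ny|apply: nclx]; exact: subset_closure.
have [r r0 rP] := within_continuous_dist cv clx e0.
have [Ox|nO] := pselect (Omega x).
  have /nbhs_ballP[s /= s0 sP] : nbhs x Omega by exact: open_nbhs_nbhs.
  exists (Num.min r s); first by rewrite lt_min r0.
  move=> y; rewrite lt_min => /andP[xyr xys].
  have Oy : Omega y by apply: sP; rewrite -ball_normE.
  by rewrite /V !ext_in//; apply: rP => //; exact: subset_closure.
exists r => // y xy; have [Oy|nOy] := pselect (Omega y).
  by rewrite ext_closure// /V ext_in//; apply: rP => //; exact: subset_closure.
by rewrite /V !ext_out// subrr normr0.
Qed.

Lemma bounded_norm : exists2 M : R, 0 <= M & forall x, Omega x -> `|x| <= M.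
Proof.
have [M [Mr HM]] := bO; exists (`|M| + 1); first by rewrite addr_ge0.
by move=> x Ox; apply: (HM (`|M| + 1)) => //; rewrite (le_lt_trans (ler_norm _))// ltrDl.
Qed.

(** Uniform continuity of [V], for points as close as the cubes are small. *)
Lemma mol_support_dist e : 0 < e -> exists N, forall k, (N <= k)%N ->
  forall x y, mol_support k x y -> `|V x - V y| <= e.
Proof.
move=> e0; have [M M0 HM] := bounded_norm.
pose K := cbox (const_mx (- (M + 1)) : E) (const_mx (M + 1)).
have cK : compact K by exact: compact_cbox.
have cVK : {within K, continuous V} by apply: continuous_subspaceT => x; exact: zero_ext_continuous.
have [r r0 rP] := compact_unif_continuous cK cVK e0.
have inK (x : E) : `|x| <= M + 1 -> K x.
  move=> xM i; rewrite !mxE; have := le_trans (coord_norm_le x i) xM.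
  by rewrite ler_norml.
(* With distance below 1, two points not both of norm at most [M + 1] both have norm above [M],
   where [V] vanishes. *)
pose d := Num.min r 1; have d0 : 0 < d by rewrite lt_min r0 ltr01.
exists (Num.bound d^-1) => k Nk x y hy.
have xy : `|x - y| < d.
  have kd : k.+1%:R^-1 < d.
    rewrite invf_plt ?posrE//.
    have : d^-1 < (Num.bound d^-1)%:R by apply: archi_boundP; rewrite invr_ge0 ltW.
    by move=> /lt_le_trans; apply; rewrite ler_nat leqW.
  apply: rV_norm_lt => // i; have := hy i; rewrite !mxE => /andP[h1 h2].
  rewrite ger0_norm ?subr_ge0//; apply: le_lt_trans kd.
  by rewrite lerBlDr addrC -lerBlDr.
move: xy; rewrite lt_min => /andP[xyr xy1].
have [Kx|nKx] := pselect (`|x| <= M + 1 /\ `|y| <= M + 1).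
  by case: Kx => Kx Ky; apply/ltW/rP => //; exact: inK.
have far (z : E) : M < `|z| -> V z = 0.
  by move=> Mz; apply: ext_out => /HM; rewrite leNgt Mz.
have hx : `|x| <= `|x - y| + `|y| by rewrite -{1}[x](subrK y) ler_normD.
have hy' : `|y| <= `|x - y| + `|x| by rewrite distrC -{1}[y](subrK x) ler_normD.
rewrite !far ?subrr ?normr0 ?ltW//; apply: contra_notT nKx; rewrite -leNgt => h; split; lra.
Qed.

Hypothesis iV : mu.-integrable setT (EFin \o V).

(** The difference [mollify k V x - V x] is the kernel average of [V y - V x] over the cube at
    [x]. *)
Lemma mollify_unif e : 0 < e -> exists N, forall k, (N <= k)%N ->
  forall x, `|mollify k V x - V x| <= e.
Proof.
move=> e0; have [N NP] := mol_support_dist e0; exists N => k Nk x.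
have i1 := integrable_mollify_integrand k x iV; have i2 := integrable_mol_rV_sub k x.
have i3 : mu.-integrable setT (EFin \o (fun y => V x * mol_rV k (x - y))).
  exact: (integrableZl measurableT (V x) i2).
have i5 : mu.-integrable setT (EFin \o (fun y => e * mol_rV k (x - y))).
  exact: (integrableZl measurableT e i2).
have i4 : mu.-integrable setT (EFin \o (fun y => mol_rV k (x - y) * V y - V x * mol_rV k (x - y))).
  exact: (integrableB measurableT i1 i3).
have -> : mollify k V x - V x =
    (\int[mu]_y (mol_rV k (x - y) * V y - V x * mol_rV k (x - y)))%R.
  by rewrite RintegralB// RintegralZl// Rintegral_mol_rV_sub mulr1.
apply: le_trans (le_normr_Rintegral measurableT i4) _.
rewrite -[leRHS]mulr1 -(Rintegral_mol_rV_sub (n := n) k x) -RintegralZl//.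
apply: le_Rintegral => //; first exact: (integrable_norm i4).
move=> y _; rewrite mulrC -mulrBl normrM (@ger0_norm _ (mol_rV k _)) ?mol_rV_ge0//.
have [hy|nhy] := pselect (mol_support k x y); last by rewrite mol_rV_eq0// !mulr0.
by rewrite ler_wpM2r ?mol_rV_ge0// distrC; exact: NP hy.
Qed.

End zero_extension.

Section approximation.
Variables (R : realType) (n : nat) (Omega : set 'rV[R]_n) (v : 'rV[R]_n -> R)
  (w : 'I_n -> 'rV[R]_n -> R).
Notation E := 'rV[R]_n.
Notation mu := (lebesgue_rV R n).
Hypotheses (oO : open Omega) (bO : bounded_set Omega)
  (cv : {within closure Omega, continuous v}) (v0 : forall x, bdry Omega x -> v x = 0)
  (gv : in_L2 Omega v) (gw : forall i, in_L2 Omega (w i))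
  (vw : forall i, weak_partial Omega i v (w i)).

Let V := v \_ Omega.
Let W i := w i \_ Omega.

(* The limit of the gradients of [trunc m v]. Since it turns out to be a weak gradient of
   [v], it agrees with [w] almost everywhere. *)
Definition nonzero_part i : E -> R := fun x => if v x == 0 then 0 else w i x.

Let iV : mu.-integrable setT (EFin \o V).
Proof. exact: in_L2_integrable. Qed.

Let iW i : mu.-integrable setT (EFin \o W i).
Proof. exact: in_L2_integrable. Qed.

Let mV : measurable_fun setT V.
Proof. by apply: continuous_measurable_rV => x; exact: zero_ext_continuous. Qed.

Let mW i : measurable_fun setT (W i).
Proof. by have [] := (in_L2P oO (w i)).1 (gw i). Qed.

Let QW i : (sqint mu (W i) < +oo)%E.
Proof. by have [] := (in_L2P oO (w i)).1 (gw i). Qed.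

Lemma nonzero_part_extE i x : (nonzero_part i \_ Omega) x = if V x == 0 then 0 else W i x.
Proof.
have [Ox|nO] := pselect (Omega x); first by rewrite /V /W !ext_in.
by rewrite /V /W !ext_out// eqxx.
Qed.

Lemma measurable_nonzero_part i : measurable_fun setT (nonzero_part i \_ Omega).
Proof.
rewrite (_ : _ \_ _ = (fun x => W i x * \1_(V @^-1` [set~ 0]) x)); last first.
  apply/funext => x; rewrite nonzero_part_extE indicE.
  have [V0|V0] := eqVneq (V x) 0; first by rewrite memNset ?mulr0//= => /(_ V0).
  by rewrite mem_set ?mulr1//=; exact/eqP.
apply: measurable_funM => //; apply: measurable_indic.
rewrite -[X in measurable X]setTI; apply: mV => //.
by apply: measurableC; exact: measurable_set1.
Qed.

Let V_out x : ~ Omega x -> V x = 0.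
Proof. exact: ext_out. Qed.

(** Let [K] be the compact set where the modulus of [V] is at least [c = 1 / (2 (m+1))]. Off [K] the
    mollification is at most [2 c = 1 / (m+1)], so [trunc m] and its derivative vanish there. On [K]
    the function [V] varies by at most [c / 2] over the cube at [x], so the cube stays in [Omega]
    and [partial_mollify] applies. *)
Lemma trunc_mollify_test m : exists N, forall k, (N <= k)%N ->
  test_function Omega (fun x => trunc m (mollify k V x)) /\
  forall i x, partial i (fun x => trunc m (mollify k V x)) x =
    trunc' m (mollify k V x) * mollify k (W i) x.
Proof.
pose c : R := (2 * m.+1%:R)^-1.
have c0 : 0 < c by rewrite invr_gt0 mulr_gt0.
have c2 : 0 < c / 2 by rewrite divr_gt0.
have [N1 N1P] := mol_support_dist oO bO cv v0 c2.
have [N2 N2P] := mollify_unif oO bO cv v0 iV c0.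
exists (maxn N1 N2) => k; rewrite geq_max => /andP[N1k N2k].
pose K : set E := [set x | c <= `|V x|].
have KO : K `<=` Omega.
  move=> x; rewrite /K => cVx; apply: contrapT => nO; have : c <= `|V x| by exact: cVx.
  by rewrite V_out// normr0 leNgt c0.
have cK : compact K.
  apply: bounded_closed_compact.
    have [M M0 HM] := bounded_norm bO.
    exists M; split; first exact: num_real.
    by move=> M' MM' x /KO /HM /le_trans; apply; exact: ltW.
  apply: (@closed_comp _ _ (fun x => `|V x|) [set t : R | c <= t]); last exact: closed_ge.
  move=> x _; apply: continuous_comp; first exact: zero_ext_continuous.
  exact: norm_continuous.
have small x : ~ K x -> m.+1%:R * `|mollify k V x| <= 1.
  move=> /negP; rewrite -ltNge => Vx.
  have h : `|mollify k V x| <= `|mollify k V x - V x| + `|V x|.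
    by rewrite -{1}[mollify k V x](subrK (V x)) ler_normD.
  have h2 := N2P k N2k x.
  apply: (@le_trans _ _ (m.+1%:R * (c + c))).
    by rewrite ler_wpM2l//; lra.
  have m0 : m.+1%:R != 0 :> R by rewrite pnatr_eq0.
  by have -> : m.+1%:R * (c + c) = 1 by rewrite /c; move: m0; move: (m.+1%:R : R) => a a0; field.
have supp x : K x -> mol_support k x `<=` Omega.
  move=> Kx y hy; apply: contrapT => nO.
  have : `|V x - V y| <= c / 2 by exact: N1P hy.
  rewrite (V_out nO) subr0.
  by apply/negP; rewrite -ltNge; apply: lt_le_trans Kx; lra.
have d i x : is_derive x (delta_mx ord0 i) (fun x => trunc m (mollify k V x))
    (trunc' m (mollify k V x) * mollify k (W i) x).
  have dm : is_derive x (delta_mx ord0 i) (mollify k V) (partial i (mollify k V) x).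
    apply/derivableP.
    by have [] := is_derive_convol x i (fun _ : 'I_n => smooth_compact_mol R k) iV.
  have := is_derive_comp1 (is_derive_trunc m (mollify k V x)) dm.
  move=> /is_derive_eqr; apply.
  have [Kx|nKx] := pselect (K x).
    by rewrite (partial_mollify iV (iW i) (vw i))//; exact: supp.
  by have [_ ->] := trunc_small (small x nKx); rewrite !mul0r.
split; last by move=> i x; rewrite /partial derive_val.
apply: (@test_function_of_support _ _ _ _ K) => //.
  move=> j; apply: Ck_comp; first exact: smooth_trunc.
  exact: (Ck_convol j (fun _ : 'I_n => smooth_compact_mol R k) iV).
move=> x; apply: contra_neqP => nKx.
by have [-> _] := trunc_small (small x nKx).
Qed.

Let measurable_trunc' m (f : E -> R) : measurable_fun setT f ->
  measurable_fun setT (fun x => trunc' m (f x)).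
Proof.
move=> mf; apply: (measurableT_comp (f := trunc' (R := R) m)) => //.
by apply: continuous_measurable_fun; exact: trunc'_continuous.
Qed.

Let iW2 i (c : R) : mu.-integrable setT (EFin \o (fun x => c * W i x ^+ 2)).
Proof. exact: (integrableZl measurableT c (integrable_sq (mW i) (QW i))). Qed.

(** For large [m] the factor [trunc' m (V x)] equals 1 where [V x] is nonzero, and it is 0 where
    [V x] is zero; the uniform bound [C] on [trunc'] provides the domination. *)
Lemma trunc'_cvg i e : 0 < e -> exists N, forall m, (N <= m)%N ->
  (sqint mu (fun x => (nonzero_part i \_ Omega) x - trunc' m (V x) * W i x)%R <= e%:E)%E.
Proof.
have [C [C1 HC]] := trunc'_bounded R.
apply: (@sqint_dct _ _ _ mu
  (fun m x => (nonzero_part i \_ Omega) x - trunc' m (V x) * W i x)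
  (fun x => (1 + C) ^+ 2 * W i x ^+ 2)).
- move=> m; apply: measurable_funB; first exact: measurable_nonzero_part.
  by apply: measurable_funM => //; exact: measurable_trunc'.
- move=> x; apply: cvg_near_cst; rewrite nonzero_part_extE.
  have [->|V0] := eqVneq (V x) 0.
    exists 0%N => // m _; have [|_ ->] := @trunc_small R m 0; first by rewrite normr0 mulr0.
    by rewrite mul0r subrr.
  have a0 : 0 < `|V x| / 2 by rewrite divr_gt0// normr_gt0.
  exists (Num.bound ((`|V x| / 2)^-1)) => // m /= Nm.
  have [|_ ->] := @trunc_large R m (V x); last by rewrite mul1r subrr.
  have : (`|V x| / 2)^-1 <= m.+1%:R.
    have : (`|V x| / 2)^-1 < (Num.bound ((`|V x| / 2)^-1))%:R.
      by apply: archi_boundP; rewrite invr_ge0 ltW.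
    by move=> /ltW/le_trans; apply; rewrite ler_nat leqW.
  by rewrite -[leLHS]div1r ler_pdivrMr// mulrA ler_pdivlMr// mul1r.
- exact: iW2.
- move=> m x; rewrite nonzero_part_extE -exprMn.
  rewrite -[leLHS]real_normK ?num_real// -[leRHS]real_normK ?num_real//.
  rewrite ler_sqr ?nnegrE// [leRHS]normrM [X in _ <= X * _]ger0_norm; last lra.
  rewrite (_ : (1 + C) * `|W i x| = `|W i x| + C * `|W i x|); last by ring.
  apply: le_trans (ler_normB _ _) _; apply: lerD.
    by case: ifP => _; rewrite ?normr0.
  by rewrite normrM ler_wpM2r.
Qed.

(** The error splits in two: a change of [trunc'], handled by dominated convergence since
    mollifications converge pointwise, and a change of [W i], handled by L^2 convergence and the
    bound [C]. *)
Lemma trunc'_mollify_cvg m i e : 0 < e -> exists N, forall k, (N <= k)%N ->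
  (sqint mu (fun x => trunc' m (V x) * W i x -
     trunc' m (mollify k V x) * mollify k (W i) x)%R <= e%:E)%E.
Proof.
move=> e0; have [C [C1 HC]] := trunc'_bounded R.
have mT k : measurable_fun setT (fun x => trunc' m (mollify k V x)).
  by apply: measurable_trunc'; exact: measurable_mollify.
have mTV : measurable_fun setT (fun x => trunc' m (V x)) by exact: measurable_trunc'.
have mM k : measurable_fun setT (mollify k (W i)) by exact: measurable_mollify.
have D : forall e : R, 0 < e -> exists N, forall k, (N <= k)%N ->
    (sqint mu (fun x => (trunc' m (V x) - trunc' m (mollify k V x)) * W i x)%R <= e%:E)%E.
  apply: (@sqint_dct _ _ _ mu (fun k x => (trunc' m (V x) - trunc' m (mollify k V x)) * W i x)
    (fun x => (2 * C) ^+ 2 * W i x ^+ 2)).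
  - by move=> k; apply: measurable_funM => //; exact: measurable_funB.
  - move=> x.
    have cm : mollify k V x @[k --> \oo] --> V x.
      apply/cvgrPdist_le => d d0; have [N NP] := mollify_unif oO bO cv v0 iV d0.
      by exists N => // k /= Nk; rewrite distrC; exact: NP.
    have ct : trunc' m (mollify k V x) @[k --> \oo] --> trunc' m (V x).
      by apply: continuous_cvg => //; exact: trunc'_continuous.
    have cc : trunc' m (V x) @[k --> \oo] --> trunc' m (V x) by exact: cvg_cst.
    have := cvgM (cvgB cc ct) (cvg_cst (W i x)).
    by rewrite subrr mul0r; exact.
  - exact: iW2.
  - move=> k x; rewrite -exprMn.
    rewrite -[leLHS]real_normK ?num_real// -[leRHS]real_normK ?num_real//.
    rewrite ler_sqr ?nnegrE// normrM [leRHS]normrM ler_wpM2r// [leRHS]ger0_norm; last lra.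
    apply: le_trans (ler_normB _ _) _.
    by rewrite (_ : 2 * C = C + C); [exact: lerD|ring].
have C0 : 0 < C by lra.
have e4 : 0 < e / 4 by rewrite divr_gt0.
have e4C : 0 < e / 4 / C ^+ 2 by rewrite divr_gt0// exprn_gt0.
have [N1 N1P] := D _ e4; have [N2 N2P] := in_L2_mollify_cvg oO bO (gw i) e4C.
exists (maxn N1 N2) => k; rewrite geq_max => /andP[N1k N2k].
rewrite (_ : e = 2 * (e / 4 + e / 4)); last by field.
apply: (@sqint_split _ _ _ mu _ (fun x => (trunc' m (V x) - trunc' m (mollify k V x)) * W i x)
  (fun x => trunc' m (mollify k V x) * (W i x - mollify k (W i) x))).
- by apply: measurable_funB; exact: measurable_funM.
- by apply: measurable_funM => //; exact: measurable_funB.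
- by apply: measurable_funM => //; exact: measurable_funB.
- by move=> x; ring.
- exact: N1P.
have -> : (e / 4)%:E = ((C ^+ 2)%:E * (e / 4 / C ^+ 2)%:E)%E :> \bar R.
  by rewrite -EFinM; congr EFin; field; exact: lt0r_neq0.
apply: (@le_trans _ _ (sqint mu (fun x => C * (mollify k (W i) x - W i x)))).
  apply: le_sqint.
  - by apply: measurable_funM => //; exact: measurable_funB.
  - by apply: measurable_funM => //; exact: measurable_funB.
  - by move=> x; rewrite !normrM (ger0_norm (ltW C0)) distrC ler_wpM2r.
rewrite sqintZ; last exact: measurable_funB.
by apply: lee_wpmul2l; [rewrite lee_fin sqr_ge0|exact: N2P].
Qed.

(** The level [m] is fixed first and [k] afterwards, as the required fineness of the mollification
    depends on [m]. *)
Lemma zero_trace_approx (e : R) : 0 < e -> exists phi, [/\ test_function Omega phi,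
  (sqint mu (fun x => V x - phi x)%R <= e%:E)%E &
  forall i, (sqint mu (fun x => (nonzero_part i \_ Omega) x - partial i phi x)%R <= e%:E)%E].
Proof.
move=> e0; have e4 : 0 < e / 4 by rewrite divr_gt0.
have mO := measurable_Omega oO.
have fO : mu Omega \is a fin_num by rewrite ge0_fin_numE//; exact: mu_bounded_lty.
pose L := fine (mu Omega); have L0 : 0 <= L by exact: fine_ge0.
have /choice[N1 N1P] i := trunc'_cvg i e4.
(* On [Omega] the error is at most [3 / (m+1)]: one share from mollifying and two from truncating.
   Its square integrates to at most [9 L / (m+1)^2], which has to be at most [e]. *)
pose q := 9 * L / e; have q0 : 0 <= q by rewrite divr_ge0 ?mulr_ge0// ltW.
pose m := maxn (\max_i N1 i)%N (Num.bound q).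
have qm : 9 * L <= e * m.+1%:R ^+ 2.
  have h1 : q <= m.+1%:R.
    apply: (@le_trans _ _ (Num.bound q)%:R); first by apply/ltW/archi_boundP.
    by rewrite ler_nat leqW// leq_maxr.
  have h2 : (1 : R) <= m.+1%:R by rewrite ler1n.
  have h3 : 9 * L <= e * m.+1%:R by rewrite [leRHS]mulrC -ler_pdivrMr.
  by apply: le_trans h3 _; rewrite ler_pM2l//; move: h2; move: (m.+1%:R : R) => a; nra.
have /choice[N2 N2P] i := trunc'_mollify_cvg m i e4.
have [N3 N3P] := trunc_mollify_test m.
have [N4 N4P] := mollify_unif oO bO cv v0 iV (e := m.+1%:R^-1) ltac:(by []).
pose k := maxn (\max_i N2 i)%N (maxn N3 N4).
have [tphi dphi] : _ /\ _ := N3P k ltac:(by rewrite /k; lia).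
exists (fun x => trunc m (mollify k V x)); split => //.
- have [_ _ SO] := tphi.
  have mphi : measurable_fun setT (fun x => trunc m (mollify k V x)).
    by apply: continuous_measurable_rV => x; exact: test_continuous tphi.
  apply: (@le_trans _ _ (sqint mu (fun x => 3 / m.+1%:R * \1_Omega x))).
    apply: le_sqint; first exact: measurable_funB.
      by apply: measurable_funM => //; exact: measurable_indic.
    move=> x; have [Ox|nO] := pselect (Omega x); last first.
      rewrite V_out// indicE memNset// mulr0.
      rewrite (_ : trunc m (mollify k V x) = 0) ?subrr//.
      apply: contrapT => /eqP h; apply: nO; apply: SO; exact: subset_closure.
    rewrite indicE mem_set// mulr1 [leRHS]ger0_norm; last by rewrite divr_ge0.
    rewrite (_ : V x - _ = (V x - mollify k V x) +
      (mollify k V x - trunc m (mollify k V x))); last by ring.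
    apply: le_trans (ler_normD _ _) _.
    rewrite (_ : 3 / m.+1%:R = m.+1%:R^-1 + 2 / m.+1%:R); last by ring.
    apply: lerD; last exact: trunc_dist.
    by rewrite distrC; apply: N4P; rewrite /k; lia.
  rewrite sqintZ; last exact: measurable_indic.
  rewrite /sqint (eq_integral (fun x => (\1_Omega x)%:E)); last first.
    by move=> x _; rewrite indicE; case: (x \in _); rewrite ?expr1n ?expr0n.
  have muE : mu Omega = L%:E by rewrite /L fineK.
  rewrite integral_indic// setIT.
  apply: (@le_trans _ _ (((3 / m.+1%:R) ^+ 2)%:E * L%:E)%E); first by rewrite -muE.
  rewrite -EFinM lee_fin.
  have a0 : 0 < (m.+1%:R : R) by [].
  move: qm a0; move: (m.+1%:R : R) => a qm a0.
  rewrite (_ : _ * L = 9 * L / a ^+ 2); last by field; exact: lt0r_neq0.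
  by rewrite ler_pdivrMr// exprn_gt0.
- move=> i; rewrite (_ : e = 2 * (e / 4 + e / 4)); last by field.
  have mV' : measurable_fun setT (fun x => trunc' m (V x)) by exact: measurable_trunc'.
  have mT : measurable_fun setT (fun x => trunc' m (mollify k V x)).
    by apply: measurable_trunc'; exact: measurable_mollify.
  have mM : measurable_fun setT (mollify k (W i)) by exact: measurable_mollify.
  under eq_fun do rewrite dphi.
  have mN := measurable_nonzero_part i.
  apply: (@sqint_split _ _ _ mu _ (fun x => (nonzero_part i \_ Omega) x - trunc' m (V x) * W i x)
     (fun x => trunc' m (V x) * W i x - trunc' m (mollify k V x) * mollify k (W i) x)).
  + by apply: measurable_funB => //; exact: measurable_funM.
  + by apply: measurable_funB => //; exact: measurable_funM.
  + by apply: measurable_funB; exact: measurable_funM.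
  + by move=> x; ring.
  + by apply: N1P; rewrite /m leq_max (leq_bigmax i).
  + by apply: N2P; rewrite /k leq_max (leq_bigmax i).
Qed.

End approximation.

(** * Calculus of weak derivatives in L^2 *)

Section weak_derivatives.
Variables (R : realType) (n : nat) (Omega : set 'rV[R]_n).
Hypotheses (oO : open Omega) (bO : bounded_set Omega).
Notation E := 'rV[R]_n.
Notation mu := (lebesgue_rV R n).
Implicit Types (x : E) (v w phi z : E -> R) (i : 'I_n).
Let mO : measurable Omega := measurable_Omega oO.

Lemma extB v w x : ((v \- w) \_ Omega) x = (v \_ Omega) x - (w \_ Omega) x.
Proof.
have [Ox|nO] := pselect (Omega x); first by rewrite !ext_in.
by rewrite !ext_out// subr0.
Qed.

Lemma in_L2_bound v : in_L2 Omega v -> exists2 s : R, 0 <= s & (sqint mu (v \_ Omega) <= s%:E)%E.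
Proof.
move=> /(in_L2P oO)[_ Qv]; have Q0 := sqint_ge0 mu (v \_ Omega).
have Qf : sqint mu (v \_ Omega) \is a fin_num by rewrite ge0_fin_numE.
by exists (fine (sqint mu (v \_ Omega))); rewrite ?fine_ge0// fineK.
Qed.

Lemma sqint_subr v w (a b : R) : in_L2 Omega v -> in_L2 Omega w ->
  (sqint mu (v \_ Omega) <= a%:E)%E -> (sqint mu (w \_ Omega) <= b%:E)%E ->
  (sqint mu ((v \- w)%R \_ Omega) <= (2 * (a + b))%:E)%E.
Proof.
move=> /(in_L2P oO)[mv _] /(in_L2P oO)[mw _] va wb.
have -> : (v \- w) \_ Omega = (fun x => (v \_ Omega) x - (w \_ Omega) x).
  by apply/funext => x; exact: extB.
apply: (@sqint_split _ _ _ mu _ (v \_ Omega) (fun x => - (w \_ Omega) x)) => //.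
- exact: measurable_funB.
- exact: measurableT_comp.
- by rewrite /sqint; under eq_integral do rewrite sqrrN.
Qed.

Lemma in_L2B v w : in_L2 Omega v -> in_L2 Omega w -> in_L2 Omega (v \- w).
Proof.
move=> gv gw; have [a a0 va] := in_L2_bound gv; have [b b0 wb] := in_L2_bound gw.
apply/(in_L2P oO); split; last exact: le_lt_trans (sqint_subr gv gw va wb) (ltry _).
have [mv _] := (in_L2P oO v).1 gv; have [mw _] := (in_L2P oO w).1 gw.
rewrite (_ : (v \- w) \_ Omega = (fun x => (v \_ Omega) x - (w \_ Omega) x)).
  exact: measurable_funB.
by apply/funext => x; exact: extB.
Qed.

Lemma test_measurable phi : test_function Omega phi -> measurable_fun setT phi.
Proof. by move=> tp; apply: continuous_measurable_rV => x; exact: test_continuous tp. Qed.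

Lemma in_L2_test phi : test_function Omega phi -> in_L2 Omega phi.
Proof.
move=> tp; have [B HB] := test_bounded tp; have mp := test_measurable tp.
apply/(in_L2P oO).
have -> : phi \_ Omega = phi.
  apply/funext => x; have [Ox|nO] := pselect (Omega x); first by rewrite ext_in.
  by rewrite ext_out// (test_notin tp).
split => //.
have B0 : 0 <= B by apply: le_trans (HB 0).
apply: (@le_lt_trans _ _ (sqint mu (fun x => B * \1_Omega x))%R).
  apply: le_sqint => //; first by apply: measurable_funM => //; exact: measurable_indic.
  move=> x; have [Ox|nO] := pselect (Omega x).
    by rewrite indicE mem_set// mulr1 (ger0_norm B0).
  by rewrite (test_notin tp)// normr0.
rewrite sqintZ; last exact: measurable_indic.
rewrite /sqint (eq_integral (fun x => (\1_Omega x)%:E)); last first.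
  by move=> x _; rewrite indicE; case: (x \in _); rewrite ?expr1n ?expr0n.
rewrite integral_indic// setIT lte_mul_pinfty ?lee_fin ?sqr_ge0//.
exact: mu_bounded_lty.
Qed.

Lemma integrable_mul_test v phi : in_L2 Omega v -> test_function Omega phi ->
  mu.-integrable Omega (EFin \o (fun x => v x * phi x)).
Proof.
move=> gv tp; have [B HB] := test_bounded tp.
rewrite (_ : (fun x => _) = (fun x => phi x * v x)); last by apply/funext => x; rewrite mulrC.
apply: (@integrable_bounded_mul _ _ _ mu _ _ _ B) => //.
- by apply: measurable_funTS; exact: test_measurable.
- by apply/integrable_ext => //; exact: in_L2_integrable.
Qed.

(** For L^2 functions the integrals are finite, and the identity can be manipulated in [R], where
    subtraction is unrestricted. *)
Lemma weak_partialP i v w : in_L2 Omega v -> in_L2 Omega w ->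
  weak_partial Omega i v w <-> forall phi, test_function Omega phi ->
    \int[mu]_(x in Omega) (v x * partial i phi x) = - \int[mu]_(x in Omega) (w x * phi x).
Proof.
move=> gv gw.
have fin z phi : in_L2 Omega z -> test_function Omega phi ->
    (\int[mu]_(x in Omega) (z x * phi x)%:E = (\int[mu]_(x in Omega) (z x * phi x))%:E)%E.
  move=> gz tp; rewrite /Rintegral fineK//.
  exact: integrable_fin_num (integrable_mul_test gz tp).
split=> h phi tp.
  have := h phi tp; rewrite !fin//; last exact: test_partial.
  by rewrite -EFinN => -[].
by rewrite !fin// ?h// ?EFinN//; exact: test_partial.
Qed.

Lemma Rintegral_mul_testB v w phi : in_L2 Omega v -> in_L2 Omega w -> test_function Omega phi ->
  \int[mu]_(x in Omega) ((v \- w) x * phi x) =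
  \int[mu]_(x in Omega) (v x * phi x) - \int[mu]_(x in Omega) (w x * phi x).
Proof.
move=> gv gw tp; rewrite -RintegralB//; try exact: integrable_mul_test.
by apply: eq_Rintegral => x _; rewrite /= mulrBl.
Qed.

Lemma weak_partialB i v w v' w' : in_L2 Omega v -> in_L2 Omega w ->
  in_L2 Omega v' -> in_L2 Omega w' ->
  weak_partial Omega i v w -> weak_partial Omega i v' w' ->
  weak_partial Omega i (v \- v') (w \- w').
Proof.
move=> gv gw gv' gw' /(weak_partialP _ gv gw) h /(weak_partialP _ gv' gw') h'.
apply/(weak_partialP _ (in_L2B gv gv') (in_L2B gw gw')) => phi tp.
rewrite !Rintegral_mul_testB//; last exact: test_partial.
by rewrite h// h'// opprB opprK addrC.
Qed.

(** Does the work of Cauchy-Schwarz, by integrating the weighted inequality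
    [a * B <= B s / 2 + B a^2 / (2 s)] over [Omega], which has finite measure. *)
Lemma Rintegral_mul_test_small phi : test_function Omega phi ->
  exists2 B : R, 0 <= B & forall v s, in_L2 Omega v -> 0 < s ->
    (sqint mu (v \_ Omega) <= (s ^+ 2)%:E)%E ->
    `|\int[mu]_(x in Omega) (v x * phi x)| <= s * B.
Proof.
move=> tp; have [B HB] := test_bounded tp.
have B0 : 0 <= B by apply: le_trans (HB 0).
pose L := fine (mu Omega); have muoo : (mu Omega < +oo)%E by exact: mu_bounded_lty.
have muE : mu Omega = L%:E by rewrite fineK// ge0_fin_numE.
have L0 : 0 <= L by exact: fine_ge0.
(* The two terms integrate to at most [B s L / 2] and [B s / 2]. *)
exists (B * (L + 1) / 2) => [|v s gv s0 Qv]; first by rewrite divr_ge0// mulr_ge0// addr_ge0.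
have mv := gv.1.
have iv : mu.-integrable Omega (EFin \o v) by apply/integrable_ext => //; exact: in_L2_integrable.
rewrite -lee_fin EFin_normr_Rintegral//; last exact: integrable_mul_test.
apply: le_trans (le_abse_integral _ _ _) _ => //.
  by have /integrableP[] := integrable_mul_test gv tp.
have msq : measurable_fun Omega (fun x => (v x ^+ 2)%:E).
  by apply/measurable_EFinP; exact: measurable_funX.
apply: (@le_trans _ _ (\int[mu]_(x in Omega) ((B * s / 2)%:E + ((B / (2 * s))%:E * (v x ^+ 2)%:E)))%E).
  apply: ge0_le_integral => //.
  - apply: measurableT_comp => //; apply/measurable_EFinP; apply: measurable_funM => //.
    by apply: measurable_funTS; exact: test_measurable.
  - apply: emeasurable_funD => //; exact: measurable_funeM.
  - move=> x _; rewrite /= -EFinM -EFinD lee_fin normrM.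
    apply: (@le_trans _ _ (`|v x| * B)); first by rewrite ler_wpM2l.
    rewrite -[v x ^+ 2]real_normK ?num_real//.
    move: (`|v x|) => a; rewrite -subr_ge0.
    rewrite (_ : _ - _ = B / (2 * s) * (s - a) ^+ 2); last by field; exact: lt0r_neq0.
    by rewrite mulr_ge0 ?sqr_ge0// divr_ge0// mulr_ge0// ltW.
have c0 : 0 <= B / (2 * s) by rewrite divr_ge0// mulr_ge0// ltW.
rewrite ge0_integralD//; last 3 first.
- by move=> x _; rewrite lee_fin divr_ge0// mulr_ge0// ltW.
- by move=> x _; rewrite -EFinM lee_fin mulr_ge0// sqr_ge0.
- exact: measurable_funeM.
rewrite integral_cst// ge0_integralZl//; last by move=> x _; rewrite lee_fin sqr_ge0.
rewrite (@integral_ext R n Omega (fun x => v x ^+ 2)).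
have -> : (\int[mu]_x (((fun x => (v x ^+ 2)%R) \_ Omega) x)%:E)%E = sqint mu (v \_ Omega).
  apply: eq_integral => x _; have [Ox|nO] := pselect (Omega x); first by rewrite !ext_in.
  by rewrite !ext_out// expr0n.
apply: (@le_trans _ _ ((B * s / 2)%:E * L%:E + (B / (2 * s))%:E * (s ^+ 2)%:E)%E).
  by apply: leeD; [rewrite -muE|apply: lee_wpmul2l => //; rewrite lee_fin].
rewrite -!EFinM -EFinD lee_fin le_eqVlt; apply/orP; left; apply/eqP.
by field; exact: lt0r_neq0.
Qed.

(** Both sides of the defining identity are continuous in L^2 for a fixed test function, so the
    graph of the weak derivative is closed. *)
Lemma weak_partial_lim i v w : in_L2 Omega v -> in_L2 Omega w ->
  (forall e : R, 0 < e -> exists v' w', [/\ in_L2 Omega v', in_L2 Omega w',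
    weak_partial Omega i v' w', (sqint mu ((v \- v')%R \_ Omega) <= e%:E)%E &
    (sqint mu ((w \- w')%R \_ Omega) <= e%:E)%E]) ->
  weak_partial Omega i v w.
Proof.
move=> gv gw h; apply/weak_partialP => // phi tp.
have tdp := test_partial i tp.
have [B1 B10 H1] := Rintegral_mul_test_small tdp.
have [B2 B20 H2] := Rintegral_mul_test_small tp.
apply/eqP; rewrite -subr_eq0 opprK -normr_le0; apply/ler_addgt0Pr => e e0; rewrite add0r.
pose s := e / (B1 + B2 + 1); have s0 : 0 < s by rewrite divr_gt0// ltr_wpDl// addr_ge0.
have [|v' [w' [gv' gw' + Q1 Q2]]] := h (s ^+ 2); first by rewrite exprn_gt0.
move=> /(weak_partialP _ gv' gw')/(_ _ tp) E0.
have b1 := H1 _ _ (in_L2B gv gv') s0 Q1; have b2 := H2 _ _ (in_L2B gw gw') s0 Q2.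
rewrite (_ : _ + _ = \int[mu]_(x in Omega) ((v \- v') x * partial i phi x) +
  \int[mu]_(x in Omega) ((w \- w') x * phi x)); last first.
  by rewrite !Rintegral_mul_testB// E0; ring.
apply: le_trans (ler_normD _ _) _; apply: le_trans (lerD b1 b2) _.
rewrite -mulrDr -[leRHS](divfK (_ : B1 + B2 + 1 != 0)) -/s.
  by rewrite ler_wpM2l ?ltW// ltrDl.
by rewrite gt_eqF// ltr_wpDl// addr_ge0.
Qed.

(** The difference of two weak derivatives is orthogonal to all test functions, and
    [fundamental_lemma] applies. *)
Lemma weak_partial_unique i v w w' : in_L2 Omega v -> in_L2 Omega w -> in_L2 Omega w' ->
  weak_partial Omega i v w -> weak_partial Omega i v w' ->
  sqint mu ((w \- w')%R \_ Omega) = 0%E.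
Proof.
move=> gv gw gw' /(weak_partialP _ gv gw) h /(weak_partialP _ gv gw') h'.
apply: fundamental_lemma => // [|phi tp]; first exact: in_L2B.
have := Rintegral_mul_testB gw gw' tp.
rewrite -[X in _ = X - _]opprK -h// h'// opprK subrr => e0.
rewrite -[LHS]fineK; last first.
  by apply: integrable_fin_num => //; apply: (integrable_mul_test _ tp); exact: in_L2B.
by congr EFin.
Qed.

Lemma wpartialP i v : (exists2 w, in_L2 Omega w & weak_partial Omega i v w) ->
  in_L2 Omega (wpartial Omega i v) /\ weak_partial Omega i v (wpartial Omega i v).
Proof.
move=> [w gw vw]; rewrite /wpartial; case: xgetP => [z _ //|/(_ w)].
by case.
Qed.

(** Weak derivatives do not see null sets; this is the constant case of [weak_partial_lim]. It
    allows passing between representatives. *)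
Lemma weak_partial_congr i v v' w w' : in_L2 Omega v -> in_L2 Omega v' ->
  in_L2 Omega w -> in_L2 Omega w' ->
  sqint mu ((v \- v')%R \_ Omega) = 0%E -> sqint mu ((w \- w')%R \_ Omega) = 0%E ->
  weak_partial Omega i v' w' -> weak_partial Omega i v w.
Proof.
move=> gv gv' gw gw' Q1 Q2 h; apply: weak_partial_lim => // e e0.
by exists v', w'; rewrite Q1 Q2 !lee_fin ltW.
Qed.

Lemma sqint_eq0_ae v : in_L2 Omega v ->
  sqint mu (v \_ Omega) = 0%E <-> {ae mu, forall x, Omega x -> v x = 0}.
Proof.
move=> /(in_L2P oO)[mv _].
have msq := measurable_sq mv.
have := @ae_eq_integral_abs _ _ _ mu setT measurableT _ msq.
rewrite (_ : (\int[mu]_(x in setT) `| ((v \_ Omega) x ^+ 2)%:E |)%E = sqint mu (v \_ Omega)); last first.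
  by apply: eq_integral => x _; rewrite gee0_abs// lee_fin sqr_ge0.
move=> ->; split; apply: filterS => x.
  by move=> /(_ Logic.I)[] /eqP; rewrite sqrf_eq0 => /eqP + Ox; rewrite ext_in.
move=> h _ /=; have [Ox|nO] := pselect (Omega x); first by rewrite ext_in// h// expr0n.
by rewrite ext_out// expr0n.
Qed.

Lemma norm2_le_ae v M : measurable_fun Omega v -> 0 <= M ->
  {ae mu, forall x, Omega x -> `|v x| <= M} ->
  (norm2 Omega v <= (M * Num.sqrt (fine (mu Omega)))%:E)%E.
Proof.
move=> mv M0 aeM; pose L := fine (mu Omega).
have muE : mu Omega = L%:E by rewrite fineK// ge0_fin_numE// mu_bounded_lty.
have L0 : 0 <= L by exact: fine_ge0.
rewrite norm2_le ?mulr_ge0// ?sqrtr_ge0// exprMn sqr_sqrtr//.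
have mvO : measurable_fun setT (v \_ Omega) by exact/(measurable_restrictT _ mO).
apply: (@le_trans _ _ (\int[mu]_x ((M ^+ 2)%:E * (\1_Omega x)%:E))%E); last first.
  rewrite ge0_integralZl//; last by rewrite lee_fin sqr_ge0.
    rewrite integral_indic// setIT (EFinM (M ^+ 2)); apply: lee_wpmul2l.
      by rewrite lee_fin sqr_ge0.
    by have := lexx (mu Omega); rewrite {2}muE.
  by apply/measurable_EFinP; exact: measurable_indic.
apply: ae_ge0_le_integral => //.
- by move=> x _; rewrite lee_fin sqr_ge0.
- exact: measurable_sq.
- by move=> x _; rewrite -EFinM lee_fin mulr_ge0// sqr_ge0.
- by apply: measurable_funeM; apply/measurable_EFinP; exact: measurable_indic.
move: aeM; apply: filterS => x h _; rewrite -EFinM lee_fin indicE.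
have [Ox|nO] := pselect (Omega x); last by rewrite ext_out// expr0n/= mulr_ge0// sqr_ge0.
by rewrite mem_set// mulr1 ext_in// -[leLHS]real_normK ?num_real// lerXn2r ?nnegrE ?h.
Qed.

Lemma sobolev_in_L2 m v : sobolev Omega m v -> in_L2 Omega v.
Proof. by case: m => [|m] []. Qed.

Lemma sobolevW m v : sobolev Omega m.+1 v -> sobolev Omega m v.
Proof.
elim: m v => [v []//|m IHm v [gv h]]; split => // i.
by have [w vw sw] := h i; exists w => //; exact: IHm.
Qed.

Lemma sobolevB m v w : sobolev Omega m v -> sobolev Omega m w -> sobolev Omega m (v \- w).
Proof.
elim: m v w => [|m IHm] v w [gv hv] [gw hw]; split => //; try exact: in_L2B.
move=> i; have [v' vv' sv'] := hv i; have [w' ww' sw'] := hw i.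
exists (v' \- w'); last exact: IHm.
have gv' := sobolev_in_L2 sv'; have gw' := sobolev_in_L2 sw'; exact: weak_partialB.
Qed.

Lemma sobolev_wpartial m i v : sobolev Omega m.+1 v ->
  in_L2 Omega (wpartial Omega i v) /\ weak_partial Omega i v (wpartial Omega i v).
Proof.
move=> [gv /(_ i)[w vw sw]]; apply: wpartialP; exists w => //.
exact: sobolev_in_L2 sw.
Qed.

End weak_derivatives.

(** * Membership in H^1_0 and the weak Laplacian of a difference *)

Section zero_trace.
Variables (R : realType) (n : nat) (Omega : set 'rV[R]_n).
Hypotheses (oO : open Omega) (bO : bounded_set Omega).
Notation E := 'rV[R]_n.
Notation mu := (lebesgue_rV R n).
Implicit Types (x : E) (v w phi z : E -> R) (i : 'I_n).
Let mO : measurable Omega := measurable_Omega oO.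

Lemma test_ext phi : test_function Omega phi -> phi \_ Omega = phi.
Proof.
move=> tp; apply/funext => x; have [Ox|nO] := pselect (Omega x); first by rewrite ext_in.
by rewrite ext_out// (test_notin tp).
Qed.

Lemma weak_partial_test i phi : test_function Omega phi -> weak_partial Omega i phi (partial i phi).
Proof.
move=> tp; apply: weak_partial_C1 => // x _.
- exact: test_continuous tp.
- by have [] := test_is_derive i x tp.
- exact: (@test_partial_continuous _ _ _ phi i x tp).
Qed.

Lemma norm2_sum (f : 'I_n -> E -> R) c : (forall i, in_L2 Omega (f i)) ->
  (forall i, (sqint mu (f i \_ Omega) <= c%:E)%E) ->
  (sqint mu ((fun x => Num.sqrt (\sum_i f i x ^+ 2))%R \_ Omega) <= (n%:R * c)%:E)%E.
Proof.
move=> gf Qf.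
rewrite /sqint (eq_integral (fun x => \sum_i ((f i \_ Omega) x ^+ 2)%:E)%E); last first.
  move=> x _; rewrite sumEFin; congr EFin; have [Ox|nO] := pselect (Omega x).
    rewrite ext_in// sqr_sqrtr; last by apply: sumr_ge0 => i _; exact: sqr_ge0.
    by apply: eq_bigr => i _; rewrite ext_in.
  by rewrite ext_out// expr0n big1// => i _; rewrite ext_out// expr0n.
rewrite ge0_integral_sum//; last 2 first.
- by move=> i; apply: measurable_sq; have [] := (in_L2P oO (f i)).1 (gf i).
- by move=> i x _; rewrite lee_fin sqr_ge0.
apply: (@le_trans _ _ (\sum_(i < n) c%:E)%E); first by apply: lee_sum => i _; exact: Qf.
by rewrite sumEFin lee_fin sumr_const card_ord mulr_natl.
Qed.

(** The approximating test functions have gradients close to [z], the part of the gradient where [v]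
    is nonzero. Passing to the limit makes [z] itself a weak gradient of [v], so the gradients of
    [v - phi] are small as well. *)
Lemma zero_trace_sobolev10 v : {within closure Omega, continuous v} ->
  (forall x, bdry Omega x -> v x = 0) -> sobolev Omega 1 v -> sobolev10 Omega v.
Proof.
move=> cv v0 sv; split=> // e e0.
have gv := sobolev_in_L2 sv.
pose w i := wpartial Omega i v.
have gw i : in_L2 Omega (w i) by have [] := sobolev_wpartial i sv.
have vw i : weak_partial Omega i v (w i) by have [] := sobolev_wpartial i sv.
pose z i := nonzero_part v w i.
have gz i : in_L2 Omega (z i).
  apply/(in_L2P oO); split; first exact: measurable_nonzero_part.
  have [mw Qw] := (in_L2P oO (w i)).1 (gw i).
  apply: le_lt_trans Qw; apply: le_sqint => //; first exact: measurable_nonzero_part.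
  by move=> x; rewrite nonzero_part_extE; case: ifP; rewrite ?normr0.
have approx (c : R) : 0 < c -> exists phi, [/\ test_function Omega phi,
    (sqint mu ((v \- phi)%R \_ Omega) <= c%:E)%E &
    forall i, (sqint mu ((z i \- partial i phi)%R \_ Omega) <= c%:E)%E].
  move=> c0; have [phi [tp Q1 Q2]] := zero_trace_approx oO bO cv v0 gv gw vw c0.
  exists phi; split => // [|i].
    rewrite (_ : _ \_ _ = (fun x => (v \_ Omega) x - phi x)); first exact: Q1.
    by apply/funext => x; rewrite extB (test_ext tp).
  rewrite (_ : _ \_ _ = (fun x => (z i \_ Omega) x - partial i phi x)); first exact: Q2.
  by apply/funext => x; rewrite extB (test_ext (test_partial i tp)).
have vz i : weak_partial Omega i v (z i).
  apply: weak_partial_lim => // c c0; have [phi [tp Q1 Q2]] := approx c c0.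
  exists phi, (partial i phi); split => //.
  - exact: (in_L2_test oO bO tp).
  - exact: (in_L2_test oO bO (test_partial i tp)).
  - exact: weak_partial_test.
(* Each of the two terms of [normH1] gets [e / 3], which leaves a strict inequality. The squared
   gradient norm is at most [n] times [2 * c], hence the divisor [2 * n + 1] in [c], positive also
   for [n = 0]. *)
pose d := e / 3; have d0 : 0 < d by rewrite divr_gt0.
pose c := d ^+ 2 / (2 * n%:R + 1).
have N0 : 0 < 2 * n%:R + 1 :> R by rewrite ltr_wpDl// mulr_ge0.
have c0 : 0 < c by rewrite divr_gt0// exprn_gt0.
have cE : c * (2 * n%:R + 1) = d ^+ 2 by rewrite /c divfK// gt_eqF.
have [phi [tp Q1 Q2]] := approx c c0; exists phi => //.
have gp := in_L2_test oO bO tp.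
have gdp i := in_L2_test oO bO (test_partial i tp).
have gvp : in_L2 Omega (v \- phi) by exact: in_L2B.
have wp i : weak_partial Omega i (v \- phi) (z i \- partial i phi).
  by apply: weak_partialB => //; exact: weak_partial_test.
have [gq wq] : (forall i, in_L2 Omega (wpartial Omega i (v \- phi))) /\
    (forall i, weak_partial Omega i (v \- phi) (wpartial Omega i (v \- phi))).
  by split=> i; have [] : _ /\ _ := @wpartialP _ _ _ i (v \- phi) (ex_intro2 _ _ _ (in_L2B oO (gz i) (gdp i)) (wp i)).
have Q3 i : (sqint mu (wpartial Omega i (v \- phi)%R \_ Omega) <= (2 * c)%:E)%E.
  have gB := in_L2B oO (gz i) (gdp i).
  (* The representative picked by [wpartial] differs from [z i - partial i phi] by a null function;
     splitting off this zero term costs the factor 2. *)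
  have u0 := weak_partial_unique oO bO gvp (gq i) gB (wq i) (wp i).
  rewrite (_ : 2 * c = 2 * (0 + c)); last by rewrite add0r.
  have [m1 _] := (in_L2P oO _).1 (gq i); have [m2 _] := (in_L2P oO _).1 gB.
  have [m3 _] := (in_L2P oO _).1 (in_L2B oO (gq i) gB).
  apply: (sqint_split m1 m3 m2) (Q2 i) => [x|]; last by rewrite u0.
  by rewrite extB subrK.
rewrite /normH1; apply: (@le_lt_trans _ _ (d%:E + d%:E)%E); last first.
  by rewrite -EFinD lte_fin /d; lra.
apply: leeD.
  rewrite (norm2_le _ _ (ltW d0)); apply: le_trans Q1 _; rewrite lee_fin -cE.
  by rewrite -[leLHS]mulr1 (ler_wpM2l (ltW c0))// lerDr mulr_ge0.
rewrite /norm2_grad (norm2_le _ _ (ltW d0)); apply: le_trans (norm2_sum gq Q3) _.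
by rewrite lee_fin -cE -subr_ge0 (_ : _ - _ = c) ?ltW//; ring.
Qed.

Lemma sqint_subrr v : sqint mu ((v \- v)%R \_ Omega) = 0%E.
Proof. by rewrite /sqint integral0_eq// => x _; rewrite extB subrr expr0n. Qed.

(** [sobolev] only promises that some weak derivative [p'] of [u] is differentiable again. A given
    weak derivative [p], in particular the one chosen by [wpartial], equals [p'] almost everywhere
    and inherits this. *)
Lemma wpartialP_congr i u p : sobolev Omega 2 u -> in_L2 Omega p -> weak_partial Omega i u p ->
  in_L2 Omega (wpartial Omega i p) /\ weak_partial Omega i p (wpartial Omega i p).
Proof.
move=> [gu /(_ i)[p' up' sp']] gp up; have gp' := sobolev_in_L2 (sp' : sobolev Omega 1 p').
have [g'' w''] := sobolev_wpartial i (sp' : sobolev Omega 1 p').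
apply: wpartialP; exists (wpartial Omega i p') => //.
exact: (weak_partial_congr oO bO gp gp' g'' g'' (weak_partial_unique oO bO gu gp gp' up up')
  (sqint_subrr _) w'').
Qed.

(** Both applications of [wpartial] involve a choice, so each order of differentiation needs
    uniqueness once, and the equality holds only almost everywhere. *)
Lemma wlaplacian_sub u s : sobolev Omega 2 u ->
  in_L2 Omega s -> (forall i, in_L2 Omega (partial i s)) ->
  (forall i, in_L2 Omega (partial i (partial i s))) ->
  (forall i, weak_partial Omega i s (partial i s)) ->
  (forall i, weak_partial Omega i (partial i s) (partial i (partial i s))) ->
  {ae mu, forall x, Omega x ->
    wlaplacian Omega (u \- s) x = wlaplacian Omega u x - laplacian s x}.
Proof.
move=> su gs gs1 gs2 ws1 ws2.
have key i : {ae mu, forall x, Omega x ->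
    wpartial Omega i (wpartial Omega i (u \- s)) x -
    (wpartial Omega i (wpartial Omega i u) x - partial i (partial i s) x) = 0}.
  have gu := sobolev_in_L2 su.
  have [g1 w1] := sobolev_wpartial i su.
  have gB := in_L2B oO gu gs.
  have wB1 := weak_partialB oO bO gu g1 gs (gs1 i) w1 (ws1 i).
  have [g3 w3] := wpartialP (ex_intro2 _ _ _ (in_L2B oO g1 (gs1 i)) wB1).
  have [g2 w2] := wpartialP_congr su g1 w1.
  (* The chosen representatives are generalized: only their membership in L^2 and their weak
     derivative property matter from here. *)
  move: (wpartial Omega i (u \- s)) g3 w3 => q g3 w3.
  move: (wpartial Omega i u) g1 w1 g2 w2 wB1 => p g1 w1 g2 w2 wB1.
  move: (wpartial Omega i p) g2 w2 => p' g2 w2.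
  have gB1 := in_L2B oO g1 (gs1 i).
  have u1 := weak_partial_unique oO bO gB g3 gB1 w3 wB1.
  have gB2 := in_L2B oO g2 (gs2 i).
  have wB2 := weak_partialB oO bO g1 g2 (gs1 i) (gs2 i) w2 (ws2 i).
  have wB2' : weak_partial Omega i q (p' \- partial i (partial i s)).
    exact: (weak_partial_congr oO bO g3 gB1 gB2 gB2 u1 (sqint_subrr _) wB2).
  have [g4 w4] := wpartialP (ex_intro2 _ _ _ gB2 wB2').
  move: (wpartial Omega i q) g4 w4 => q' g4 w4.
  have u2 := weak_partial_unique oO bO g3 g4 gB2 w4 wB2'.
  exact/(sqint_eq0_ae oO (in_L2B oO g4 gB2)).
have : \forall x \ae mu, forall i, Omega x ->
    wpartial Omega i (wpartial Omega i (u \- s)) x -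
    (wpartial Omega i (wpartial Omega i u) x - partial i (partial i s) x) = 0.
  exact: filter_forall.
apply: filterS => x h Ox; rewrite /wlaplacian /laplacian -sumrB.
by apply: eq_bigr => i _; apply/eqP; rewrite -subr_eq0 h.
Qed.

End zero_trace.

(** * Polynomials on simplices *)

Section homogeneous_polynomials.
Variables (R : realType) (d : nat).
Notation B := 'rV[R]_d.+1.
Implicit Types (b : B) (g h : B -> R) (m : nat) (k : 'I_d.+1).

(** Homogeneous polynomial functions, described by how they are generated instead of by
    coefficients; bounds, continuity, derivatives and monomial expansions then come by induction. *)
Inductive homog : nat -> (B -> R) -> Prop :=
| hom_cst c : homog 0 (fun=> c)
| hom_var m k g : homog m g -> homog m.+1 (fun b => b ord0 k * g b)
| hom_add m g h : homog m g -> homog m h -> homog m (fun b => g b + h b).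

Lemma hom_eq m g h : g =1 h -> homog m g -> homog m h.
Proof. by move=> /funext ->. Qed.

Lemma hom_scale m c g : homog m g -> homog m (fun b => c * g b).
Proof.
elim=> [a|{}m k {}g _ ih|{}m {}g h _ ig _ ih]; first exact: hom_cst.
- by apply: hom_eq (hom_var k ih) => b; rewrite mulrCA.
- by apply: hom_eq (hom_add ig ih) => b; rewrite mulrDr.
Qed.

Lemma hom0 m : homog m (fun=> 0).
Proof.
elim: m => [|m ih]; first exact: hom_cst.
by apply: hom_eq (hom_var ord0 ih) => b; rewrite mulr0.
Qed.

Lemma hom_bigsum m (I : Type) (r : seq I) (F : I -> B -> R) :
  (forall i, homog m (F i)) -> homog m (fun b => \sum_(i <- r) F i b).
Proof.
move=> hF; elim: r => [|i r ih]; first by apply: hom_eq (hom0 m) => b; rewrite big_nil.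
by apply: hom_eq (hom_add (hF i) ih) => b; rewrite big_cons.
Qed.

Lemma hom_mul m m' g h : homog m g -> homog m' h -> homog (m + m') (fun b => g b * h b).
Proof.
move=> hg hh; elim: hg => [c|{}m k {}g _ ih|{}m {}g g' _ ig _ ih].
- exact: hom_scale.
- by apply: hom_eq (hom_var k ih) => b; rewrite mulrA.
- by apply: hom_eq (hom_add ig ih) => b; rewrite mulrDl.
Qed.

Lemma hom_coord k : homog 1 (fun b => b ord0 k).
Proof. by apply: hom_eq (hom_var k (hom_cst 1)) => b; rewrite mulr1. Qed.

Definition coord_sum b : R := \sum_k b ord0 k.

Lemma hom_coord_sum : homog 1 coord_sum.
Proof. by apply: hom_bigsum => k; exact: hom_coord. Qed.

Lemma hom_prod (I : Type) (r : seq I) (M : I -> nat) (F : I -> B -> R) :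
  (forall i, homog (M i) (F i)) -> homog (\sum_(i <- r) M i) (fun b => \prod_(i <- r) F i b).
Proof.
move=> hF; elim: r => [|i r ih].
  by rewrite big_nil; apply: hom_eq (hom_cst 1) => b; rewrite big_nil.
by rewrite big_cons; apply: hom_eq (hom_mul (hF i) ih) => b; rewrite big_cons.
Qed.

Lemma hom_exp m g j : homog m g -> homog (m * j) (fun b => g b ^+ j).
Proof.
move=> hg; elim: j => [|j ih]; first by rewrite muln0; exact: hom_cst.
by rewrite mulnS; apply: hom_eq (hom_mul hg ih) => b; rewrite exprS.
Qed.

(* [g] and its homogenizations agree on the hyperplane [coord_sum b = 1]. *)
Lemma hom_widen m m' g : (m <= m')%N -> homog m g ->
  exists2 h, homog m' h & forall b, coord_sum b = 1 -> h b = g b.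
Proof.
move=> mm' hg; exists (fun b => coord_sum b ^+ (m' - m) * g b) => [|b ->]; last by rewrite expr1n mul1r.
rewrite -{1}(subnK mm'); apply: hom_mul => //.
by rewrite -[X in homog X _]mul1n; exact: hom_exp hom_coord_sum.
Qed.

Lemma hom_bounded m g : homog m g ->
  exists2 M, 0 <= M & forall b, (forall k, 0 <= b ord0 k <= 1) -> `|g b| <= M.
Proof.
elim=> [c|{}m k {}g _ [M M0 ih]|{}m {}g h _ [M M0 ig] _ [M' M'0 ih]].
- by exists `|c|.
- exists M => // b hb; have /andP[b0 b1] := hb k.
  by rewrite normrM (ger0_norm b0) -[leRHS]mul1r ler_pM// ih.
- exists (M + M') => [|b hb]; first exact: addr_ge0.
  by apply: le_trans (ler_normD _ _) _; rewrite lerD ?ig ?ih.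
Qed.

Definition mono (a : 'I_d.+1 -> nat) b : R := \prod_k b ord0 k ^+ a k.

Lemma multi_index_of (a : 'I_d.+1 -> nat) m : (\sum_k a k)%N = m ->
  exists c : multi_index d m, forall k, val c k = a k :> nat.
Proof.
move=> am; have ale k : (a k < m.+1)%N by rewrite ltnS -am (bigD1 k)//= leq_addr.
pose f : {ffun 'I_d.+1 -> 'I_m.+1} := [ffun k => Ordinal (ale k)].
have fm : (\sum_k (f k : nat))%N == m.
  by apply/eqP; apply: etrans am; apply: eq_bigr => k _; rewrite ffunE.
by exists (exist _ f fm) => k /=; rewrite ffunE.
Qed.

Lemma hom_mono m (c : multi_index d m) : homog m (mono (fun k => val c k)).
Proof.
rewrite -[X in homog X _](eqP (valP c)); apply: hom_prod => k.
by rewrite -[X in homog X _]mul1n; apply: hom_exp; exact: hom_coord.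
Qed.

(** Recovers coefficients from the inductive description. They make the Lagrange functions and the
    monomials comparable through square matrices in [hom_interpolation]. *)
Lemma hom_span m g : homog m g -> exists F : multi_index d m -> R,
  forall b, g b = \sum_c F c * mono (fun k => val c k) b.
Proof.
have spanD (I : finType) m' (h : I -> B -> R) : (forall i, exists F : multi_index d m' -> R,
    forall b, h i b = \sum_c F c * mono (fun k => val c k) b) ->
    exists F : multi_index d m' -> R,
    forall b, \sum_i h i b = \sum_c F c * mono (fun k => val c k) b.
  move=> /choice[F HF]; exists (fun c => \sum_i F i c) => b.
  under eq_bigr do rewrite HF.
  by rewrite exchange_big; apply: eq_bigr => c _; rewrite mulr_suml.
have single m' (a : 'I_d.+1 -> nat) r : (\sum_k a k)%N = m' -> exists F : multi_index d m' -> R,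
    forall b, r * mono a b = \sum_c F c * mono (fun k => val c k) b.
  move=> /multi_index_of[c hc]; exists (fun c' => if c' == c then r else 0) => b.
  rewrite (bigD1 c)//= eqxx big1 ?addr0; last by move=> c' /negPf ->; rewrite mul0r.
  by congr (_ * _); apply: eq_bigr => k _; rewrite hc.
elim=> [r|{}m k {}g _ [F HF]|{}m {}g h _ [F HF] _ [G HG]].
- have [|F HF] := single 0%N (fun=> 0%N) r; first by rewrite big1.
  by exists F => b; rewrite -HF /mono big1 ?mulr1.
- pose a (c : multi_index d m) j := (val c j + (j == k))%N.
  have [|G HG] := spanD _ m.+1 (fun (c : multi_index d m) b => F c * mono (a c) b).
    move=> c; apply: single; rewrite big_split/= (eqP (valP c)).
    by rewrite (bigD1 k)//= eqxx big1 ?addn0 ?addn1// => j /negPf ->.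
  exists G => b; rewrite -HG HF mulr_sumr; apply: eq_bigr => c _.
  rewrite mulrCA; congr (_ * _); rewrite /mono (bigD1 k)//= [RHS](bigD1 k)//= mulrA.
  rewrite /a eqxx addn1 exprS; congr (_ * _).
  by apply: eq_bigr => j /negPf ->; rewrite addn0.
- exists (fun c => F c + G c) => b; rewrite HF HG -big_split/=.
  by apply: eq_bigr => c _; rewrite mulrDl.
Qed.

Section interpolation.
Variable m : nat.
Hypothesis m0 : (0 < m)%N.
Notation I := (multi_index d m).

Definition grid_point (c : I) : B := \row_k ((val c k)%:R / m%:R).

Lemma grid_point_coord_sum c : coord_sum (grid_point c) = 1.
Proof.
rewrite /coord_sum; under eq_bigr do rewrite mxE.
by rewrite -mulr_suml -natr_sum (eqP (valP c)) divff// pnatr_eq0 -lt0n.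
Qed.

(* [m b_k - j] vanishes at the grid points with [k]-th index [j]; the factor [coord_sum b],
   equal to 1 on barycentric coordinates, makes the product homogeneous of degree [m]. *)
Definition lagrange (a : I) b : R :=
  \prod_k \prod_(j < val a k) ((m%:R * b ord0 k - j%:R * coord_sum b) / (val a k - j)%:R).

Lemma hom_lagrange a : homog m (lagrange a).
Proof.
rewrite -[X in homog X _](eqP (valP a)); apply: hom_prod => k.
rewrite -[X in homog X _]muln1 -[X in (X * 1)%N]card_ord -sum_nat_const; apply: hom_prod => j.
apply: (@hom_eq _ (fun b => (m%:R / (val a k - j)%:R) * b ord0 k +
  (- j%:R / (val a k - j)%:R) * coord_sum b)); last first.
  by apply: hom_add; apply: hom_scale; [exact: hom_coord|exact: hom_coord_sum].
by move=> b; rewrite mulrBl mulNr; congr (_ + _); [rewrite mulrAC|rewrite mulNr mulrAC].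
Qed.

(** For [a = c] every factor is 1. Otherwise the equal totals force some [k] with [c k < a k], and
    the factor with [j = c k] vanishes. *)
Lemma lagrange_grid a c : lagrange a (grid_point c) = (a == c)%:R.
Proof.
have mm (x : R) : m%:R * (x / m%:R) = x by rewrite mulrCA divff ?mulr1// pnatr_eq0 -lt0n.
rewrite /lagrange grid_point_coord_sum; have [->|ac] := eqVneq a c.
  rewrite big1// => k _; rewrite big1// => j _; rewrite mxE mulr1.
  have q : (val c k - j)%:R != 0 :> R by rewrite pnatr_eq0 subn_eq0 -ltnNge.
  rewrite (mm (val c k)%:R) -(natrB _ (ltnW (ltn_ord j))); exact: divff.
have [k ck] : exists k, (val c k < val a k)%N.
  apply/existsP; rewrite -[X in is_true X]negbK negb_exists; apply/negP => /forallP h.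
  case/eqP: ac; apply/val_inj/ffunP => k; apply/val_inj/eqP.
  have le j : (val a j <= val c j)%N by rewrite leqNgt.
  have := etrans (eqP (valP a)) (esym (eqP (valP c))).
  rewrite (bigD1 k)//= [X in _ = X -> _](bigD1 k)//= => E.
  have lk : (\sum_(i < d.+1 | i != k) val a i <= \sum_(i < d.+1 | i != k) val c i)%N.
    by apply: leq_sum => i _; exact: le.
  by rewrite eqn_leq le -(leq_add2r (\sum_(i < d.+1 | i != k) val c i)) -E leq_add2l.
rewrite (bigD1 k)//= (bigD1 (Ordinal ck))//= mxE mulr1.
by rewrite (mm (val c k)%:R) subrr !mul0r.
Qed.

(* The matrix [L] of the Lagrange polynomials in the monomials and the matrix [V] of the values
   of the monomials at the grid points are square with [L V = 1], hence [V L = 1]. *)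
Lemma hom_interpolation g b : homog m g ->
  g b = \sum_(c : I) g (grid_point c) * lagrange c b.
Proof.
pose N := #|{: I}|.
have /choice[F HF] : forall a : I, exists F : I -> R, forall b,
    lagrange a b = \sum_c F c * mono (fun k => val c k) b.
  by move=> a; apply: hom_span; exact: hom_lagrange.
pose ev (i : 'I_N) : I := enum_val i; pose rk (c : I) : 'I_N := enum_rank c.
have evK i : rk (ev i) = i by exact: enum_valK.
have rkK c : ev (rk c) = c by exact: enum_rankK.
have reindexI (G : I -> R) : \sum_p G p = \sum_i G (ev i).
  rewrite (reindex_onto ev rk)/=; last by move=> p _; rewrite rkK.
  by apply: eq_bigl => p; rewrite evK eqxx.
pose L : 'M[R]_N := \matrix_(i, j) F (ev i) (ev j).
pose V : 'M[R]_N := \matrix_(i, j) mono (fun k => val (ev i) k) (grid_point (ev j)).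
have /mulmx1C VL : L *m V = 1%:M.
  apply/matrixP => i j; rewrite !mxE.
  have := lagrange_grid (ev i) (ev j); rewrite (inj_eq (can_inj evK)) => <-.
  by rewrite HF reindexI; apply: eq_bigr => c _; rewrite !mxE.
have monoE (c : I) : mono (fun k => val c k) b =
    \sum_p mono (fun k => val c k) (grid_point p) * lagrange p b.
  rewrite reindexI; under eq_bigr do rewrite HF reindexI mulr_sumr.
  rewrite exchange_big/=.
  transitivity (\sum_j (1%:M : 'M[R]_N) (rk c) j * mono (fun k => val (ev j) k) b).
    rewrite (bigD1 (rk c))//= mxE eqxx mul1r rkK big1 ?addr0// => j jc.
    by rewrite mxE eq_sym (negPf jc) mul0r.
  apply: eq_bigr => j _; rewrite -VL mxE mulr_suml; apply: eq_bigr => i _.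
  by rewrite !mxE rkK mulrA.
move=> /hom_span[G HG]; under eq_bigr do rewrite HG mulr_suml.
rewrite exchange_big/= HG; apply: eq_bigr => c _; rewrite monoE mulr_sumr.
by apply: eq_bigr => p _; rewrite mulrA.
Qed.

(** There are [m] factors in all, the entries of [a] summing to [m]. Each has a numerator between
    [-m] and [m] and a denominator at least 1. *)
Lemma lagrange_bound a b : (forall k, 0 <= b ord0 k) -> coord_sum b = 1 ->
  `|lagrange a b| <= m%:R ^+ m.
Proof.
move=> b0 b1; rewrite /lagrange normr_prod.
have bk k : b ord0 k <= 1.
  by rewrite -b1 /coord_sum (bigD1 k)//= lerDl sumr_ge0.
have -> : m%:R ^+ m = \prod_k m%:R ^+ (val a k) :> R.
  by rewrite prodrXr (eqP (valP a)).
apply: ler_prod => k _; rewrite normr_ge0 normr_prod/=.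
have -> : m%:R ^+ val a k = \prod_(j < val a k) m%:R :> R by rewrite prodr_const card_ord.
apply: ler_prod => j _.
rewrite normr_ge0 b1 mulr1 normrM/= normfV [X in _ / X]ger0_norm//.
have q1 : 1 <= (val a k - j)%:R :> R by rewrite ler1n subn_gt0.
rewrite ler_pdivrMr; last exact: lt_le_trans q1.
apply: (@le_trans _ _ m%:R); last by rewrite ler_peMr.
have jm : j%:R <= m%:R :> R.
  by rewrite ler_nat; apply: leq_trans (ltnW (ltn_ord j)) _; rewrite -ltnS.
have := b0 k; have := bk k; have : 0 <= j%:R :> R by [].
have mb0 : 0 <= m%:R * b ord0 k by rewrite mulr_ge0.
have mb1 : m%:R * b ord0 k <= m%:R by rewrite ler_piMr.
rewrite ler_norml => *; apply/andP; split; lra.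
Qed.

Lemma hom_bound g b M : homog m g -> (forall k, 0 <= b ord0 k) -> coord_sum b = 1 ->
  (forall c, `|g (grid_point c)| <= M) -> `|g b| <= #|{: I}|%:R * m%:R ^+ m * M.
Proof.
move=> hg b0 b1 hM; rewrite (hom_interpolation b hg); apply: le_trans (ler_norm_sum _ _ _) _.
rewrite -mulrA mulr_natl -sumr_const; apply: ler_sum => c _.
by rewrite normrM mulrC ler_pM// lagrange_bound.
Qed.

End interpolation.

Lemma hom_bernstein m (a : multi_index d m) : homog m (bernstein a).
Proof. by apply: hom_scale; exact: hom_mono. Qed.

End homogeneous_polynomials.

Lemma entry_le_enorm (R : realType) m n (M : 'M[R]_(m, n)) i j : `|M i j| <= enorm M.
Proof.
rewrite -sqrtr_sqr ler_wsqrtr// (bigD1 i)//= (bigD1 j)//= -addrA lerDl addr_ge0//.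
  by apply: sumr_ge0 => k _; exact: sqr_ge0.
by apply: sumr_ge0 => k _; apply: sumr_ge0 => l _; exact: sqr_ge0.
Qed.

(** * Barycentric coordinates on a simplex *)

Section barycentric_coordinates.
Variables (R : realType) (d : nat) (T : 'M[R]_(d.+1, d)).
Hypothesis hT : affine_mx T \in unitmx.
Notation E := 'rV[R]_d.
Notation bary := (barycentric T).
Implicit Types (x y v : E) (k : 'I_d.+1).

Lemma bary_affine x : coord_sum (bary x) = 1 /\ bary x *m T = x.
Proof.
have : bary x *m affine_mx T = row_mx (const_mx 1 : 'rV[R]_1) x by rewrite /barycentric mulmxKV.
rewrite [LHS](mul_mx_row (bary x) (const_mx 1 : 'cV[R]_d.+1) T) => /(@eq_row_mx _ 1 1 d _ _ _ _)[h ->]; split => //.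
have := congr1 (fun M : 'rV[R]_1 => M ord0 ord0) h; rewrite [LHS]mxE [RHS]mxE => <-.
by apply: eq_bigr => k _; rewrite [X in _ = _ * X]mxE mulr1.
Qed.

Lemma bary_unique x (w : 'rV[R]_d.+1) : coord_sum w = 1 -> w *m T = x -> bary x = w.
Proof.
move=> w1 wT; rewrite /barycentric; apply: canLR (mulmxK hT) _.
rewrite [RHS](mul_mx_row w (const_mx 1 : 'cV[R]_d.+1) T) wT.
suff -> : w *m (const_mx 1 : 'cV[R]_d.+1) = const_mx 1 by [].
apply/rowP => j; rewrite [LHS]mxE [RHS]mxE -[RHS]w1.
by apply: eq_bigr => k _; rewrite mxE mulr1.
Qed.

Lemma bary_comb n (P : 'M[R]_(n, d)) (w : 'rV[R]_n) : \sum_i w ord0 i = 1 ->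
  bary (w *m P) = \sum_i w ord0 i *: bary (row i P).
Proof.
move=> w1; apply: bary_unique.
  rewrite /coord_sum; under eq_bigr do rewrite summxE.
  rewrite exchange_big/= -w1; apply: eq_bigr => i _.
  under eq_bigr do rewrite mxE.
  by rewrite -mulr_sumr [X in _ * X](bary_affine (row i P)).1 mulr1.
rewrite mulmx_suml mulmx_sum_row; apply: eq_bigr => i _.
by rewrite -scalemxAl (bary_affine _).2.
Qed.

Lemma bary_vertex k : bary (row k T) = delta_mx ord0 k.
Proof.
apply: bary_unique; last by rewrite rowE.
rewrite /coord_sum (bigD1 k)//= mxE !eqxx big1 ?addr0// => j /negPf jk.
by rewrite mxE jk andbF.
Qed.

(** Barycentric coordinates respect convex combinations and are unit vectors at the vertices;
    conversely they are themselves the weights of such a combination. *)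
Lemma bodyP x : body T x <-> forall k, 0 <= bary x ord0 k.
Proof.
split=> [[n [P [w [PT w0 w1 ->]]]] k|h].
  rewrite bary_comb// summxE sumr_ge0// => i _; have [l _ <-] := PT i.
  by rewrite mxE mulr_ge0// bary_vertex mxE; case: (_ && _).
exists d.+1, T, (bary x); split => // [k||]; first by exists k.
  exact: (bary_affine x).1.
by rewrite (bary_affine x).2.
Qed.

(** The linear part of the affine map [barycentric T]. *)
Definition bary_dir v : 'rV[R]_d.+1 := (row_mx (const_mx 0 : 'rV[R]_1) v : 'rV[R]_d.+1) *m invmx (affine_mx T).

Lemma bary_line (t : R) v x : bary (t *: v + x) = t *: bary_dir v + bary x.
Proof.
rewrite /barycentric /bary_dir scalemxAl -mulmxDl; congr (_ *m _).
rewrite (scale_row_mx t (const_mx 0 : 'rV[R]_1) v) (add_row_mx _ _ (const_mx 1 : 'rV[R]_1)).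
suff -> : t *: (const_mx 0 : 'rV[R]_1) + const_mx 1 = const_mx 1 by [].
by apply/rowP => j; rewrite !mxE mulr0 add0r.
Qed.

Lemma bary_dir_sub x y : bary_dir (y - x) = bary y - bary x.
Proof.
by have := bary_line 1 (y - x) x; rewrite !scale1r subrK => ->; rewrite addrK.
Qed.

Lemma bary_dir_sum v : bary_dir v = \sum_j v ord0 j *: bary_dir (delta_mx ord0 j).
Proof.
have d0 : bary_dir 0 = 0 by have := bary_dir_sub 0 0; rewrite !subrr.
have lin (t : R) u w : bary_dir (t *: u + w) = t *: bary_dir u + bary_dir w.
  have := bary_dir_sub 0 (t *: u + w); rewrite subr0 bary_line => ->.
  by have := bary_dir_sub 0 w; rewrite subr0 -addrA => <-.
rewrite [in LHS](row_sum_delta v) -[X in X = _]addr0.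
elim: (index_enum _) => [|j s ih]; first by rewrite !big_nil d0 addr0.
by rewrite !big_cons lin -addrA ih.
Qed.

Lemma is_derive_bary v x k :
  is_derive x v (fun y => bary y ord0 k) (bary_dir v ord0 k).
Proof.
apply/is_derive_line0.
have -> : (fun s : R => bary (s *: v + x) ord0 k) =
    (fun s : R => bary_dir v ord0 k * s + bary x ord0 k).
  by apply/funext => s; rewrite bary_line !mxE mulrC.
apply: (is_derive_eqr (is_derive_add (is_derive_scale (bary_dir v ord0 k) (is_derive_id (0 : R) 1))
  (is_derive_const (0 : R) 1 (bary x ord0 k)))).
by rewrite mulr1 addr0.
Qed.

Lemma bary_continuous x k : {for x, continuous (fun y => bary y ord0 k)}.
Proof.
apply: (@lipschitz_continuous_at _ _ _ (\sum_j `|bary_dir (delta_mx ord0 j) ord0 k|)) => y.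
rewrite (_ : _ - _ = bary_dir (y - x) ord0 k); last by rewrite bary_dir_sub !mxE.
rewrite bary_dir_sum summxE mulr_suml; apply: le_trans (ler_norm_sum _ _ _) _.
apply: ler_sum => j _; rewrite mxE normrM mulrC ler_wpM2l//.
exact: coord_norm_le.
Qed.

Lemma hom_bary_continuous m g x : homog m g -> {for x, continuous (fun y => g (bary y))}.
Proof.
elim=> [c|{}m k {}g _ ih|{}m {}g h _ ig _ ih]; first exact: cst_continuous.
- by apply: continuousM => //; exact: bary_continuous.
- exact: continuousD.
Qed.

(** Differentiation would lower the degree; the lost factor is replaced by [coord_sum], equal to 1
    on barycentric coordinates, so a Laplacian keeps the degree of the spline. *)
Lemma hom_is_derive m g i : homog m g -> exists2 g', homog m g' &
  forall x, is_derive x (delta_mx ord0 i) (fun y => g (bary y)) (g' (bary x)).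
Proof.
elim=> [c|{}m k {}g hg [g' hg' dg]|{}m {}g h _ [g' hg' dg] _ [h' hh' dh]].
- by exists (fun=> 0) => [|x]; [exact: hom0|exact: is_derive_const].
- pose r := bary_dir (delta_mx ord0 i) ord0 k.
  exists (fun b : 'rV[R]_d.+1 => b ord0 k * g' b + r * (coord_sum b * g b)) => [|x].
    apply: hom_add; first exact: hom_var.
    by apply: hom_scale; by rewrite -[m.+1]/(1 + m)%N; apply: hom_mul => //; exact: hom_coord_sum.
  apply: is_derive_eqr (is_derive_mul (is_derive_bary _ _ _) (dg x)) _.
  by rewrite (bary_affine x).1 mul1r /r [g _ * _]mulrC.
- exists (fun b => g' b + h' b) => [|x]; first exact: hom_add.
  exact: is_derive_add.
Qed.

Definition inner : set E := [set x | forall k, 0 < bary x ord0 k].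

Lemma inner_body x : inner x -> body T x.
Proof. by move=> h; apply/bodyP => k; exact: ltW. Qed.

Lemma near_inner x : inner x -> \forall y \near x, inner y.
Proof.
move=> h; apply: (@filter_forall _ _ (fun k y => 0 < bary y ord0 k) (nbhs x) (nbhs_filter x)) => k.
by have /cvgr_gt/(_ _ (h k)) := bary_continuous (x := x) (k := k).
Qed.

Lemma near_notin_body x : ~ body T x -> \forall y \near x, ~ body T y.
Proof.
move=> /bodyP/existsNP[k /negP]; rewrite -ltNge => h.
have /cvgr_lt/(_ _ h) := bary_continuous (x := x) (k := k).
by apply: filterS => y hy /bodyP/(_ k); rewrite leNgt hy.
Qed.

(** A small move from [x] towards the barycentre, whose coordinates are all [1 / (d+1)], makes every
    coordinate positive. *)
Lemma body_closure_inner x : body T x -> closure inner x.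
Proof.
move=> /bodyP bx B /nbhs_ballP[e /= e0 eB].
pose w : 'rV[R]_d.+1 := const_mx d.+1%:R^-1.
pose c := w *m T; have bc : bary c = w.
  apply: bary_unique => //; rewrite /coord_sum.
  under eq_bigr do rewrite mxE; rewrite sumr_const card_ord -[LHS]mulr_natl.
  by rewrite divff// pnatr_eq0.
pose t := Num.min 1 (e / (2 * (`|c - x| + 1))).
have N0 : 0 < 2 * (`|c - x| + 1) by rewrite mulr_gt0// ltr_wpDl.
have t0 : 0 < t by rewrite lt_min ltr01 divr_gt0.
have t1 : t <= 1 by rewrite ge_min lexx.
exists (t *: (c - x) + x); split.
  move=> k; rewrite bary_line bary_dir_sub bc.
  have -> : (t *: (w - bary x) + bary x) ord0 k = t * (d.+1%:R^-1 - bary x ord0 k) + bary x ord0 k.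
    by move: (bary x) => z; rewrite !mxE.
  have := bx k; have : 0 < d.+1%:R^-1 :> R by rewrite invr_gt0.
  move: (d.+1%:R^-1) (bary x ord0 k) => a b a0 b0.
  rewrite (_ : _ + _ = t * a + (1 - t) * b); last by ring.
  by rewrite ltr_pwDl ?mulr_gt0// mulr_ge0// subr_ge0.
apply: eB; rewrite -ball_normE/= opprD addrCA subrr addr0 normrN normrZ gtr0_norm//.
apply: (@le_lt_trans _ _ (e / (2 * (`|c - x| + 1)) * `|c - x|)).
  by rewrite ler_wpM2r// ge_min lexx orbT.
rewrite mulrAC ltr_pdivrMr// ltr_pM2l// mulrDr mulr1.
by have : 0 <= `|c - x| by []; lra.
Qed.

(** The difference [x - y] is a convex combination of the differences of vertices, with weights the
    products of the barycentric coordinates of [x] and [y]. *)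
Lemma body_diam x y : body T x -> body T y -> `|x - y| <= longest_edge T.
Proof.
move=> /bodyP bx /bodyP by_.
have edge k l j : `|T k j - T l j| <= longest_edge T.
  apply: (@le_trans _ _ (enorm (row k T - row l T))).
    by have := entry_le_enorm (row k T - row l T) ord0 j; rewrite !mxE.
  rewrite /longest_edge; apply: le_trans (le_bigmax _ _ k).
  exact: (le_bigmax _ (fun l => enorm (row k T - row l T))).
have L0 : 0 <= longest_edge T by rewrite /longest_edge; exact: bigmax_ge_id.
apply: rV_norm_le => // j.
have xE (z : E) : z ord0 j = \sum_k bary z ord0 k * T k j.
  by rewrite -{1}(bary_affine z).2 mxE.
have [sx _] := bary_affine x; have [sy _] := bary_affine y.
have -> : (x - y) ord0 j = \sum_k \sum_l bary x ord0 k * bary y ord0 l * (T k j - T l j).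
  rewrite !mxE (xE x) (xE y).
  under [RHS]eq_bigr do under eq_bigr do rewrite mulrBr.
  under [RHS]eq_bigr do rewrite sumrB.
  rewrite sumrB; congr (_ - _).
    apply: eq_bigr => k _; rewrite -mulr_suml -mulr_sumr.
    by rewrite -/(coord_sum (bary y)) sy mulr1.
  rewrite exchange_big/=; apply: eq_bigr => l _; rewrite -mulr_suml -mulr_suml.
  by rewrite -/(coord_sum (bary x)) sx mul1r.
apply: le_trans (ler_norm_sum _ _ _) _.
apply: (@le_trans _ _ (\sum_k \sum_l bary x ord0 k * bary y ord0 l * longest_edge T)).
  apply: ler_sum => k _; apply: le_trans (ler_norm_sum _ _ _) _.
  apply: ler_sum => l _; rewrite normrM ger0_norm ?mulr_ge0//.
  by rewrite ler_wpM2l// mulr_ge0.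
under eq_bigr do rewrite -mulr_suml -mulr_sumr.
rewrite -mulr_suml -mulr_suml.
by rewrite -/(coord_sum (bary x)) -/(coord_sum (bary y)) sx sy !mul1r.
Qed.

Lemma bary_domain_point m (a : multi_index d m) : (0 < m)%N ->
  bary (domain_point T a) = grid_point R a.
Proof.
move=> m0; apply: bary_unique; first exact: grid_point_coord_sum.
rewrite mulmx_sum_row /domain_point scaler_sumr; apply: eq_bigr => k _.
by rewrite mxE scalerA mulrC.
Qed.

Lemma bary_le1 x k : body T x -> 0 <= bary x ord0 k <= 1.
Proof.
move=> /bodyP bx; rewrite bx -(bary_affine x).1 /coord_sum (bigD1 k)//= lerDl.
by rewrite sumr_ge0.
Qed.

Lemma body_domain_point m (a : multi_index d m) : (0 < m)%N -> body T (domain_point T a).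
Proof.
by move=> m0; apply/bodyP => k; rewrite bary_domain_point// mxE divr_ge0.
Qed.

End barycentric_coordinates.

Lemma continuous_eq_closure (R : realType) (V : normedModType R) (f g : V -> R) (S : set V) x :
  {for x, continuous f} -> {for x, continuous g} -> (forall y, S y -> f y = g y) ->
  closure S x -> f x = g x.
Proof.
move=> cf cg fg Sx; apply/eqP; rewrite -subr_eq0 -normr_le0; apply/ler_addgt0Pr => e e0.
rewrite add0r.
have c : {for x, continuous (fun y => f y - g y)} by exact: continuousB.
have /cvgrPdist_lt/(_ e e0)/Sx[y [Sy /=]] := c.
by rewrite (fg y Sy) subrr subr0 => /ltW.
Qed.

(** * Splines *)

Section piecewise_polynomials.
Variables (R : realType) (d : nat) (Omega : set 'rV[R]_d) (n : nat) (T : 'I_n -> 'M[R]_(d.+1, d)).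
Hypotheses (oO : open Omega) (bO : bounded_set Omega)
  (uT : forall k, affine_mx (T k) \in unitmx)
  (OT : closure Omega = \bigcup_k body (T k)).
Notation E := 'rV[R]_d.
Implicit Types (x y : E) (s : E -> R) (p : 'I_n -> E -> R) (k : 'I_n) (i : 'I_d) (m : nat).

(** Piecewise polynomials of degree at most [m], without reference to Bernstein coefficients, so
    that the notion is stable under differentiation. *)
Definition pieces m s p := (forall k, exists2 g, homog m g & forall x, p k x = g (barycentric (T k) x)) /\
  forall k x, body (T k) x -> Omega x -> s x = p k x.

Lemma piece_continuous m s p k x : pieces m s p -> {for x, continuous (p k)}.
Proof.
move=> [/(_ k)[g hg pg] _]; have -> : p k = (fun y => g (barycentric (T k) y)) by exact/funext.
exact: hom_bary_continuous hg.
Qed.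

(** Inside a simplex [s] coincides with its piece near each point, hence so do the derivatives. The
    other points of the simplex in [Omega] are limits of such points, and both derivatives are
    continuous there. *)
Lemma pieces_partial m s p i : pieces m s p ->
  (forall x, Omega x -> {for x, continuous (partial i s)}) ->
  pieces m (partial i s) (fun k => partial i (p k)).
Proof.
move=> sp cs; have hp k : exists2 g, homog m g & forall x, partial i (p k) x = g (barycentric (T k) x).
  have [/(_ k)[g hg pg] _] := sp; have [g' hg' dg] := hom_is_derive (uT k) i hg.
  exists g' => // x; have -> : p k = (fun y => g (barycentric (T k) y)) by exact/funext.
  by have [_ <-] := dg x.
split => // k x bx Ox.
apply: (@continuous_eq_closure _ _ _ _ (inner (T k) `&` Omega)).
- exact: cs.
- have [g hg pg] := hp k.
  have -> : partial i (p k) = (fun y => g (barycentric (T k) y)) by exact/funext.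
  exact: hom_bary_continuous hg.
- move=> y [iy Oy]; rewrite /partial; apply: near_eq_derive.
  have nO : \forall z \near y, Omega z by exact: open_nbhs_nbhs.
  have := near_inner iy; apply: filterS2 nO => z Oz iz.
  by apply: sp.2 => //; exact: (inner_body (uT k)).
- move=> B nB; have nO : nbhs x Omega by exact: open_nbhs_nbhs.
  have [y [iy [Oy By]]] := body_closure_inner (uT k) bx (filterI nO nB).
  by exists y.
Qed.

Lemma body_cover x : closure Omega x -> exists k, body (T k) x.
Proof. by rewrite OT => -[k _ bx]; exists k. Qed.

Lemma pieces_bounded m s p : pieces m s p -> exists2 M, 0 <= M & forall x, Omega x -> `|s x| <= M.
Proof.
move=> [hp sp].
have /choice[M HM] : forall k, exists M, 0 <= M /\ forall x, body (T k) x -> `|p k x| <= M.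
  move=> k; have [g hg pg] := hp k; have [M M0 HM] := hom_bounded hg.
  by exists M; split => // x bx; rewrite pg; apply: HM => l; exact: bary_le1.
exists (\sum_k M k) => [|x Ox]; first by apply: sumr_ge0 => k _; exact: (HM k).1.
have [k bx] := body_cover (subset_closure Ox); rewrite (sp k)//.
apply: le_trans ((HM k).2 x bx) _; rewrite (bigD1 k)//= lerDl.
by apply: sumr_ge0 => l _; exact: (HM l).1.
Qed.

Lemma pieces_in_L2 m s p : pieces m s p -> (forall x, Omega x -> {for x, continuous s}) ->
  in_L2 Omega s.
Proof.
move=> /pieces_bounded[M M0 HM] cs.
have ms : measurable_fun Omega s by exact: open_continuous_measurable_rV.
split => //; apply: le_lt_trans (norm2_le_ae oO bO ms M0 _) (ltry _).
exact: aeW.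
Qed.

(** Gluing on a finite closed cover: near [x] only the simplices containing [x] occur, and on each
    of them [s] is a polynomial. *)
Lemma pieces_within_continuous m s p : pieces m s p ->
  (forall k x, body (T k) x -> s x = p k x) -> {within closure Omega, continuous s}.
Proof.
move=> hp sp; apply/subspace_continuousP => x cx; apply/cvgrPdist_lt => e e0.
have H : \forall y \near x, forall k, body (T k) y -> `|s x - s y| < e.
  apply: (@filter_forall _ _ (fun k y => body (T k) y -> `|s x - s y| < e) (nbhs x) (nbhs_filter x)) => k.
  have [bx|nbx] := pselect (body (T k) x).
    have /cvgrPdist_lt/(_ e e0) := piece_continuous (k := k) (x := x) hp.
    by apply: filterS => y h by_; rewrite !(sp k).
  by have := near_notin_body (uT k) nbx; apply: filterS.
rewrite near_withinE; apply: filterS H => y H cy.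
by have [k by_] := body_cover cy; exact: H by_.
Qed.

Section laplacian.
Variables (m : nat) (s : E -> R) (p : 'I_n -> E -> R).
Hypotheses (sp : pieces m s p)
  (cs1 : forall i x, Omega x -> {for x, continuous (partial i s)})
  (cs2 : forall i x, Omega x -> {for x, continuous (partial i (partial i s))}).

Lemma pieces_laplacian : pieces m (laplacian s) (fun k => laplacian (p k)).
Proof.
have sp2 i := pieces_partial (pieces_partial sp (cs1 (i := i))) (cs2 (i := i)).
split=> [k|k x bx Ox]; last by apply: eq_bigr => i _; apply: (sp2 i).2.
have /choice[g hg] : forall i, exists g, homog m g /\ forall x,
    partial i (partial i (p k)) x = g (barycentric (T k) x).
  by move=> i; have [g ? ?] := (sp2 i).1 k; exists g.
exists (fun b => \sum_i g i b) => [|x]; first by apply: hom_bigsum => i; exact: (hg i).1.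
by apply: eq_bigr => i _; exact: (hg i).2.
Qed.

(* Near [x] the datum [f] is almost the constant [f x], so the polynomial
   [laplacian (p k) + f x] is small at the domain points of degree [m']. *)
Lemma laplacian_bound m' f (r e : R) : (0 < m')%N -> (m <= m')%N ->
  (forall x y, closure Omega x -> closure Omega y -> `|x - y| < r -> `|f x - f y| < e) ->
  mesh_size T < r ->
  (forall k (a : multi_index d m'),
    `|laplacian (p k) (domain_point (T k) a) + f (domain_point (T k) a)| <= e) ->
  forall x, Omega x ->
    `|f x + laplacian s x| <= #|{: multi_index d m'}|%:R * m'%:R ^+ m' * (2 * e).
Proof.
move=> m'0 mm' fr Tr he x Ox; have cx := subset_closure Ox.
have [k bx] := body_cover cx; rewrite (pieces_laplacian.2 k)//.
have [g hg pg] := pieces_laplacian.1 k.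
have [g' hg' gg'] := hom_widen mm' hg.
(* The constant [f x] is homogenized to degree [m'] to fit the interpolation bound. *)
pose h b := g' b + f x * coord_sum b ^+ m'.
have hh : homog m' h.
  apply: hom_add => //; apply: hom_scale; rewrite -[X in homog X _]mul1n.
  by apply: hom_exp; exact: hom_coord_sum.
have hE y : h (barycentric (T k) y) = laplacian (p k) y + f x.
  have [s1 _] := bary_affine (uT k) y.
  by rewrite /h s1 expr1n mulr1 gg'// pg.
rewrite addrC -hE; apply: hom_bound => //.
- exact/(bodyP (uT k)).
- exact: (bary_affine (uT k) x).1.
move=> a; rewrite -(bary_domain_point (uT k) a m'0) hE.
set y := domain_point _ _; have by_ : body (T k) y by exact: body_domain_point.
have cy : closure Omega y by rewrite OT; exists k.
(* The factor 2 in the bound: one [e] from the nodal hypothesis, one from the oscillation of [f]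
   between [x] and the node. *)
rewrite (_ : _ + _ = (laplacian (p k) y + f y) + (f x - f y)); last by ring.
apply: le_trans (ler_normD _ _) _; rewrite mulr2n mulrDl mul1r lerD//; first exact: he.
apply/ltW/fr => //; apply: le_lt_trans Tr.
apply: le_trans (body_diam (uT k) bx by_) _.
exact: (le_bigmax _ (fun k => longest_edge (T k))).
Qed.

End laplacian.

End piecewise_polynomials.

Lemma piece_pieces (R : realType) (d : nat) (Omega : set 'rV[R]_d) n
    (T : 'I_n -> 'M[R]_(d.+1, d)) D (c : 'cV[R]_#|node d n D|) (s : 'rV[R]_d -> R) :
  represents T c setT s -> pieces Omega T D s (piece T c).
Proof.
move=> cs; split=> [k|k x bx _]; last exact: cs.
exists (fun b => \sum_(a : multi_index d D) c (enum_rank ((k, a) : node d n D)) ord0 * bernstein a b) => //.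
by apply: hom_bigsum => a; apply: hom_scale; exact: hom_bernstein.
Qed.

(** The constraint bounds a Euclidean norm of unnormalized nodal residuals, hence every single
    residual, whatever the number of simplices. *)
Lemma feasible_node (R : realType) (d n D D' : nat) (T : 'I_n -> 'M[R]_(d.+1, d))
    (K : 'M[R]_(#|node d n D'|, #|node d n D|)) (f : 'rV[R]_d -> R) (eps : R) (c : 'cV[R]_#|node d n D|) :
  laplace_matrix T K -> feasible eps K (node_values T D' f) c ->
  forall k (a : multi_index d D'),
    `|laplacian (piece T c k) (domain_point (T k) a) + f (domain_point (T k) a)| <= eps.
Proof.
move=> hK hc k a; apply: le_trans hc.
have := entry_le_enorm (K *m c + node_values T D' f) (enum_rank ((k, a) : node d n D')) ord0.
by rewrite mxE hK mxE enum_rankK.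
Qed.

Lemma compact_closure_bounded (R : realType) (n : nat) (S : set 'rV[R]_n) :
  bounded_set S -> compact (closure S).
Proof.
move=> /bounded_norm[M M0 SM]; have cK := @compact_cbox R n (const_mx (- M)) (const_mx M).
have clK : closed (cbox (const_mx (- M) : 'rV[R]_n) (const_mx M)).
  by apply: compact_closed => //; exact: norm_hausdorff.
apply: (subclosed_compact _ cK); first exact: closed_closure.
rewrite [X in _ `<=` X](closure_id _).1//; apply: closure_subset => x Sx i.
by rewrite !mxE -ler_norml; apply: le_trans (SM x Sx); exact: coord_norm_le.
Qed.

Theorem theorem5 (R : realType) (d : nat) (hd : (2 <= d)%N)
  (Omega : set 'rV[R]_d) (hOmega : polygonal_domain Omega)
  (r_Omega : R) (hr_Omega : 0 < r_Omega)
  (hreach : uniformly_positive_reach (closure Omega) r_Omega)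
  (r D D' : nat) (hr : (2 <= r)%N)
  (hD2 : d = 2%N -> (3 * r + 2 <= D)%N) (hD3 : d = 3%N -> (6 * r + 3 <= D)%N)
  (hDD' : (D < D')%N)
  (A : R) (hA0 : 0 < A)
  (hA : forall v : 'rV[R]_d -> R, sobolev Omega 2 v -> sobolev10 Omega v ->
     (A%:E * normH2 Omega v <= norm2 Omega (wlaplacian Omega v))%E) :
  exists2 C : R, 0 < C &
  forall (kappa alpha beta gamma : R),
    0 < alpha -> 0 < beta -> 0 < gamma ->
  forall (f g u : 'rV[R]_d -> R),
    {within closure Omega, continuous f} ->
    {within closure Omega, continuous g} ->
    sobolev Omega 3 u ->
    poisson_solution Omega f g u ->
  forall eps1 : R, 0 < eps1 ->
  exists2 h : R, 0 < h &
  forall (n : nat) (T : 'I_n -> 'M[R]_(d.+1, d)),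
    is_triangulation Omega T -> quasi_uniform T kappa -> mesh_size T < h ->
  forall (m0 mr : nat)
    (H0 : 'M[R]_(m0, #|node d n D|)) (Hr : 'M[R]_(mr, #|node d n D|))
    (K : 'M[R]_(#|node d n D'|, #|node d n D|))
    (B : 'M[R]_(#|bdry_nodes Omega T D'|, #|node d n D|)),
    smoothness_matrix Omega T 0 H0 -> smoothness_matrix Omega T r Hr ->
    laplace_matrix T K -> bdry_matrix B ->
  forall (c : 'cV[R]_#|node d n D|) (us : 'rV[R]_d -> R),
    spline_solution alpha beta gamma eps1 H0 Hr K B
      (node_values T D' f) (bdry_values Omega T D' g) c ->
    represents T c setT us -> Ck r Omega us ->
    (forall x, bdry Omega x -> u x - us x = 0) ->
  [/\ sobolev Omega 2 (u \- us),
      (norm2 Omega (u \- us)%R <= (C * eps1)%:E)%E,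
      (norm2_grad Omega (u \- us)%R <= (C * eps1)%:E)%E &
      (norm2_hess Omega (u \- us)%R <= (C * eps1)%:E)%E].
Proof.
have [oO _ _ bO _] := hOmega.
pose mu := lebesgue_rV R d; pose C1 : R := #|{: multi_index d D'}|%:R * D'%:R ^+ D'.
pose S := Num.sqrt (fine (mu Omega)).
have C10 : 0 <= C1 by rewrite mulr_ge0// exprn_ge0.
have Q0 : 0 <= C1 * 2 * S / A by rewrite divr_ge0 ?(ltW hA0)// mulr_ge0 ?sqrtr_ge0// mulr_ge0.
(* The summand 1 makes the constant positive without a lower bound on [S]. *)
exists (C1 * 2 * S / A + 1); first by rewrite ltr_wpDl.
move=> kappa alpha beta gamma _ _ _ f g u cf cg su [cu ueq _] e e0.
(* The mesh threshold: on simplices smaller than [rr] the datum [f] oscillates by less than the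
   tolerance. *)
have [rr rr0 fr] := compact_unif_continuous (compact_closure_bounded bO) cf e0.
exists rr => // n T [uT OT _ _] _ Tr m0 mr H0 Hr K B _ _ hK _ c us [hc _] cs Cus us0.
have sp := piece_pieces Omega cs.
have m0' : (0 < D')%N by exact: leq_ltn_trans hDD'.
(* Writing the smoothness order as [r.+2] unfolds two levels of [Ck], which yield classical second
   derivatives continuous in [Omega]. *)
case: r hr Cus {hD2 hD3} => [//|[//|r]] _ Cus.
have c0 x : Omega x -> {for x, continuous us} by have [h _] := Cus; exact: h.
have d0 i x : Omega x -> derivable us x (delta_mx ord0 i) by have [_ /(_ i)[h _]] := Cus; exact: h.
have c1 i x : Omega x -> {for x, continuous (partial i us)}.
  by have [_ /(_ i)[_ [h _]]] := Cus; exact: h.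
have d1 i j x : Omega x -> derivable (partial i us) x (delta_mx ord0 j).
  by have [_ /(_ i)[_ [_ /(_ j)[h _]]]] := Cus; exact: h.
have c2 i j x : Omega x -> {for x, continuous (partial j (partial i us))}.
  have [_ /(_ i)[_ [_ /(_ j)[_]]]] := Cus.
  by case: (r) => [|?] [h _]; exact: h.
have sp1 i := pieces_partial oO uT sp (c1 i).
have sp2 i j := pieces_partial oO uT (sp1 i) (c2 i j).
have g0 := pieces_in_L2 oO bO uT OT sp c0.
have g1 i := pieces_in_L2 oO bO uT OT (sp1 i) (c1 i).
have g2 i j := pieces_in_L2 oO bO uT OT (sp2 i j) (c2 i j).
have w1 i := weak_partial_C1 oO c0 (d0 i) (c1 i).
have w2 i j := weak_partial_C1 oO (c1 i) (d1 i j) (c2 i j).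
have sus : sobolev Omega 2 us.
  split=> // i; exists (partial i us) => //; split=> // j.
  by exists (partial j (partial i us)).
have su2 : sobolev Omega 2 u by exact: sobolevW.
have sv : sobolev Omega 2 (u \- us) by exact: sobolevB.
have cv : {within closure Omega, continuous (u \- us)}.
  (* [Ck] speaks of [Omega] only; continuity up to the boundary comes from the polynomial pieces,
     which represent [us] on entire simplices. *)
  have cus := pieces_within_continuous uT OT sp (fun k x bx => cs k x bx Logic.I).
  by move=> x; apply: continuousB; [exact: cu|exact: cus].
have s10 : sobolev10 Omega (u \- us).
  by apply: zero_trace_sobolev10 => //; exact: sobolevW.
have bound := laplacian_bound oO uT OT sp (fun i => c1 i) (fun i => c2 i i) m0' (ltnW hDD')
  fr Tr (feasible_node hK hc).
have Lv : (norm2 Omega (wlaplacian Omega (u \- us)%R) <= (C1 * (2 * e) * S)%:E)%E.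
  apply: norm2_le_ae => //.
  - apply: measurable_sum => i; have [gi wi] := sobolev_wpartial i sv.
    by have [[]] := wpartialP_congr oO bO sv gi wi.
  - by rewrite mulr_ge0// mulr_ge0// ltW.
  - have := wlaplacian_sub oO bO su2 g0 g1 (fun i => g2 i i) w1 (fun i => w2 i i).
    move: ueq; apply: filterS2 => x h1 h2 Ox.
    (* Up to sign, the weak Laplacian of [u - us] is [f] plus the classical Laplacian of [us], the
       quantity estimated in [bound]. *)
    rewrite h2// -normrN opprB addrC.
    by have := bound x Ox; rewrite -(h1 Ox) addrC.
have n0 (w : 'rV[R]_d -> R) : (0 <= norm2 Omega w)%E by exact: Lnorm_ge0.
have h0 : (0 <= norm2_hess Omega (u \- us)%R)%E by apply: sume_ge0 => i _; apply: sume_ge0.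
have H2 : (normH2 Omega (u \- us)%R <= ((C1 * 2 * S / A + 1) * e)%:E)%E.
  have := le_trans (hA _ sv s10) Lv.
  rewrite muleC -lee_pdivlMr// => /le_trans; apply.
  (* The two bounds differ by exactly [e], the contribution of the summand 1. *)
  by rewrite -EFinM lee_fin -subr_ge0 (_ : _ - _ = e) ?ltW//; ring.
have ng0 : (0 <= norm2_grad Omega (u \- us)%R)%E by exact: n0.
(* Each of the three quantities is a summand of [normH2], whose summands are nonnegative. *)
split => //; apply: le_trans H2; rewrite /normH2.
- by rewrite -addeA leeDl// adde_ge0.
- by rewrite addeAC leeDr// adde_ge0.
- by rewrite leeDr// adde_ge0.
Qed.
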